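(* Let $K\subset\mathbb{R}^{d}$ be a regular self-similar set satisfying the open set condition (OSC) with $\dim_M K<d$. Suppose that the complement $K^c$ of $K$ has a bounded connected component. Then $\tilde s_{0}(K)\ge\dim_M K$.
   Context: **Self-similar sets.** Let $N\ge 2$ and let $S_1,\dots,S_N:\mathbb{R}^d\to\mathbb{R}^d$ be contracting similarities with ratios $r_i\in(0,1)$. The self-similar set generated by $\{S_1,\dots,S_N\}$ is the unique nonempty compact set $K$ with $K=\bigcup_i S_iK$. It satisfies OSC if there is a nonempty open set $O$ with $\bigcup_i S_iO\subset O$ and $S_iO\cap S_jO=\emptyset$ for $i\ne j$. $\dim_M$ denotes Minkowski (box) dimension (it exists for such $K$). **Curvature-direction measure $\widetilde C_0$.** For a closed set $X\subset\mathbb{R}^d$ of positive reach (Federer) let $\mathrm{nor}\,X=\{(x,n): x\in\partial X,\ n\in S^{d-1}\cap\mathrm{Nor}(X,x)\}$, $\mathrm{Nor}(X,x)$ being the polar cone of the tangent cone of $X$ at $x$. For $\mathcal H^{d-1}$-a.e. $(x,n)\in\mathrm{nor}\,X$ there are generalized principal curvatures $\kappa_i(x,n)\in(-\infty,\infty]$ and orthonormal principal directions $a_i(x,n)$, $i=1,\dots,d-1$, such that the vectors $\left(\frac{a_i}{\sqrt{1+\kappa_i^2}},\frac{\kappa_ia_i}{\sqrt{1+\kappa_i^2}}\right)$ (equal to $(0,a_i)$ if $\kappa_i=\infty$) form an orthonormal basis of the tangent space of $\mathrm{nor}\,X$ at $(x,n)$. For Borel $\beta\subset\mathbb{R}^d\times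 S^{d-1}$ put $$\widetilde C_0(X,\beta)=\frac1{\mathcal H^{d-1}(S^{d-1})}\int_{\mathrm{nor}\,X}\mathbf 1_\beta(x,n)\prod_{i=1}^{d-1}\frac{\kappa_i(x,n)}{\sqrt{1+\kappa_i(x,n)^2}}\,d\mathcal H^{d-1}(x,n)$$ (a factor is $1$ if $\kappa_i=\infty$). For bounded $F\subset\mathbb{R}^d$ let $F_\varepsilon=\{y:\mathrm{dist}(y,F)\le\varepsilon\}$. A value $\varepsilon>0$ is regular for $F$ if the closure $\widetilde{F_\varepsilon}$ of the complement of $F_\varepsilon$ has positive reach and $\partial F_\varepsilon$ is a Lipschitz manifold. For regular $\varepsilon$ put $\widetilde C_0(F_\varepsilon,\cdot):=(-1)^{d-1}\widetilde C_0(\widetilde{F_\varepsilon},\rho(\cdot))$ with $\rho(x,n)=(x,-n)$, and let $\widetilde C_0^{\mathrm{var}}(F_\varepsilon)$ be the total mass of its total variation measure. A set $K$ is called regular if Lebesgue-almost all $\varepsilon>0$ are regular for $K$. **Scaling exponent.** $\tilde s_0(F):=\inf\{s\ge0:\ \mathrm{ess\,lim}_{\varepsilon\to0}\,\varepsilon^{s}\widetilde C_0^{\mathrm{var}}(F_\varepsilon)=0\}$ (with $\inf\emptyset=\infty$), where the essential limit means the limit after discarding a Lebesgue null set of $\varepsilon$'s. *)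

(* Defs.v *)
From HB Require Import structures.
From mathcomp Require Import all_boot all_order all_algebra.
From mathcomp Require Import all_classical all_reals all_analysis.

Set Implicit Arguments.
Unset Strict Implicit.
Unset Printing Implicit Defensive.

Import Order.TTheory GRing.Theory Num.Theory.
Import numFieldNormedType.Exports.

Local Open Scope classical_set_scope.
Local Open Scope ring_scope.

(* R^n is 'rV[R]_n. The library norm on matrices is the sup norm: it induces  *)
(* the usual topology and bounded sets, but all metric notions below must use *)
(* the Euclidean norm.                                                        *)
Section Norm.
Context {R : realType} {n : nat}.
Implicit Types u v : 'rV[R]_n.

Definition dot u v : R := \sum_(i < n) u 0 i * v 0 i.

Definition enorm u : R := Num.sqrt (dot u u).

End Norm.

Section Euclidean.
Context {R : realType} {n : nat}.
Implicit Types (u v x y : 'rV[R]_n) (A F : set 'rV[R]_n).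

Definition usphere : set 'rV[R]_n := [set u | enorm u = 1].

(* -oo on the empty set *)
Definition ediam A : \bar R :=
  ereal_sup [set (enorm (x - y))%:E | x in A & y in A].

Definition infdist y F : R := inf [set enorm (y - x) | x in F].

Definition parallel_set F (e : R) : set 'rV[R]_n :=
  [set y | infdist y F <= e].

Definition frontier A : set 'rV[R]_n := closure A `\` A°.

Definition similarity (r : R) (S : 'rV[R]_n -> 'rV[R]_n) :=
  forall x y, enorm (S x - S y) = r * enorm (x - y).

(* cone of all limits of t_k (b_k - a), with t_k > 0, b_k in A and b_k --> a *)
Definition tangent_cone A (a : 'rV[R]_n) : set 'rV[R]_n :=
  [set u | forall e : R, 0 < e -> exists b t,
     [/\ A b, 0 < t, enorm (b - a) < e & enorm (t *: (b - a) - u) < e]].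

Definition polar_cone (C : set 'rV[R]_n) : set 'rV[R]_n :=
  [set v | forall u, C u -> dot u v <= 0].

Definition positive_reach A := closed A /\
  exists2 r : R, 0 < r & forall y, infdist y A < r ->
    exists! x, A x /\ enorm (y - x) = infdist y A.

Definition lipschitz_manifold (m : nat) (M : set 'rV[R]_n) :=
  forall p, M p -> exists (U : set 'rV[R]_n) (V : set 'rV[R]_m)
      (phi : 'rV[R]_m -> 'rV[R]_n) (L : R),
    [/\ open U /\ U p, open V, phi @` V = M `&` U, 0 < L &
     forall s t, V s -> V t ->
       L^-1 * enorm (s - t) <= enorm (phi s - phi t) <= L * enorm (s - t)].

Definition covering_number F (delta : R) : R :=
  inf [set k%:R | k in [set k : nat | exists A : 'I_k -> set 'rV[R]_n,
    (forall i, (ediam (A i) <= delta%:E)%E) /\ F `<=` \bigcup_i A i]].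

(* Meaningful when the limit exists, as it does for self-similar sets. *)
Definition minkowski_dim F : R :=
  lim ((fun delta : R => ln (covering_number F delta) / - ln delta) @ 0^'+).

End Euclidean.

Section Hausdorff.
Context {R : realType}.

(* Lebesgue measure of the unit ball of R^m *)
Fixpoint vol_ball (m : nat) : R :=
  match m with
  | 0 => 1
  | 1 => 2
  | m'.+2 => 2 * pi / m%:R * vol_ball m'
  end.

Lemma vol_ball_ge0 m : 0 <= vol_ball m.
Proof.
suff : 0 <= vol_ball m /\ 0 <= vol_ball m.+1 by case.
elim: m => [|m [h1 h2]]; first by rewrite /= !ler0n.
split=> //=; apply: mulr_ge0 => //; apply: divr_ge0 => //.
by apply: mulr_ge0 => //; exact: pi_ge0.
Qed.

Context {n : nat}.
Variable m : nat.
Implicit Types (A : set 'rV[R]_n) (delta : R).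
Local Open Scope ereal_scope.

(* Normalized so that the m-dimensional Hausdorff measure of R^m is the       *)
(* Lebesgue measure.                                                          *)
Definition hausdorff_gauge A : \bar R :=
  if `[< A = set0 >] then 0 else (vol_ball m / 2 ^+ m)%:E * ediam A ^+ m.

Definition hausdorff_delta delta A : \bar R :=
  ereal_inf [set \sum_(0 <= k <oo) hausdorff_gauge (B k) | B in
    [set B : (set 'rV[R]_n)^nat |
      (forall k, ediam (B k) <= delta%:E) /\ A `<=` \bigcup_k B k]].

Definition hausdorff A : \bar R :=
  ereal_sup [set hausdorff_delta delta A | delta in [set delta | (0 < delta)%R]].

Let hausdorff_gauge0 : hausdorff_gauge set0 = 0.
Proof. by rewrite /hausdorff_gauge asboolT. Qed.

Let ediam_ge0 A : A !=set0 -> 0 <= ediam A.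
Proof.
move=> [x Ax]; apply: (@le_trans _ _ (enorm (x - x))%:E).
  by rewrite lee_fin sqrtr_ge0.
by apply: ereal_sup_ubound; exists x => //; exists x.
Qed.

Let hausdorff_gauge_ge0 A : 0 <= hausdorff_gauge A.
Proof.
rewrite /hausdorff_gauge; case: asboolP => // /eqP/set0P A0.
apply: mule_ge0; last exact: expe_ge0 (ediam_ge0 A0).
by rewrite lee_fin divr_ge0 ?exprn_ge0 ?vol_ball_ge0.
Qed.

(* The delta-content is the outer measure that the library generates, over    *)
(* the discrete sigma-algebra, from the gauge extended by +oo.                *)
Local Notation allsets := (g_sigma_algebraType [set: set 'rV[R]_n]).

Let gauge_oo delta A : \bar R :=
  if (ediam A <= delta%:E)%E then hausdorff_gauge A else +oo.

Let gauge_oo_ge0 delta A : 0 <= gauge_oo delta A.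
Proof. by rewrite /gauge_oo; case: ifP => // _; rewrite leey. Qed.

Let gauge_oo0 delta : gauge_oo delta set0 = 0.
Proof.
rewrite /gauge_oo hausdorff_gauge0; case: ifPn => //; case/negP.
rewrite (_ : ediam set0 = -oo) ?leNye// /ediam (_ : [set _ | _ in _ & _ in _] = set0).
  by rewrite ereal_sup0.
by apply/seteqP; split=> // ? [].
Qed.

Let hausdorff_deltaE delta : hausdorff_delta delta =
  @mu_ext _ allsets R (gauge_oo delta).
Proof.
apply/funext => A; apply/eqP; rewrite eq_le; apply/andP; split.
  apply: le_ereal_inf_tmp => _ [B [_ AB] <-].
  have [Bd|/existsNP[k /negP Bk]] := pselect (forall k, ediam (B k) <= delta%:E).
    apply: ereal_inf_lbound; exists B => //=.
    by apply: eq_eseriesr => k _; rewrite /gauge_oo Bd.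
  rewrite (_ : limn _ = +oo) ?leey//; apply: (@eseries_pinfty _ _ xpredT k) => //.
    by move=> j _; rewrite gt_eqF// (lt_le_trans _ (gauge_oo_ge0 _ _)).
  by rewrite /gauge_oo (negbTE Bk).
apply: le_ereal_inf_tmp => _ [B [Bd AB] <-].
apply: ereal_inf_lbound; exists B => /=.
  by split=> // k; exact: sub_sigma_algebra.
by apply: eq_eseriesr => k _; rewrite /gauge_oo Bd.
Qed.

Let hausdorff0 : hausdorff set0 = 0.
Proof.
apply/eqP; rewrite eq_le; apply/andP; split.
  apply: ge_ereal_sup => _ [delta _ <-].
  by rewrite hausdorff_deltaE (@mu_ext0 _ allsets _ _ (gauge_oo0 _) (gauge_oo_ge0 _)).
apply: ereal_sup_ubound; exists 1%R => //=.
by rewrite hausdorff_deltaE (@mu_ext0 _ allsets _ _ (gauge_oo0 _) (gauge_oo_ge0 _)).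
Qed.

Let hausdorff_delta_le delta A : (0 < delta)%R ->
  hausdorff_delta delta A <= hausdorff A.
Proof. by move=> d0; apply: ereal_sup_ubound; exists delta. Qed.

Let hausdorff_delta_ge0 delta A : 0 <= hausdorff_delta delta A.
Proof. by rewrite hausdorff_deltaE; exact: (@mu_ext_ge0 _ allsets _ _ (gauge_oo_ge0 _)). Qed.

Let hausdorff_ge0 A : 0 <= hausdorff A.
Proof. exact: le_trans (hausdorff_delta_ge0 1 A) (hausdorff_delta_le _ _). Qed.

Let le_hausdorff : {homo hausdorff : A B / A `<=` B >-> A <= B}.
Proof.
move=> A B AB; apply: ge_ereal_sup => _ [delta /= d0 <-].
apply: le_trans (hausdorff_delta_le B d0).
by rewrite hausdorff_deltaE; exact: (@le_mu_ext _ allsets).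
Qed.

Let hausdorff_sigma_subadditive : sigma_subadditive hausdorff.
Proof.
move=> F; apply: ge_ereal_sup => _ [delta /= d0 <-].
apply: (@le_trans _ _ (\sum_(i <oo) hausdorff_delta delta (F i))).
  rewrite hausdorff_deltaE.
  exact: (@mu_ext_sigma_subadditive _ allsets _ _ (gauge_oo_ge0 _)).
by apply: lee_nneseries => // k _; exact: hausdorff_delta_le.
Qed.

HB.instance Definition _ := isOuterMeasure.Build R 'rV[R]_n hausdorff
  hausdorff0 hausdorff_ge0 le_hausdorff hausdorff_sigma_subadditive.

End Hausdorff.

Section CurvatureDirectionMeasure.
Context {R : realType} {d : nat}.
Implicit Types (X F : set 'rV[R]_d) (p : 'rV[R]_(d + d)).

(* (x, n) in R^d x R^d is encoded as row_mx x n in R^(d + d) *)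
Definition direction_bundle : set 'rV[R]_(d + d) :=
  [set p | usphere (rsubmx p)].

Definition nor X : set 'rV[R]_(d + d) :=
  [set p | [/\ frontier X (lsubmx p), usphere (rsubmx p) &
    polar_cone (tangent_cone X (lsubmx p)) (rsubmx p)]].

(* 1 / sqrt (1 + k^2) and k / sqrt (1 + k^2), at +oo: 0 and 1. *)
Definition curv_cos (k : \bar R) : R :=
  if k is r%:E then (Num.sqrt (1 + r ^+ 2))^-1 else 0.

Definition curv_sin (k : \bar R) : R :=
  if k is r%:E then r / Num.sqrt (1 + r ^+ 2) else 1.

(* Row i of a is the direction a_i. At almost every p the tangent cone of     *)
(* nor X is a (d-1)-dimensional linear space, the tangent space of nor X.     *)
Definition principal_curvatures X p (k : 'I_d.-1 -> \bar R) :=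
  (forall i, k i != -oo%E) /\
  exists a : 'M[R]_(d.-1, d),
    let b := \matrix_(i < d.-1)
      row_mx (curv_cos (k i) *: row i a) (curv_sin (k i) *: row i a) in
    [/\ a *m a^T = 1%:M, b *m b^T = 1%:M &
      tangent_cone (nor X) p = [set v | (v <= b)%MS]].

(* The product does not depend on the family chosen by xget; families can     *)
(* only fail to exist on an H^(d-1)-null subset of nor X.                     *)
Definition curv_density X p : R :=
  \prod_(i < d.-1) curv_sin (xget (fun=> 0%E) (principal_curvatures X p) i).

(* The integral is over the (complete) sigma-algebra of sets measurable for   *)
(* the outer measure H^(d-1), which contains the Borel sets.                  *)
Definition curv_dir_measure X (beta : set 'rV[R]_(d + d)) : \bar R :=
  let H := @hausdorff R (d + d) d.-1 in
  ((fine (hausdorff d.-1 (@usphere R d)))^-1%:E *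
  \int[H : set (caratheodory_type H) -> \bar R]_(p in nor X)
    (\1_beta p * curv_density X p)%:E)%E.

Definition reflect_normal p : 'rV[R]_(d + d) :=
  row_mx (lsubmx p) (- rsubmx p).

Definition closed_complement F (e : R) : set 'rV[R]_d :=
  closure (~` parallel_set F e).

Definition regular_value F (e : R) := positive_reach (closed_complement F e) /\
  lipschitz_manifold d.-1 (frontier (parallel_set F e)).

Definition regular_set F :=
  {ae @lebesgue_measure R, forall e, 0 < e -> regular_value F e}.

Definition parallel_curv_measure F (e : R) (beta : set 'rV[R]_(d + d)) :
    \bar R :=
  (((-1) ^+ d.-1)%:E *
   curv_dir_measure (closed_complement F e) (reflect_normal @` beta))%E.

Definition variation_mass (mu : set 'rV[R]_(d + d) -> \bar R)
    (D : set 'rV[R]_(d + d)) : \bar R :=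
  ereal_sup [set t | exists (k : nat) (A : 'I_k -> set 'rV[R]_(d + d)),
    [/\ forall i, <<s open >> (A i), trivIset setT A, \bigcup_i A i = D &
     t = \sum_(i < k) `|mu (A i)|]]%E.

Definition curv_variation F (e : R) : \bar R :=
  variation_mass (parallel_curv_measure F e) direction_bundle.

Definition ess_cvg0 (f : R -> \bar R) := exists2 N : set R,
  (@lebesgue_measure R).-negligible N &
  f @ (within (~` N) 0^'+) --> 0%E.

Definition scaling_exponent F : \bar R :=
  ereal_inf [set s%:E | s in [set s : R |
    0 <= s /\ ess_cvg0 (fun e => ((e `^ s)%:E * curv_variation F e)%E)]].

End CurvatureDirectionMeasure.

Section SelfSimilar.
Context {R : realType} {d N : nat}.
Implicit Types (S : 'I_N -> 'rV[R]_d -> 'rV[R]_d) (K O : set 'rV[R]_d).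

Definition self_similar_set S K :=
  [/\ K !=set0, compact K & K = \bigcup_i (S i @` K)].

Definition open_set_condition S := exists O,
  [/\ O !=set0, open O, \bigcup_i (S i @` O) `<=` O &
   trivIset setT (fun i => S i @` O)].

End SelfSimilar.

(* Main.v *)
(* Let V be a bounded component of the complement of K, s < D := dim_M K < d. By
   box counting, for all small e there are at least e^(-s) disjoint images of V
   under compositions of the S_i that are not filled by the e-neighbourhood of K:
   choose a scale rho slightly larger than e and cells of size about rho, pairwise
   rho-separated; a filled image contains a ball that forces (rho/e)^d or so
   e-separated points of K, which is too many for most cells since D < d.
   Let X be the closed complement of K_e and V one of these unfilled holes. Then
   Y = X `&` V is compact and relatively open in X, so the pairs (x, n) with n an
   outer normal at x of the convex hull of Y belong to nor X. There the generalized
   curvatures exist (differentiability of the nearest-point projection, by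
   Rademacher's theorem and Eilenberg's inequality) and are nonnegative. The Gauss
   map (x, n) |-> n sends these pairs onto the whole sphere and has Jacobian the
   curvature density, so the area inequality gives each hole a curvature mass
   bounded below by a constant depending only on d. Hence e^s times the variation
   of C_0(K_e) stays away from 0. *)

From HB Require Import structures.
Require Import Defs.
From mathcomp Require Import all_boot all_order all_algebra.
From mathcomp Require Import all_classical all_reals all_analysis.
From mathcomp Require Import measurable_realfun.
From mathcomp Require Import ring lra zify.
Import Order.TTheory GRing.Theory Num.Theory.
Import numFieldNormedType.Exports.

Set Implicit Arguments.
Unset Strict Implicit.
Unset Printing Implicit Defensive.

Local Open Scope classical_set_scope.
Local Open Scope ring_scope.

(** * Euclidean geometry *)

(** Only an upper bound for the measure of a Gauss image is needed, never an area formula, so crude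
    constants suffice: linear approximations are compared with boxes. Three obstacles shape the
    argument. The normal bundle is (d-1)-dimensional inside 2d-space, while differentiability of the
    projection is known almost everywhere in d-space only; varying the distance [rho] along the
    normals supplies the missing dimension. The integrand [curv_density] uses curvatures chosen by
    [xget], and nothing is known about the regularity of this choice: the integral is bounded
    through simple functions below it, and the properties of the chosen family are re-derived from
    the tangent cone. Finally, null sets are meant for Hausdorff outer measures, and Fubini's
    theorem is replaced by counting cubes that meet a compact set. Convex hulls enter because
    supporting half-spaces force one sign of the density, so nothing cancels within a hole.
    Regularity of [K] and the essential limit both hold up to null sets of radii, so one small
    radius satisfying both gives the contradiction. *)

Section EuclideanBasics.
Context {R : realType} {n : nat}.
Implicit Types u v w x y z : 'rV[R]_n.

Lemma dotC u v : dot u v = dot v u.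
Proof. by apply: eq_bigr => i _; rewrite mulrC. Qed.
Lemma dotDl u v w : dot (u + v) w = dot u w + dot v w.
Proof. by rewrite /dot -big_split; apply: eq_bigr => i _ /=; rewrite mxE mulrDl. Qed.
Lemma dotDr u v w : dot w (u + v) = dot w u + dot w v.
Proof. by rewrite dotC dotDl dotC (dotC v). Qed.
Lemma dotZl a u v : dot (a *: u) v = a * dot u v.
Proof. by rewrite /dot mulr_sumr; apply: eq_bigr => i _ /=; rewrite mxE mulrA. Qed.
Lemma dotZr a u v : dot u (a *: v) = a * dot u v.
Proof. by rewrite dotC dotZl dotC. Qed.
Lemma dotNl u v : dot (- u) v = - dot u v.
Proof. by rewrite -scaleN1r dotZl mulN1r. Qed.
Lemma dotNr u v : dot u (- v) = - dot u v.
Proof. by rewrite dotC dotNl dotC. Qed.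
Lemma dotBl u v w : dot (u - v) w = dot u w - dot v w.
Proof. by rewrite dotDl dotNl. Qed.
Lemma dotBr u v w : dot w (u - v) = dot w u - dot w v.
Proof. by rewrite dotDr dotNr. Qed.
Lemma dot0l u : dot 0 u = 0.
Proof. by rewrite -(scale0r 0) dotZl mul0r. Qed.
Lemma dot0r u : dot u 0 = 0.
Proof. by rewrite dotC dot0l. Qed.
Definition dotE := (dotDl, dotDr, dotBl, dotBr, dotNl, dotNr, dotZl, dotZr).

Lemma dot_mulmx_tr u v : dot u v = (u *m v^T) 0 0.
Proof. by rewrite mxE; apply: eq_bigr => i _; rewrite mxE. Qed.
Lemma dot_ge0 u : 0 <= dot u u.
Proof. by apply: sumr_ge0 => i _; rewrite -expr2 sqr_ge0. Qed.
Lemma enorm_ge0 u : 0 <= enorm u.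
Proof. exact: sqrtr_ge0. Qed.
Hint Resolve enorm_ge0 : core.

Lemma sqr_enorm u : enorm u ^+ 2 = dot u u.
Proof. by rewrite /enorm sqr_sqrtr ?dot_ge0. Qed.
Lemma dot_enorm u : dot u u = enorm u ^+ 2.
Proof. by rewrite sqr_enorm. Qed.
Lemma enorm0 : enorm (0 : 'rV[R]_n) = 0.
Proof. by rewrite /enorm dot0l sqrtr0. Qed.
Lemma coord_le_enorm u i : `|u 0 i| <= enorm u.
Proof.
rewrite -(@ler_pXn2r _ 2) ?nnegrE // sqr_enorm real_normK ?num_real //.
rewrite /dot (bigD1 i) //= -expr2 lerDl; apply: sumr_ge0 => j _.
by rewrite -expr2 sqr_ge0.
Qed.

Lemma enorm_eq0 u : enorm u = 0 -> u = 0.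
Proof.
move=> u0; apply/rowP => i; rewrite mxE; apply/eqP; rewrite -normr_le0 -u0.
exact: coord_le_enorm.
Qed.

Lemma enorm_gt0 u : (0 < enorm u) = (u != 0).
Proof.
rewrite lt_neqAle enorm_ge0 andbT eq_sym; congr negb.
by apply/eqP/eqP => [/enorm_eq0|->]; rewrite ?enorm0.
Qed.

Lemma enormZ a u : enorm (a *: u) = `|a| * enorm u.
Proof. by rewrite /enorm dotZl dotZr mulrA -expr2 sqrtrM ?sqr_ge0 // sqrtr_sqr. Qed.
Lemma enormN u : enorm (- u) = enorm u.
Proof. by rewrite -scaleN1r enormZ normrN1 mul1r. Qed.
Lemma enormBC u v : enorm (u - v) = enorm (v - u).
Proof. by rewrite -enormN opprB. Qed.
Lemma cauchy_schwarz u v : dot u v <= enorm u * enorm v.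
Proof.
have [u0|u0] := eqVneq (enorm u) 0; first by rewrite (enorm_eq0 u0) dot0l enorm0 mul0r.
have [v0|v0] := eqVneq (enorm v) 0; first by rewrite (enorm_eq0 v0) dot0r enorm0 mulr0.
have pu : 0 < enorm u by rewrite lt_neqAle eq_sym u0 /=.
have pv : 0 < enorm v by rewrite lt_neqAle eq_sym v0 /=.
have := dot_ge0 (enorm v *: u - enorm u *: v).
rewrite !dotE (dotC v u) !dot_enorm => h.
have {}h : 0 <= (2 * enorm u * enorm v) * (enorm u * enorm v - dot u v) by nra.
by rewrite -subr_ge0 -(pmulr_rge0 _ (_ : 0 < 2 * enorm u * enorm v)) // !mulr_gt0.
Qed.

Lemma normr_dot_le u v : `|dot u v| <= enorm u * enorm v.
Proof.
rewrite ler_norml cauchy_schwarz andbT lerNl -dotNl.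
by rewrite (le_trans (cauchy_schwarz _ _)) // enormN.
Qed.

Lemma enorm_sqrD u v : enorm (u + v) ^+ 2 = enorm u ^+ 2 + 2 * dot u v + enorm v ^+ 2.
Proof. by rewrite !sqr_enorm !dotE (dotC v u); ring. Qed.
Lemma enorm_sqrB u v : enorm (u - v) ^+ 2 = enorm u ^+ 2 - 2 * dot u v + enorm v ^+ 2.
Proof. by rewrite !sqr_enorm !dotE (dotC v u); ring. Qed.
Lemma ler_enormD u v : enorm (u + v) <= enorm u + enorm v.
Proof.
rewrite -(@ler_pXn2r _ 2) ?nnegrE ?addr_ge0 // enorm_sqrD.
by have := cauchy_schwarz u v; nra.
Qed.

Lemma ler_enormB u v : enorm (u - v) <= enorm u + enorm v.
Proof. by rewrite (le_trans (ler_enormD _ _)) // enormN. Qed.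
Lemma ler_enorm_dist x y z : enorm (x - z) <= enorm (x - y) + enorm (y - z).
Proof. by rewrite (le_trans _ (ler_enormD _ _)) // addrA subrK. Qed.
Lemma ler_dist_enorm u v : `|enorm u - enorm v| <= enorm (u - v).
Proof.
rewrite ler_norml; apply/andP; split.
  have := ler_enormD u (v - u); rewrite addrC subrK (enormBC v u); lra.
by have := ler_enormD v (u - v); rewrite addrC subrK; lra.
Qed.

Lemma mxnorm_le_enorm u : `|u| <= enorm u.
Proof.
rewrite /Num.norm /= mx_normrE; apply: bigmax_le => // -[i j] _ /=.
by rewrite ord1; exact: coord_le_enorm.
Qed.

Lemma coord_le_mxnorm u i : `|u 0 i| <= `|u|.
Proof.
rewrite [leRHS]/Num.norm /= mx_normrE.
by apply: (le_bigmax _ (fun ij : 'I_1 * 'I_n => `|u ij.1 ij.2|) (ord0, i)).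
Qed.

Lemma enorm_le_sum u : enorm u <= \sum_i `|u 0 i|.
Proof.
rewrite -(@ler_pXn2r _ 2) ?nnegrE //; last exact: sumr_ge0.
rewrite sqr_enorm /dot expr2 mulr_suml; apply: ler_sum => i _.
rewrite (bigD1 i) //= mulrDr -normrM -{1}[u 0 i * u 0 i]ger0_norm -?expr2 ?sqr_ge0 //.
by rewrite lerDl mulr_ge0 // sumr_ge0.
Qed.

Lemma enorm_le_coord u e : (forall i, `|u 0 i| <= e) -> enorm u <= n%:R * e.
Proof.
move=> ue; apply: le_trans (enorm_le_sum u) _.
apply: (@le_trans _ _ (\sum_(i < n) e)); first exact: ler_sum.
by rewrite sumr_const card_ord mulr_natl.
Qed.

Lemma enorm_le_mxnorm u : enorm u <= n%:R * `|u|.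
Proof. by apply: enorm_le_coord => i; exact: coord_le_mxnorm. Qed.
(** The ambient topology is that of the sup norm, and the two norms differ by the factors 1 and [n].
    The divisor [n%:R + 1] stays positive when [n = 0]. *)
Lemma nbhs_enormP x (A : set 'rV[R]_n) :
  nbhs x A <-> exists2 e : R, 0 < e & forall y, enorm (y - x) < e -> A y.
Proof.
split.
  move=> /nbhs_ballP[e /= e0 eA]; exists e => // y yx; apply: eA.
  rewrite -ball_normE /=; apply: le_lt_trans (mxnorm_le_enorm _) _.
  by rewrite enormBC.
move=> [e e0 eA]; apply/nbhs_ballP; exists (e / (n%:R + 1)) => /=.
  by rewrite divr_gt0 // ltr_wpDl.
move=> y; rewrite -ball_normE /= => xy; apply: eA.
rewrite ltr_pdivlMr ?ltr_wpDl // in xy; apply: le_lt_trans xy.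
rewrite enormBC; apply: le_trans (enorm_le_mxnorm _) _.
by rewrite mulrC ler_wpM2l // lerDl.
Qed.

Lemma lipschitz_continuous_at (f : 'rV[R]_n -> R) L x :
  (forall y, `|f x - f y| <= L * enorm (x - y)) -> {for x, continuous f}.
Proof.
move=> fL A /nbhs_ballP[e /= e0 eA]; apply/nbhs_enormP.
exists (e / (`|L| + 1)); first by rewrite divr_gt0 // ltr_wpDl.
move=> y; rewrite ltr_pdivlMr ?ltr_wpDl // enormBC => xy; apply: eA.
rewrite /ball /=; apply: le_lt_trans (fL y) _; apply: le_lt_trans xy.
by rewrite mulrC ler_wpM2l // (le_trans (ler_norm _)) // lerDl.
Qed.

Lemma continuous_enorm : continuous (@enorm R n).
Proof.
move=> x; apply: (@lipschitz_continuous_at _ 1) => y; rewrite mul1r.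
exact: ler_dist_enorm.
Qed.

Lemma continuous_enormB a : continuous (fun x => enorm (x - a)).
Proof.
move=> x; apply: (@lipschitz_continuous_at _ 1) => y; rewrite mul1r.
apply: le_trans (ler_dist_enorm _ _) _.
by rewrite [X in enorm X](_ : _ = x - y) //; apply/rowP => i; rewrite !mxE; ring.
Qed.

Lemma closure_enormP x (A : set 'rV[R]_n) :
  closure A x <-> forall e : R, 0 < e -> exists2 y, A y & enorm (y - x) < e.
Proof.
split=> [xA e e0|xA B].
  have /xA[y [Ay yx]] : nbhs x [set y | enorm (y - x) < e].
    by apply/nbhs_enormP; exists e.
  by exists y.
by move=> /nbhs_enormP[e /xA[y Ay yx] eB]; exists y; split => //; exact: eB.
Qed.

Lemma closed_enormP (A : set 'rV[R]_n) :
  closed A <-> forall x, (forall e : R, 0 < e -> exists2 y, A y & enorm (y - x) < e) -> A x.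
Proof. by split=> [Ac x /closure_enormP/Ac //|Ac x /closure_enormP/Ac]. Qed.
Lemma open_enormP (A : set 'rV[R]_n) :
  open A <-> forall x, A x -> exists2 e : R, 0 < e & forall y, enorm (y - x) < e -> A y.
Proof.
rewrite openE; split=> [Ao x /Ao/nbhs_enormP //|Ao x /Ao ?].
exact/nbhs_enormP.
Qed.

Lemma bounded_enorm_compact (A : set 'rV[R]_n) (M : R) :
  (forall x, A x -> enorm x <= M) -> closed A -> compact A.
Proof.
move=> AM; apply: bounded_closed_compact.
exists M; split; first exact: num_real.
move=> N MN x /AM xM; apply: le_trans (mxnorm_le_enorm _) _.
exact: le_trans xM (ltW MN).
Qed.

Lemma bounded_enormP (A : set 'rV[R]_n) : bounded_set A ->
  exists2 M : R, 0 < M & forall x, A x -> enorm x <= M.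
Proof.
move=> [M [_ hM]]; pose M' := `|M| + 1.
have M'0 : 0 < M' by rewrite ltr_wpDl.
exists (n%:R * M' + 1); first by rewrite ltr_wpDl // mulr_ge0 // ltW.
move=> x /hM h; apply: le_trans (enorm_le_mxnorm _) _.
rewrite ler_wpDr // ler_wpM2l //; apply: h.
by apply: le_lt_trans (ler_norm _) _; rewrite ltrDl.
Qed.

Lemma compact_enorm_bounded (A : set 'rV[R]_n) : compact A ->
  exists2 M : R, 0 < M & forall x, A x -> enorm x <= M.
Proof. by move=> /compact_bounded; exact: bounded_enormP. Qed.

(* Sequential form of compactness, with indices replaced by tolerances. *)
Lemma compact_cluster (A : set 'rV[R]_n) (T : R -> set 'rV[R]_n) : compact A ->
  (forall e, 0 < e -> exists2 x, A x & T e x) ->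
  (forall e e', e <= e' -> T e `<=` T e') ->
  exists2 x, A x & forall e, 0 < e -> exists2 y, A y /\ T e y & enorm (y - x) < e.
Proof.
move=> cA TA Tmono.
pose F := filter_from [set e : R | 0 < e] (fun e => A `&` T e).
have FF : ProperFilter F.
  apply: filter_from_proper; last by move=> e /TA[x Ax Tx]; exists x.
  apply: filter_from_filter; first by exists 1 => /=.
  move=> e f /= e0 f0; exists (Num.min e f); first by rewrite /= lt_min e0.
  by move=> x [Ax Tx]; do 2!split => //; apply: Tmono Tx; rewrite ge_min lexx ?orbT.
have FA : F A by exists 1 => //= x [].
have [x [Ax xF]] := cA F FF FA.
exists x => // e e0.
have nx : nbhs x [set y | enorm (y - x) < e] by apply/nbhs_enormP; exists e.
have Fe : F (A `&` T e) by exists e.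
by have [y [yAT yx]] := xF _ _ Fe nx; exists y.
Qed.

End EuclideanBasics.

#[global] Hint Resolve enorm_ge0 : core.

(** * Hausdorff measure *)

Section HausdorffBasics.
Context {R : realType} {n : nat}.
Variable m : nat.
Implicit Types (A B E : set 'rV[R]_n) (delta : R).
Local Open Scope ereal_scope.

Lemma ediam_ge0 A : A !=set0 -> 0 <= ediam A.
Proof.
move=> [x Ax]; apply: (@le_trans _ _ (enorm (x - x))%:E).
  by rewrite lee_fin enorm_ge0.
by apply: ereal_sup_ubound; exists x => //; exists x.
Qed.

Lemma ediam_leP A (e : R) :
  (ediam A <= e%:E) <-> (forall x y, A x -> A y -> (enorm (x - y) <= e)%R).
Proof.
split=> [h x y Ax Ay|h].
  by rewrite -lee_fin; apply: le_trans h; apply: ereal_sup_ubound; exists x => //; exists y.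
by apply: ge_ereal_sup => _ [x Ax [y Ay <-]]; rewrite lee_fin; exact: h.
Qed.

Lemma le_ediam A B : A `<=` B -> ediam A <= ediam B.
Proof.
by move=> AB; apply: le_ereal_sup => _ [x Ax [y Ay <-]]; exists x; [exact: AB|exists y => //; exact: AB].
Qed.

Lemma vol_ball_gt0 k : (0 < vol_ball k :> R)%R.
Proof.
suff : (0 < vol_ball k :> R)%R /\ (0 < vol_ball k.+1 :> R)%R by case.
elim: k => [|k [h1 h2]]; first by rewrite /= !ltr0n.
split=> //=; apply: mulr_gt0 => //; apply: divr_gt0 => //.
by apply: mulr_gt0 => //; exact: pi_gt0.
Qed.

Definition gauge_const k : R := vol_ball k / 2 ^+ k.

Lemma gauge_const_gt0 k : (0 < gauge_const k)%R.
Proof. by rewrite divr_gt0 ?vol_ball_gt0 ?exprn_gt0. Qed.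
Hint Resolve gauge_const_gt0 : core.

Lemma hausdorff_gauge0 : hausdorff_gauge m (set0 : set 'rV[R]_n) = 0.
Proof. by rewrite /hausdorff_gauge asboolT. Qed.
Lemma hausdorff_gaugeE A : A !=set0 ->
  hausdorff_gauge m A = (gauge_const m)%:E * ediam A ^+ m.
Proof. by move=> /set0P/eqP A0; rewrite /hausdorff_gauge asboolF. Qed.
Lemma hausdorff_gauge_ge0 A : 0 <= hausdorff_gauge m A.
Proof.
rewrite /hausdorff_gauge; case: asboolP => // /eqP/set0P A0.
apply: mule_ge0; last exact: expe_ge0 (ediam_ge0 A0).
by rewrite lee_fin ltW // gauge_const_gt0.
Qed.

Hint Resolve hausdorff_gauge_ge0 : core.

Lemma ediam_fin A delta : A !=set0 -> ediam A <= delta%:E ->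
  exists e : R, [/\ (0 <= e <= delta)%R, ediam A = e%:E &
    hausdorff_gauge m A = (gauge_const m * e ^+ m)%:E].
Proof.
move=> A0 Ad; have := ediam_ge0 A0.
rewrite (hausdorff_gaugeE A0); case: (ediam A) Ad => [e| |] //.
by rewrite !lee_fin => h1 h2; exists e; rewrite h1 h2 -EFin_expe EFinM.
Qed.

Lemma hausdorff_gauge_le A e : (0 <= e)%R -> ediam A <= e%:E ->
  hausdorff_gauge m A <= (gauge_const m * e ^+ m)%:E.
Proof.
move=> e0 Ae; have [->|/set0P A0] := eqVneq A set0.
  by rewrite hausdorff_gauge0 lee_fin mulr_ge0 ?exprn_ge0 // ltW.
have [f [/andP[f0 fe] _ ->]] := ediam_fin A0 Ae.
by rewrite lee_fin ler_wpM2l ?(ltW (gauge_const_gt0 _)) // lerXn2r.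
Qed.

Lemma le_hausdorff_gauge A B : A `<=` B -> hausdorff_gauge m A <= hausdorff_gauge m B.
Proof.
move=> AB; have [->|/set0P A0] := eqVneq A set0; first by rewrite hausdorff_gauge0.
have B0 : B !=set0 by case: A0 => x /AB; exists x.
rewrite !hausdorff_gaugeE //; apply: lee_wpmul2l; first by rewrite lee_fin ltW.
have := le_ediam AB; have := ediam_ge0 A0; move: (ediam A) (ediam B) => a b a0 ab.
elim: m => // k ih; rewrite !expeS; apply: lee_pmul => //; exact: expe_ge0.
Qed.

(* [hausdorff_delta] is the outer measure generated, over the discrete
   sigma-algebra, by the gauge extended by [+oo]. *)
Local Notation allsets := (g_sigma_algebraType [set: set 'rV[R]_n]).
Let gauge_oo delta A : \bar R :=
  if ediam A <= delta%:E then hausdorff_gauge m A else +oo.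
Let gauge_oo_ge0 delta A : 0 <= gauge_oo delta A.
Proof. by rewrite /gauge_oo; case: ifP => // _; rewrite leey. Qed.
Lemma ediam0 : ediam (set0 : set 'rV[R]_n) = -oo.
Proof.
rewrite /ediam (_ : [set _ | _ in _ & _ in _] = set0) ?ereal_sup0 //.
by apply/seteqP; split=> // ? [].
Qed.

Let gauge_oo0 delta : gauge_oo delta set0 = 0.
Proof. by rewrite /gauge_oo hausdorff_gauge0 ediam0 leNye. Qed.
Let hausdorff_delta_mu_ext delta :
  @hausdorff_delta R n m delta = @mu_ext _ allsets R (gauge_oo delta).
Proof.
apply/funext => A; apply/eqP; rewrite eq_le; apply/andP; split.
  apply: le_ereal_inf_tmp => _ [B [_ AB] <-].
  have [Bd|/existsNP[k /negP Bk]] := pselect (forall k, ediam (B k) <= delta%:E).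
    apply: ereal_inf_lbound; exists B => //=.
    by apply: eq_eseriesr => k _; rewrite /gauge_oo Bd.
  rewrite (_ : limn _ = +oo) ?leey//; apply: (@eseries_pinfty _ _ xpredT k) => //.
    by move=> j _; rewrite gt_eqF// (lt_le_trans _ (gauge_oo_ge0 _ _)).
  by rewrite /gauge_oo (negbTE Bk).
apply: le_ereal_inf_tmp => _ [B [Bd AB] <-].
apply: ereal_inf_lbound; exists B => /=; first by split=> // k; exact: sub_sigma_algebra.
by apply: eq_eseriesr => k _; rewrite /gauge_oo Bd.
Qed.

HB.instance Definition _ delta := isOuterMeasure.Build R 'rV[R]_n
  (@hausdorff_delta R n m delta)
  (eq_ind_r (fun f : set 'rV[R]_n -> \bar R => f set0 = 0)
    (@mu_ext0 _ allsets _ _ (gauge_oo0 _) (gauge_oo_ge0 _)) (hausdorff_delta_mu_ext delta))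
  (eq_ind_r (fun f : set 'rV[R]_n -> \bar R => forall A, 0 <= f A)
    (@mu_ext_ge0 _ allsets _ _ (gauge_oo_ge0 _)) (hausdorff_delta_mu_ext delta))
  (eq_ind_r (fun f : set 'rV[R]_n -> \bar R => {homo f : A B / A `<=` B >-> A <= B})
    (@le_mu_ext _ allsets _ (gauge_oo delta)) (hausdorff_delta_mu_ext delta))
  (eq_ind_r (fun f : set 'rV[R]_n -> \bar R => sigma_subadditive f)
    (@mu_ext_sigma_subadditive _ allsets _ _ (gauge_oo_ge0 _)) (hausdorff_delta_mu_ext delta)).

Lemma hausdorff_delta_le A delta : (0 < delta)%R ->
  hausdorff_delta m delta A <= hausdorff m A.
Proof. by move=> d0; apply: ereal_sup_ubound; exists delta. Qed.
Lemma hausdorff_leP A y :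
  (hausdorff m A <= y) <-> (forall delta, (0 < delta)%R -> hausdorff_delta m delta A <= y).
Proof.
split=> [h delta d0|h]; first exact: le_trans (hausdorff_delta_le A d0) h.
by apply: ge_ereal_sup => _ [delta /= d0 <-]; exact: h.
Qed.

Lemma hausdorff_delta_anti A delta delta' : (delta <= delta')%R ->
  hausdorff_delta m delta' A <= hausdorff_delta m delta A.
Proof.
move=> dd; apply: le_ereal_inf => _ [B [Bd AB] <-]; exists B => //; split=> // k.
by apply: le_trans (Bd k) _; rewrite lee_fin.
Qed.

Lemma hausdorff_delta_gauge A delta : ediam A <= delta%:E ->
  hausdorff_delta m delta A <= hausdorff_gauge m A.
Proof.
move=> Ad; apply: ereal_inf_lbound; exists (fun k : nat => if k == 0%N then A else set0).
  split=> [[|k]//|x Ax]; first by rewrite ediam0 leNye.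
  by exists 0%N.
rewrite nneseries_recl // ?eseries0 ?adde0 //.
by move=> [|k] // _ _; rewrite hausdorff_gauge0.
Qed.

Lemma hausdorff_delta_cover A delta y : hausdorff_delta m delta A < y ->
  exists B : (set 'rV[R]_n)^nat, [/\ forall k, ediam (B k) <= delta%:E,
    A `<=` \bigcup_k B k & \sum_(0 <= k <oo) hausdorff_gauge m (B k) < y].
Proof. by move=> /ereal_inf_lt[_ [B [Bd AB] <-] h]; exists B. Qed.
Lemma hausdorff_delta_finite (I : finType) (P : pred I) A (F : I -> set 'rV[R]_n) delta e :
  (0 <= e <= delta)%R -> A `<=` \bigcup_(i in [set i | P i]) F i ->
  (forall i, P i -> ediam (F i) <= e%:E) ->
  hausdorff_delta m delta A <= ((#|P|)%:R * (gauge_const m * e ^+ m))%:E.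
Proof.
move=> /andP[e0 ed] AF Fe.
(* [G] lists the sets [F i] with [P i] as a sequence, and is empty from index [#|P|] on. *)
pose G k := \bigcup_(i in [set i : 'I_#|P| | i = k :> nat]) F (enum_val i).
have Gd k : ediam (G k) <= e%:E.
  apply/ediam_leP => x y [i ik Fx] [j jk Fy].
  have ij : i = j by apply/val_inj; rewrite /= (ik : _ = _) (jk : _ = _).
  by subst j; exact: (proj1 (ediam_leP _ _) (Fe _ (enum_valP i))).
have AG : A `<=` \big[setU/set0]_(i < #|P|) G i.
  move=> x /AF[i Pi Fx]; rewrite -bigcup_mkord.
  exists (enum_rank_in Pi i); first exact: ltn_ord.
  by exists (enum_rank_in Pi i) => //; rewrite enum_rankK_in.
apply: le_trans (le_outer_measure (hausdorff_delta m delta) _ _ AG) _.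
apply: le_trans (outer_measure_subadditive _ _ _) _.
apply: (@le_trans _ _ (\sum_(i < #|P|) (gauge_const m * e ^+ m)%:E)).
  apply: lee_sum => i _; apply: le_trans (hausdorff_gauge_le e0 (Gd i)).
  by apply: hausdorff_delta_gauge; apply: le_trans (Gd i) _; rewrite lee_fin.
by rewrite sumEFin sumr_const card_ord mulr_natl.
Qed.

End HausdorffBasics.

#[global] Hint Resolve gauge_const_gt0 : core.
#[global] Hint Resolve hausdorff_gauge_ge0 : core.

Section HausdorffLipschitz.
Context {R : realType} {n k : nat}.
Variable m : nat.
Local Open Scope ereal_scope.

(** The map from [B] onto [A] is a relation, [T p q] reading: [q] is sent to [p]; no formula for the
    image is needed. A cover of [B] of mesh [delta / L] is carried to a cover of [A] of mesh
    [delta]. *)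
Lemma hausdorff_lipschitz (A : set 'rV[R]_k) (B : set 'rV[R]_n)
    (T : 'rV[R]_k -> 'rV[R]_n -> Prop) (L : R) : (0 < L)%R ->
  (forall p, A p -> exists2 q, B q & T p q) ->
  (forall p p' q q', A p -> A p' -> B q -> B q' -> T p q -> T p' q' ->
    (enorm (p - p') <= L * enorm (q - q'))%R) ->
  hausdorff m A <= (L ^+ m)%:E * hausdorff m B.
Proof.
move=> L0 AB TL; apply/hausdorff_leP => delta d0.
have eta0 : (0 < delta / L)%R by rewrite divr_gt0.
have Lm : (0 < L ^+ m)%R by rewrite exprn_gt0.
apply: (@le_trans _ _ ((L ^+ m)%:E * hausdorff_delta m (delta / L) B)); last first.
  by apply: lee_wpmul2l; [rewrite lee_fin ltW|exact: hausdorff_delta_le].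
rewrite -lee_pdivrMl //.
apply: le_ereal_inf_tmp => _ [C [Cd BC] <-].
rewrite lee_pdivrMl // -nneseriesZl //.
pose D j := [set p | A p /\ exists q, [/\ B q, C j q & T p q]].
have AD : A `<=` \bigcup_j D j.
  move=> p Ap; have [q Bq Tpq] := AB p Ap.
  by have [j _ Cq] := BC q Bq; exists j => //; split=> //; exists q.
have DE j e : (ediam (C j) <= e%:E) -> ediam (D j) <= (L * e)%:E.
  move=> /ediam_leP Ce; apply/ediam_leP => p p' [Ap [q [Bq Cq Tq]]] [Ap' [q' [Bq' Cq' Tq']]].
  by rewrite (le_trans (TL _ _ _ _ Ap Ap' Bq Bq' Tq Tq')) // ler_pM2l // Ce.
apply: ereal_inf_le; eexists; first exists D.
- split=> // j; rewrite (_ : delta = L * (delta / L))%R; first exact: DE.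
  by rewrite mulrCA divff ?mulr1 // gt_eqF.
- by [].
apply: lee_nneseries => // j _.
have [D0|/set0P[p Dp]] := eqVneq (D j) set0.
  by rewrite D0 hausdorff_gauge0 mule_ge0 // lee_fin ltW.
have C0 : C j !=set0 by case: Dp => _ [q [_ Cq _]]; exists q.
have [e [/andP[e0 ed] eC ->]] := ediam_fin m C0 (Cd j).
rewrite -EFinM mulrCA -exprMn; apply: hausdorff_gauge_le.
  by rewrite mulr_ge0 // ltW.
by apply: DE; rewrite eC.
Qed.

End HausdorffLipschitz.

Lemma ex_natinv_lt (R : realType) (e : R) : 0 < e -> exists k : nat, k.+1%:R^-1 < e.
Proof.
move=> e0; exists (Num.truncn e^-1).
by rewrite invf_plt ?posrE // truncnS_gt.
Qed.

Section HausdorffBorel.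
Context {R : realType} {n : nat}.
Variable m : nat.
Implicit Types (A B X F : set 'rV[R]_n) (delta : R).
Local Open Scope ereal_scope.
Local Notation H := (@hausdorff R n m).

(** A covering set of diameter at most [delta < e] cannot meet both [A] and [B], so each term of the
    gauge sum serves only one of them. *)
Lemma hausdorff_delta_separated A B delta e : (delta < e)%R ->
  (forall x y, A x -> B y -> (e <= enorm (x - y))%R) ->
  hausdorff_delta m delta A + hausdorff_delta m delta B <= hausdorff_delta m delta (A `|` B).
Proof.
move=> de ABe; apply: le_ereal_inf_tmp => _ [C [Cd ABC] <-].
have le_cover D : D `<=` A `|` B ->
    hausdorff_delta m delta D <= \sum_(0 <= k <oo) hausdorff_gauge m (C k `&` D).
  move=> DAB; apply: ereal_inf_lbound; exists (fun k => C k `&` D) => //; split.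
    by move=> k; apply: le_trans (Cd k); apply: le_ediam => x [].
  by move=> x Dx; have [k _ Ckx] := ABC x (DAB x Dx); exists k.
apply: (@le_trans _ _ (\sum_(0 <= k <oo) hausdorff_gauge m (C k `&` A) +
    \sum_(0 <= k <oo) hausdorff_gauge m (C k `&` B))).
  by apply: leeD; apply: le_cover => x; [left|right].
rewrite -nneseriesD //; apply: lee_nneseries => [k _ _|k _]; first exact: adde_ge0.
have [->|/set0P[x [Cx Ax]]] := eqVneq (C k `&` A) set0.
  by rewrite hausdorff_gauge0 add0e; apply: le_hausdorff_gauge => x [].
rewrite (_ : C k `&` B = set0) ?hausdorff_gauge0 ?adde0.
  by apply: le_hausdorff_gauge => y [].
apply/seteqP; split=> // y [Cy By].
have := ABe x y Ax By; have /ediam_leP/(_ x y Cx Cy) := Cd k.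
by move=> h1 h2; have := le_lt_trans (le_trans h2 h1) de; rewrite ltxx.
Qed.

(** The two suprema on the left are approached at separate scales [d1] and [d2]; contents grow as
    the scale shrinks, so both may be replaced by a common scale below [e]. *)
Lemma hausdorff_separated A B (e : R) : (0 < e)%R ->
  (forall x y, A x -> B y -> (e <= enorm (x - y))%R) ->
  H A + H B <= H (A `|` B).
Proof.
move=> e0 ABe.
have [->|HAB] := eqVneq (H (A `|` B)) +oo; first by rewrite leey.
have AAB : H A <= H (A `|` B) by apply: le_outer_measure => x; left.
have BAB : H B <= H (A `|` B) by apply: le_outer_measure => x; right.
have fAB : H (A `|` B) \is a fin_num.
  by rewrite ge0_fin_numE ?outer_measure_ge0 // ltey.
have fA : H A \is a fin_num.
  by rewrite ge0_fin_numE ?outer_measure_ge0 // (le_lt_trans AAB) // ltey.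
rewrite -leeBrDl //; apply/hausdorff_leP => d1 d10; rewrite leeBrDl // addeC.
have fd : hausdorff_delta m d1 B \is a fin_num.
  rewrite ge0_fin_numE ?outer_measure_ge0 //.
  by rewrite (le_lt_trans (hausdorff_delta_le m B d10)) // (le_lt_trans BAB) // ltey.
rewrite -leeBrDl //; apply/hausdorff_leP => d2 d20; rewrite leeBrDl // addeC.
pose d := Num.min (Num.min d1 d2) (e / 2)%R.
have d0 : (0 < d)%R by rewrite !lt_min d10 d20 divr_gt0.
have de : (d < e)%R by rewrite gt_min; apply/orP; right; lra.
apply: le_trans (hausdorff_delta_le m _ d0).
apply: le_trans (hausdorff_delta_separated de ABe).
by apply: leeD; apply: hausdorff_delta_anti; rewrite !ge_min lexx ?orbT.
Qed.

(** Carathéodory's criterion for metric outer measures. [T k] keeps the points of [X] at distance at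
    least 1/(k+1) from [F], hence is separated from [F]; the shells [Rg k] between consecutive [T k]
    have finite total measure, so what [T k] omits of the complement of [F] tends to 0. *)
Lemma closed_caratheodory F : closed F -> H.-caratheodory F.
Proof.
move=> Fc; apply: le_caratheodory_measurable => X.
change (H (X `&` F) + H (X `&` ~` F) <= H X).
have [->|HX] := eqVneq (H X) +oo; first by rewrite leey.
pose T k := [set x | X x /\ forall y, F y -> (k.+1%:R^-1 <= enorm (x - y))%R].
pose Rg k := T k.+1 `\` T k.
have TX k : T k `<=` X by move=> x [].
have T_mono j k : (j <= k)%N -> T j `<=` T k.
  move=> jk x [Xx xF]; split=> // y /xF; apply: le_trans.
  by rewrite lef_pV2 ?posrE // ler_nat ltnS.
have far j k x x' : (j.+2 <= k)%N -> Rg j x -> Rg k x' ->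
    (k%:R^-1 - k.+1%:R^-1 <= enorm (x - x'))%R.
  move=> jk [[Xx xF] _] [[Xx' _] /not_andP[//|/existsNP[y /not_implyP[Fy /negP]]]].
  rewrite -ltNge => x'y; have := xF y Fy; have := ler_enorm_dist x x' y.
  have : (k%:R^-1 <= j.+2%:R^-1 :> R)%R by rewrite lef_pV2 ?posrE ?ler_nat // ltr0n (leq_trans _ jk).
  move: x'y; move: (k%:R^-1)%R (k.+1%:R^-1)%R (j.+2%:R^-1)%R => a b c; lra.
(* Shells whose indices differ by at least 2 are separated, so along one parity the measures add up
   to at most the measure of the union. *)
have sumR p k : \sum_(0 <= j < k | odd j == p) H (Rg j) <=
    H (\bigcup_(j in [set j | (j < k)%N && (odd j == p)]) Rg j).
  elim: k => [|k ih]; first by rewrite big_geq ?outer_measure_ge0.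
  rewrite big_mkcond big_nat_recr //= -big_mkcond /=.
  case: ifPn => [kp|_]; last first.
    rewrite adde0; apply: le_trans ih _; apply: le_outer_measure => x [j /= /andP[jk jp] Rx].
    by exists j => //=; rewrite jp andbT ltnS ltnW.
  apply: (@le_trans _ _ (H (\bigcup_(j in [set j | (j < k)%N && (odd j == p)]) Rg j `|` Rg k))).
    case: k ih kp => [|k] ih kp.
      rewrite big_geq // add0e; apply: le_outer_measure => x; by right.
    apply: le_trans (leeD2r _ ih) _.
    apply: (@hausdorff_separated _ _ (k.+1%:R^-1 - k.+2%:R^-1)%R).
      by rewrite subr_gt0 ltf_pV2 ?posrE // ltr_nat.
    move=> x y [j /= /andP[jk jp] Rx] Ry; apply: (far j) => //.
    rewrite ltn_neqAle jk andbT; apply/eqP => jk1.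
    by move: kp jp; rewrite -jk1 /= => /eqP <-; case: (odd j).
  apply: le_outer_measure => x [[j /= /andP[jk jp] Rx]|Rx].
    by exists j => //=; rewrite jp andbT ltnS ltnW.
  by exists k => //=; rewrite ltnSn.
have sumRX : \sum_(0 <= j <oo) H (Rg j) < +oo.
  apply: (@le_lt_trans _ _ (H X + H X)); last by rewrite lte_add_pinfty // ltey.
  apply: lime_le; first by apply: is_cvg_nneseries => *; exact: outer_measure_ge0.
  apply: nearW => k; rewrite (bigID (fun j => odd j == true)) /=.
  apply: leeD.
    by apply: le_trans (sumR true k) _; apply: le_outer_measure => x [j _ [[]]].
  rewrite (eq_bigl (fun j => odd j == false)) => [|j]; last by case: odd.
  by apply: le_trans (sumR false k) _; apply: le_outer_measure => x [j _ [[]]].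
(* Closedness of [F] puts each point of [X] outside [F] in some [T j]; the least such [j] names its
   shell. *)
have tail k : H (X `&` ~` F) <= H (T k) + \sum_(k <= j <oo) H (Rg j).
  apply: (@le_trans _ _ (H (T k `|` \bigcup_(j in ~` `I_k) Rg j))).
    apply: le_outer_measure => x [Xx Fx].
    have [j Tj] : exists j, T j x.
      apply: contrapT => /forallNP noT; apply: Fx; apply: (proj1 (closed_enormP F) Fc) => e e0.
      have [j je] : exists j, (j.+1%:R^-1 < e)%R.
        exact: ex_natinv_lt.
      have /not_andP[//|/existsNP[y /not_implyP[Fy /negP]]] := noT j.
      by rewrite -ltNge enormBC => yx; exists y => //; exact: lt_trans je.
    have := ex_minnP (_ : exists j, `[< T j x >]).
    case=> [|i /asboolP Ti imin]; first by exists j; apply/asboolP.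
    have [ik|ki] := leqP i k; first by left; exact: T_mono Ti.
    right; case: i Ti imin ki => // i Ti imin ki; exists i; first by apply/negP; rewrite -leqNgt.
    by split=> // /asboolP/imin; rewrite ltnn.
  apply: le_trans (outer_measureU2 _ _ _) _; apply: leeD2l.
  exact: outer_measure_sigma_subadditive_tail.
have Tk k : H (X `&` F) + H (T k) <= H X.
  apply: le_trans (_ : H ((X `&` F) `|` T k) <= _); last first.
    by apply: le_outer_measure => x [[]|[]].
  apply: (@hausdorff_separated _ _ (k.+1%:R^-1)%R); first by rewrite invr_gt0.
  by move=> x y [_ Fx] [_ /(_ _ Fx)]; rewrite enormBC.
have tail0 := nneseries_tail_cvg sumRX (fun k _ => outer_measure_ge0 _ _).
have lim : (fun k => H X + \sum_(k <= j <oo) H (Rg j)) @ \oo --> H X + 0.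
  by apply: cvgeD => //; [rewrite ge0_adde_def // inE ?outer_measure_ge0|exact: cvg_cst].
rewrite -[leRHS]adde0; apply: cvge_ge lim; apply: nearW => k.
apply: (@le_trans _ _ (H (X `&` F) + (H (T k) + \sum_(k <= j <oo) H (Rg j)))).
  exact: leeD2l.
by rewrite addeA leeD2r.
Qed.

End HausdorffBorel.

(** * Coverings by grids of cubes *)

Section HausdorffBox.
Context {R : realType} {n m : nat}.
Implicit Types (E : set 'rV[R]_n).

Lemma grid_index (t : R) (s : nat) : (0 < s)%N -> 0 <= t <= (2 * s)%:R ->
  exists2 j : nat, (j < 2 * s)%N & j%:R <= t <= j.+1%:R.
Proof.
move=> s0 /andP[t0 t2].
have [ts|ts] := ltP t (2 * s)%:R.
  exists (Num.truncn t).
    by rewrite -(ltr_nat R) (le_lt_trans _ ts) // truncn_le.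
  by have /andP[-> /ltW ->] := truncn_itv t0.
exists (2 * s).-1; first by rewrite prednK // muln_gt0.
by rewrite prednK ?muln_gt0 // t2 (le_trans _ ts) // ler_nat leq_pred.
Qed.

(** The functions [f i] act as coordinates: they send [E] into a box that is cut into cubes of side
    [eta], two [s i] of them along axis [i], and each cube pulls back to a set of diameter at most
    [C * eta]. Arbitrary functions allow tilted and curved coordinates. *)
Lemma hausdorff_delta_box E (f : 'I_m -> 'rV[R]_n -> R) (c : 'I_m -> R)
    (s : 'I_m -> nat) (eta C delta : R) :
  0 <= eta -> 0 <= C -> C * eta <= delta -> (forall i, (0 < s i)%N) ->
  (forall y i, E y -> `|f i y - c i| <= (s i)%:R * eta) ->
  (forall y y', E y -> E y' -> (forall i, `|f i y - f i y'| <= eta) ->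
     enorm (y - y') <= C * eta) ->
  (hausdorff_delta m delta E <=
    ((\prod_i (2 * s i))%:R * (gauge_const m * (C * eta) ^+ m))%:E)%E.
Proof.
move=> eta0 C0 Cd s0 fE Elip.
pose K := (\max_i (2 * s i)).+1.
pose P := family (fun i : 'I_m => [pred j : 'I_K | (j < 2 * s i)%N]).
pose F (phi : {ffun 'I_m -> 'I_K}) := [set y | E y /\ forall i,
  c i + ((phi i)%:R - (s i)%:R) * eta <= f i y <= c i + ((phi i).+1%:R - (s i)%:R) * eta].
have cardP : #|P| = (\prod_i (2 * s i))%N.
  rewrite /P card_family foldrE big_map big_enum /=; apply: eq_bigr => i _.
  rewrite -[RHS](card_ord (2 * s i)) -!sum1_card.
  have sK : (2 * s i <= K)%N by apply: leqW; exact: leq_bigmax.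
  by rewrite (big_ord_widen_cond K xpredT (fun=> 1%N) sK).
rewrite -cardP; apply: (hausdorff_delta_finite _ _ (F := F)).
- by rewrite Cd mulr_ge0.
- move=> y Ey.
  have idx i : exists j : 'I_K, (j < 2 * s i)%N /\
      c i + (j%:R - (s i)%:R) * eta <= f i y <= c i + (j.+1%:R - (s i)%:R) * eta.
    have := fE y i Ey; rewrite ler_norml => /andP[h1 h2].
    (* With [eta = 0] the whole box is one point, and the cell of index 0 contains it. *)
    have [e0|e0] := eqVneq eta 0.
      have sK : (0 < K)%N by [].
      exists (Ordinal sK); rewrite e0 !mulr0 !addr0 in h1 h2 *; split.
        by rewrite /= muln_gt0 s0.
      lra.
    have ep : 0 < eta by rewrite lt_neqAle eq_sym e0.
    have := @grid_index ((f i y - c i) / eta + (s i)%:R) (s i) (s0 i).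
    have h3 : - (s i)%:R <= (f i y - c i) / eta by rewrite ler_pdivlMr // mulNr.
    have h4 : (f i y - c i) / eta <= (s i)%:R by rewrite ler_pdivrMr.
    rewrite natrM; case; first by apply/andP; split; lra.
    move=> j js /andP[j1 j2].
    have jK : (j < K)%N by rewrite ltnS (leq_trans (ltnW js)) // leq_bigmax.
    exists (Ordinal jK); split => //=.
    have fu : f i y = c i + (f i y - c i) / eta * eta by rewrite divfK // addrC subrK.
    by rewrite fu !lerD2l !ler_pM2r //; apply/andP; split; lra.
  pose phi := [ffun i => projT1 (cid (idx i))].
  have phiP i := projT2 (cid (idx i)).
  exists phi.
    by apply/familyP => i; rewrite inE ffunE; case: (phiP i).
  by split=> // i; rewrite ffunE; case: (phiP i).
- move=> phi _; apply/ediam_leP => y y' [Ey yF] [Ey' yF'].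
  apply: Elip => // i; move: (yF i) (yF' i) => /andP[a1 a2] /andP[b1 b2].
  rewrite ler_norml; rewrite -natr1 in a2 b2.
  by apply/andP; split; nra.
Qed.

(** Cells of side [M / k.+1%:R] number [2 * k.+1] in each direction, so the power of [k.+1] cancels
    and the bound survives as the mesh tends to 0. *)
Lemma hausdorff_cube E (f : 'I_m -> 'rV[R]_n -> R) (c : 'I_m -> R) (M C : R) :
  0 <= M -> 0 <= C ->
  (forall y i, E y -> `|f i y - c i| <= M) ->
  (forall y y' e, E y -> E y' -> (forall i, `|f i y - f i y'| <= e) ->
     enorm (y - y') <= C * e) ->
  (hausdorff m E <= (gauge_const m * (2 * C * M) ^+ m)%:E)%E.
Proof.
move=> M0 C0 fE Elip; apply/hausdorff_leP => delta d0.
have CM : 0 < C * M + 1 by rewrite ltr_wpDl // mulr_ge0.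
have [k kd] : exists k : nat, k.+1%:R^-1 < delta / (C * M + 1).
  by apply: ex_natinv_lt; rewrite divr_gt0.
rewrite ltr_pdivlMr // in kd.
have k0 : k.+1%:R != 0 :> R by rewrite pnatr_eq0.
have eta0 : 0 <= M / k.+1%:R by rewrite divr_ge0.
apply: le_trans (_ : (((\prod_(i < m) (2 * k.+1))%:R *
    (gauge_const m * (C * (M / k.+1%:R)) ^+ m))%:E <= _)%E); last first.
  rewrite lee_fin big_const_ord iter_muln_1 natrX natrM mulrCA -exprMn.
  rewrite le_eqVlt; apply/orP; left; apply/eqP; congr (_ * _ ^+ _).
  by field.
apply: (hausdorff_delta_box (f := f) (c := c)) => //.
- rewrite mulrA; apply: le_trans (ltW kd); rewrite mulrC ler_wpM2l ?invr_ge0 //.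
  by rewrite lerDl.
- move=> y i Ey; apply: le_trans (fE y i Ey) _.
  by rewrite mulrC divfK.
- by move=> y y' Ey Ey'; exact: Elip.
Qed.

End HausdorffBox.

(** * Eilenberg's inequality for null sets *)

Section Eilenberg.
Context {R : realType} {n : nat}.
Variable m : nat.
Implicit Types (E : set 'rV[R]_n).
Local Notation mu := (@lebesgue_measure R).

(** If the trace of [B] on [E] has diameter [t], then [f] maps it into an interval of length
    [2 * L * t]; multiplying by the m-dimensional gauge of the trace turns [t ^+ m] into
    [t ^+ m.+1]. *)
Lemma gauge_slices E (f : 'rV[R]_n -> R) (L delta : R) (B : set 'rV[R]_n) :
  0 <= L -> (forall x y, E x -> E y -> `|f x - f y| <= L * enorm (x - y)) ->
  (ediam B <= delta%:E)%E ->
  exists (I : set R) (w : R), [/\ measurable I, 0 <= w,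
    forall x, E x -> B x -> I (f x),
    hausdorff_gauge m (B `&` E) = w%:E &
    (w%:E * mu I <=
      (2 * L * (gauge_const m / gauge_const m.+1))%:E * hausdorff_gauge m.+1 B)%E].
Proof.
move=> L0 fL Bd.
have g0 : 0 <= 2 * L * (gauge_const m / gauge_const m.+1 : R).
  by apply: mulr_ge0; [exact: mulr_ge0|apply: divr_ge0; apply/ltW/gauge_const_gt0].
have [E0|/set0P[e [Be Ee]]] := eqVneq (B `&` E) set0.
  exists set0, 0; split=> //; first by move=> x Ex Bx; have : (B `&` E) x by []; rewrite E0.
    by rewrite E0 hausdorff_gauge0.
  by rewrite mul0e mule_ge0.
have BE0 : B `&` E !=set0 by exists e.
have BEd : (ediam (B `&` E) <= delta%:E)%E by apply: le_trans Bd; apply: le_ediam => x [].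
have [t [/andP[t0 td] tE gE]] := ediam_fin m BE0 BEd.
exists `[f e - L * t, f e + L * t]%classic, (gauge_const m * t ^+ m); split => //.
- by apply: mulr_ge0; [exact/ltW/gauge_const_gt0|exact: exprn_ge0].
- move=> x Ex Bx /=; rewrite in_itv /= -ler_distl.
  apply: le_trans (fL _ _ Ex Ee) _; rewrite ler_wpM2l //.
  by apply: (proj1 (ediam_leP (B `&` E) t)); rewrite ?tE.
apply: (@le_trans _ _ ((2 * L * (gauge_const m / gauge_const m.+1))%:E *
    hausdorff_gauge m.+1 (B `&` E))%E); last first.
  by apply: lee_wpmul2l; [rewrite lee_fin|apply: le_hausdorff_gauge => x []].
have [t' [_ t'E ->]] := ediam_fin m.+1 BE0 BEd.
have -> : t' = t by move: t'E; rewrite tE => -[].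
rewrite lebesgue_measure_itv /= lte_fin; case: ifPn => [_|_].
  rewrite -EFinB -!EFinM lee_fin exprS.
  have g1 : gauge_const m.+1 != 0 :> R by rewrite gt_eqF // gauge_const_gt0.
  rewrite le_eqVlt; apply/orP; left; apply/eqP; field.
  by [].
rewrite mule0 -EFinM lee_fin mulr_ge0 // mulr_ge0 ?exprn_ge0 //.
exact/ltW/gauge_const_gt0.
Qed.

(* For covers of [E] by sets [B_j] with [f @` B_j] inside an interval [I_j], the
   gauge sum of the slice at [rho] is at most [\sum_j w_j * \1_(I_j) rho], whose
   integral over [rho] is at most the (m+1)-dimensional gauge sum. *)
Lemma eilenberg E (f : 'rV[R]_n -> R) (L a b : R) : 0 <= L -> a < b ->
  (forall x y, E x -> E y -> `|f x - f y| <= L * enorm (x - y)) ->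
  hausdorff m.+1 E = 0%E ->
  exists2 rho, a <= rho <= b & hausdorff m (E `&` [set x | f x = rho]) = 0%E.
Proof.
move=> L0 ab fL HE.
pose c := 2 * L * (gauge_const m / gauge_const m.+1 : R).
have c0 : 0 <= c by apply: mulr_ge0; [exact: mulr_ge0|apply: divr_ge0; apply/ltW/gauge_const_gt0].
(* The gauge sums are summable in [k], so that the slice bounds of all scales have a finite total
   integral. *)
have cover k : exists B : (set 'rV[R]_n)^nat,
    [/\ forall j, (ediam (B j) <= (k.+1%:R^-1)%:E)%E, E `<=` \bigcup_j B j &
      (\sum_(0 <= j <oo) hausdorff_gauge m.+1 (B j) < (1 / (2 ^ (k + 1))%:R)%:E)%E].
  apply: hausdorff_delta_cover; apply: (@le_lt_trans _ _ 0%E).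
    by rewrite -HE; apply: hausdorff_delta_le; rewrite invr_gt0.
  by rewrite lte_fin divr_gt0 // ltr0n expn_gt0.
pose B k := projT1 (cid (cover k)).
have Bd k j : (ediam (B k j) <= (k.+1%:R^-1)%:E)%E.
  by rewrite /B; case: (projT2 (cid (cover k))).
have EB k : E `<=` \bigcup_j B k j by rewrite /B; case: (projT2 (cid (cover k))).
have Bs k : (\sum_(0 <= j <oo) hausdorff_gauge m.+1 (B k j) <= (1 / (2 ^ (k + 1))%:R)%:E)%E.
  by rewrite /B ltW //; case: (projT2 (cid (cover k))).
have sl k j := gauge_slices L0 fL (Bd k j).
pose I k j := projT1 (cid (sl k j)).
pose w k j := projT1 (cid (projT2 (cid (sl k j)))).
have slP k j : [/\ measurable (I k j), 0 <= w k j,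
    forall x, E x -> B k j x -> I k j (f x),
    hausdorff_gauge m (B k j `&` E) = (w k j)%:E &
    ((w k j)%:E * mu (I k j) <= c%:E * hausdorff_gauge m.+1 (B k j))%E].
  exact: projT2 (cid (projT2 (cid (sl k j)))).
have mI k j : measurable (I k j) by case: (slP k j).
have w0 k j : 0 <= w k j by case: (slP k j).
pose g k j (rho : R) := ((w k j)%:E * (\1_(I k j) rho)%:E)%E.
have g0 k j rho : (0 <= g k j rho)%E by rewrite /g mule_ge0 // lee_fin.
pose D := `[a, b]%classic : set R.
have mD : measurable D by exact: measurable_itv.
have mi k j : measurable_fun D (fun rho => (\1_(I k j) rho : R)%:E).
  by apply/measurable_EFinP; exact: measurable_indic.
have mg k j : measurable_fun D (g k j) by exact: measurable_funeM.
pose S k rho := (\sum_(0 <= j <oo) g k j rho)%E.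
have S0 k rho : (0 <= S k rho)%E by exact: nneseries_ge0.
have mS k : measurable_fun D (S k).
  apply: (@ge0_emeasurable_sum _ _ _ D (g k) xpredT) => [j x _ _|j _] //.
have intS k : (\int[mu]_(rho in D) S k rho <= (c / (2 ^ (k + 1))%:R)%:E)%E.
  rewrite integral_nneseries //; last by move=> j; exact: mg.
  apply: (@le_trans _ _ (\sum_(0 <= j <oo) (c%:E * hausdorff_gauge m.+1 (B k j)))%E).
    apply: lee_nneseries => [j _ _|j _]; first exact: integral_ge0.
    rewrite ge0_integralZl_EFin //; last exact: mi.
    have mI' : measurable (I k j : set (measurableTypeR R)) by exact: mI.
    have mD' : measurable (D : set (measurableTypeR R)) by exact: mD.
    rewrite integral_indic; [|exact: mD'|exact: mI'].
    apply: (@le_trans _ _ ((w k j)%:E * mu (I k j))%E); last by case: (slP k j).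
    apply: lee_wpmul2l; first by rewrite lee_fin.
    apply: le_measure; rewrite ?inE; [apply: measurableI; [exact: mI'|exact: mD']|exact: mI'|].
    exact: subIsetl.
  rewrite nneseriesZl //; apply: le_trans (lee_wpmul2l _ (Bs k)) _; first by rewrite lee_fin.
  by rewrite -EFinM lee_fin mulrA mulr1.
have intSS : (\int[mu]_(rho in D) (\sum_(0 <= k <oo) S k rho) <= c%:E)%E.
  rewrite integral_nneseries //.
  have := @cvg_geometric_eseries_half R c 0.
  rewrite expr0 divr1 => /cvg_lim <- //.
  apply: lee_nneseries => [k _ _|k _]; first exact: integral_ge0.
  exact: intS.
(* Otherwise the sum would be infinite on all of [a, b], against its integral bound [c]. Finiteness
   at [rho] makes [S k rho] tend to 0, as a term of a vanishing tail. *)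
have [rho [Drho Srho]] : exists rho, D rho /\ (\sum_(0 <= k <oo) S k rho < +oo)%E.
  apply: contrapT => /forallNP noS.
  have : (\int[mu]_(rho in D) (\sum_(0 <= k <oo) S k rho) = +oo)%E.
    rewrite (eq_integral (cst +oo%E)).
      rewrite integral_cst; last exact: mD.
      change (+oo * mu D = +oo)%E.
      rewrite /D lebesgue_measure_itv /= lte_fin ab -EFinB.
      by rewrite gt0_mulye // lte_fin subr_gt0.
    move=> rho; rewrite inE => Drho /=; apply/eqP; rewrite -leye_eq leNgt.
    by apply/negP => h; apply: (noS rho).
  by move=> h; move: intSS; rewrite h leye_eq.
exists rho; first by move: Drho; rewrite /D /= in_itv.
apply/eqP; rewrite eq_le outer_measure_ge0 andbT; apply/hausdorff_leP => delta d0.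
have [k0 k0d] := ex_natinv_lt d0.
have tail0 := nneseries_tail_cvg Srho (fun k _ => S0 k rho).
apply: cvge_ge tail0; exists k0 => // k /= k0k.
apply: (@le_trans _ _ (S k rho)); last first.
  rewrite (nneseries_split k 1) // addn1 big_nat1 leeDl //.
  exact: nneseries_ge0.
have kd : k.+1%:R^-1 <= delta.
  by apply: le_trans (ltW k0d); rewrite lef_pV2 ?posrE // ler_nat ltnS.
apply: le_trans (hausdorff_delta_anti _ _ kd) _.
apply: ereal_inf_le; eexists.
  exists (fun j => B k j `&` (E `&` [set x | f x = rho])) => //; split.
    by move=> j; apply: le_trans (Bd k j); apply: le_ediam => x [].
  by move=> x [Ex fx]; have [j _ Bx] := EB k x Ex; exists j.
apply: lee_nneseries => // j _.
have [->|/set0P[x [Bx [Ex fx]]]] := eqVneq (B k j `&` (E `&` [set x | f x = rho])) set0.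
  by rewrite hausdorff_gauge0.
case: (slP k j) => _ _ /(_ x Ex Bx) Ix gE _.
rewrite /g -fx indicE mem_set // mule1 -gE.
by apply: le_hausdorff_gauge => y [? []].
Qed.

End Eilenberg.

(** Induction on [m]. If [E] were null, Eilenberg's inequality for the last coordinate would give a
    null slice on which the other coordinates still reach the whole unit cube. For [m = 0] any
    nonempty covering set has gauge 1. *)
Lemma hausdorff_pos {R : realType} {n m : nat} (E : set 'rV[R]_n)
    (f : 'I_m -> 'rV[R]_n -> R) (L : R) : 0 <= L ->
  (forall i x y, E x -> E y -> `|f i x - f i y| <= L * enorm (x - y)) ->
  (forall w : 'I_m -> R, (forall i, 0 <= w i <= 1) ->
     exists2 x, E x & forall i, f i x = w i) ->
  (0 < hausdorff m E)%E.
Proof.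
move=> L0; elim: m f E => [|m ih] f E fL fE.
  rewrite lt_neqAle outer_measure_ge0 andbT eq_sym; apply/eqP => HE.
  have [|x Ex _] := fE (fun=> 0); first by case.
  have : (hausdorff_delta 0 1 E < 1)%E.
    by apply: le_lt_trans (hausdorff_delta_le _ _ _) _ => //; rewrite HE lte_fin.
  move=> /hausdorff_delta_cover[B [Bd EB]]; apply/negP; rewrite -leNgt.
  have [j _ Bx] := EB x Ex.
  have Bj0 : B j !=set0 by exists x.
  have [t [_ _ gE]] := ediam_fin 0 Bj0 (Bd j).
  apply: le_trans (_ : (\sum_(0 <= i < j.+1) hausdorff_gauge 0 (B i) <= _)%E); last first.
    exact: nneseries_lim_ge.
  rewrite big_nat_recr //= gE expr0 mulr1 /gauge_const /= divr1.
  by apply: leeDr; apply: sume_ge0 => *; exact: hausdorff_gauge_ge0.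
rewrite lt_neqAle outer_measure_ge0 andbT eq_sym; apply/eqP => HE.
have [rho rho01 Hrho] := eilenberg L0 ltr01 (fL ord_max) HE.
suff : (0 < hausdorff m (E `&` [set x | f ord_max x = rho]))%E by rewrite Hrho ltxx.
apply: (ih (fun i => f (widen_ord (leqnSn m) i))) => [i x y [Ex _] [Ey _]|w w01].
  exact: fL.
pose w' (i : 'I_m.+1) := if unlift ord_max i is Some j then w j else rho.
have [|x Ex xw] := fE w'.
  by move=> i; rewrite /w'; case: unliftP => [j|] _.
exists x; first by split=> //=; rewrite xw /w' unlift_none.
move=> i; rewrite xw /w'; have -> : widen_ord (leqnSn m) i = lift ord_max i.
  by apply/val_inj; rewrite /= /bump leqNgt ltn_ord.
by rewrite liftK.
Qed.

Definition has_slope {R : realType} (f : R -> R) (t : R) :=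
  exists c, forall tau, 0 < tau -> exists2 delta, 0 < delta &
    forall h, `|h| < delta -> `|f (t + h) - f t - c * h| <= tau * `|h|.

Lemma derivable_has_slope {R : realType} (f : R -> R) t : derivable f t 1 -> has_slope f t.
Proof.
move=> /cvg_ex[c /= fc]; exists c => tau tau0.
have /cvgrPdist_le/(_ _ tau0) := fc.
rewrite near_withinE => /nbhs_ballP[delta /= d0 hd]; exists delta => // h hdelta.
have [->|h0] := eqVneq h 0; first by rewrite addr0 subrr mulr0 subr0 normr0 mulr0.
have := hd h; rewrite /ball /= sub0r normrN => /(_ hdelta h0).
rewrite [h%:A]mulr1 [h + t]addrC => hc.
have -> : f (t + h) - f t - c * h = - (h * (c - h^-1 *: (f (t + h) - f t))).
  by rewrite mulrBr -[_ *: _]/(_ * _) mulVKf // mulrC opprB.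
by rewrite normrN normrM mulrC ler_wpM2r.
Qed.

(** * Rademacher's theorem *)

Section LipschitzSlope.
Context {R : realType}.
Variables (f : R -> R) (L : R).
Hypothesis L0 : 0 <= L.
Hypothesis fL : forall x y, `|f x - f y| <= L * `|x - y|.
Local Notation mu := (@lebesgue_measure R).
Let L1 : 0 < 2 * L + 1.
Proof. by rewrite ltr_wpDl // mulr_ge0. Qed.
(** Adding [L * t] makes [f] nondecreasing, hence the cumulative function of a Stieltjes measure
    dominated by Lebesgue measure. The slope of [f] is then read off the Radon-Nikodym density. *)
Definition lip_shift (t : R) : R := f t + L * t.
Let lip_shift_nd : nondecreasing lip_shift.
Proof.
move=> x y xy; rewrite /lip_shift -subr_ge0.
have := fL x y; rewrite distrC (distrC x) [`|y - x|]ger0_norm ?subr_ge0 //.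
by rewrite ler_norml => /andP[]; lra.
Qed.

Let lip_shift_lip x y : x <= y -> lip_shift y - lip_shift x <= 2 * L * (y - x).
Proof.
move=> xy; rewrite /lip_shift.
have := fL x y; rewrite distrC (distrC x) [`|y - x|]ger0_norm ?subr_ge0 //.
by rewrite ler_norml => /andP[]; lra.
Qed.

Let lip_shift_rc : right_continuous lip_shift.
Proof.
move=> x; apply: cvg_at_right_filter.
apply/cvgrPdist_le => /= e e0.
near=> y.
have xy : `|x - y| <= e / (2 * L + 1).
  by near: y; apply: cvgr_dist_le; [exact: cvg_id|exact: divr_gt0].
rewrite ler_pdivlMr // in xy; apply: le_trans xy.
rewrite /lip_shift (_ : _ - _ = (f x - f y) + L * (x - y)); last by ring.
apply: le_trans (ler_normD _ _) _; rewrite normrM (ger0_norm L0).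
have := fL x y; have := normr_ge0 (x - y); nra.
Unshelve. all: by end_near. Qed.
HB.instance Definition _ := isCumulative.Build R _ R lip_shift lip_shift_nd lip_shift_rc.
Let nu := lebesgue_stieltjes_measure lip_shift.
(** The slope is at most [2 * L]; the extra 1 keeps the constant invertible when [L = 0]. *)
Let nu_le A : (nu A <= (2 * L + 1)%:E * mu A)%E.
Proof.
rewrite -lee_pdivrMl // /mu /lebesgue_measure.
apply: le_ereal_inf_tmp => _ [B [mB AB] <-].
rewrite lee_pdivrMl // -nneseriesZl; last by move=> *; exact: wlength_ge0.
apply: ereal_inf_le; eexists; first by exists B.
apply: lee_nneseries => [k _ _|k _]; first exact: wlength_ge0.
have := mB k => /ocitvP[->|[[a b] /= ab ->]].
  by rewrite !measure0 mule0.
rewrite !wlength_itv /= lte_fin ab -!EFinB -EFinM lee_fin.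
apply: le_trans (lip_shift_lip (ltW ab)) _.
by rewrite ler_wpM2r ?subr_ge0 ?(ltW ab) //; lra.
Qed.

Let nu_itv a b : a <= b -> nu `]a, b]%classic = (lip_shift b - lip_shift a)%:E.
Proof.
move=> ab; rewrite /nu /lebesgue_stieltjes_measure /measure_extension measurable_mu_extE /=.
  rewrite wlength_itv /= lte_fin; case: ltP => // ba.
  by rewrite (_ : a = b) ?subrr //; apply/le_anti; rewrite ab.
exact: is_ocitv.
Qed.

(** Restriction to the interval makes the Stieltjes measure finite. The primitive of its density is
    [lip_shift] up to a constant there, so Lebesgue's differentiation theorem gives a slope [c] of
    [lip_shift], and [c - L] is one of [f]. *)
Lemma lipschitz_slope_itv (K : R) : 0 < K ->
  mu.-negligible [set t | `]- K, K[%classic t /\ ~ has_slope f t].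
Proof.
move=> K0; pose D := `]- K, K]%classic : set (measurableTypeR R).
have mD : measurable D by exact: measurable_itv.
have nuD : (nu D < +oo)%E by rewrite nu_itv ?ltry //; lra.
pose nuK := mfrestr mD nuD.
have nuKmu : nuK `<< mu.
  apply/null_content_dominatesP => A mA muA0.
  apply/eqP; rewrite eq_le measure_ge0 andbT.
  rewrite /nuK /mfrestr /mrestr /=.
  apply: le_trans (nu_le _) _.
  rewrite (_ : mu (A `&` D) = 0)%E ?mule0 //.
  by apply/eqP; rewrite eq_le measure_ge0 andbT -muA0 le_outer_measure.
have [phi [phi0 phifin iphi nuphi]] := radon_nikodym_sigma_finite nuKmu.
pose g := fine \o phi.
have phig : phi = EFin \o g by apply/funext => x /=; rewrite fineK.
have ig A : measurable A -> mu.-integrable A (EFin \o g).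
  by move=> mA; rewrite -phig; apply: integrableS iphi.
have := @FTC1Ny R g (fun y => ig _ (measurable_itv _)) (open_integrable_locally openT (ig _ measurableT)).
move=> [B [mB muB SB]]; exists B; split => // t [/= tK ft]; apply: SB => /= -[dF _].
apply: ft; have [c hc] := derivable_has_slope dF.
have FE x : - K <= x <= K ->
    (\int[mu]_(t in [set` `]-oo, x]]) g t)%R = lip_shift x - lip_shift (- K).
  move=> /andP[xK1 xK2]; rewrite /Rintegral; have := nuphi `]-oo, x]%classic (measurable_itv _).
  rewrite phig => <-.
  change (fine (nu (`]-oo, x]%classic `&` D)) = lip_shift x - lip_shift (- K)).
  rewrite (_ : _ `&` D = `]- K, x]%classic) ?nu_itv //.
  apply/seteqP; split=> y /=; rewrite /D /= !in_itv /=; first case.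
    by move=> -> /andP[->].
  move=> /andP[-> yx]; split => //; apply/andP; split => //; exact: le_trans yx xK2.
exists (c - L) => tau tau0; have [delta d0 hd] := hc tau tau0.
rewrite in_itv /= in tK; move/andP: tK => [tK1 tK2].
exists (Num.min delta (Num.min (t + K) (K - t))).
  by rewrite !lt_min d0 /= -ltrBlDr sub0r tK1 subr_gt0.
move=> h; rewrite !lt_min => /and3P[h1 h2 h3].
have := hd h h1; rewrite !FE; last 2 first.
- by rewrite !ltW.
- by move: h2 h3; rewrite !ltr_norml => /andP[? ?] /andP[? ?]; apply/andP; split; lra.
apply: le_trans; rewrite /lip_shift le_eqVlt; apply/orP; left; apply/eqP; congr `| _ |.
ring.
Qed.

Lemma lipschitz_ae_slope : mu.-negligible [set t | ~ has_slope f t].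
Proof.
have sub : [set t | ~ has_slope f t] `<=`
    \bigcup_k [set t | `]- k.+1%:R, k.+1%:R[%classic t /\ ~ has_slope f t].
  move=> t ft; exists (Num.truncn `|t|) => //; split => //=.
  by rewrite in_itv /= -ltr_norml truncnS_gt.
by apply: (@negligibleS _ _ _ mu _ _ sub); apply: negligible_bigcup => k; exact: lipschitz_slope_itv.
Qed.

End LipschitzSlope.

(** * Distance to a set *)

Section InfDist.
Context {R : realType} {n : nat}.
Implicit Types (x y z : 'rV[R]_n) (F : set 'rV[R]_n).

Lemma infdist_le y F x : F x -> infdist y F <= enorm (y - x).
Proof.
move=> Fx; apply: ge_inf; last by exists x.
by exists 0 => _ [z _ <-]; exact: enorm_ge0.
Qed.

Lemma infdist_ge y F a : F !=set0 -> (forall x, F x -> a <= enorm (y - x)) -> a <= infdist y F.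
Proof.
move=> [x Fx] aF; apply: lb_le_inf; first by exists (enorm (y - x)), x.
by move=> _ [z Fz <-]; exact: aF.
Qed.

Lemma infdist_set0 y : infdist y set0 = 0.
Proof.
rewrite /infdist (_ : [set _ | _ in _] = set0) ?inf0 //.
by apply/seteqP; split=> // ? [].
Qed.

Lemma infdist_ge0 y F : 0 <= infdist y F.
Proof.
have [->|/set0P F0] := eqVneq F set0; first by rewrite infdist_set0.
by apply: infdist_ge => // x _; exact: enorm_ge0.
Qed.

Lemma infdist_lip y z F : `|infdist y F - infdist z F| <= enorm (y - z).
Proof.
have [->|/set0P F0] := eqVneq F set0.
  by rewrite !infdist_set0 subrr normr0 enorm_ge0.
have h u v : infdist u F <= infdist v F + enorm (u - v).
  rewrite -lerBlDr; apply: infdist_ge => // x Fx; rewrite lerBlDr.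
  by rewrite (le_trans (infdist_le u Fx)) // [leRHS]addrC; exact: ler_enorm_dist.
by rewrite ler_norml; have := h y z; have := h z y; rewrite (enormBC z y); lra.
Qed.

Lemma infdist_approx y F e : F !=set0 -> 0 < e ->
  exists2 x, F x & enorm (y - x) < infdist y F + e.
Proof.
move=> F0 e0; apply: contrapT => h.
have : infdist y F + e <= infdist y F.
  apply: infdist_ge => // x Fx; rewrite leNgt; apply/negP => xe; apply: h.
  by exists x.
by rewrite gerDl leNgt e0.
Qed.

Lemma infdist_attained y F : closed F -> F !=set0 ->
  exists2 x, F x & enorm (y - x) = infdist y F.
Proof.
move=> Fc F0.
pose A := F `&` [set x | enorm (x - y) <= infdist y F + 1].
have cA : compact A.
  apply: (@bounded_enorm_compact _ _ _ (infdist y F + 1 + enorm y)).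
    move=> x [_ /= xy]; rewrite (_ : x = (x - y) + y); last by rewrite subrK.
    by rewrite (le_trans (ler_enormD _ _)) // lerD2r.
  apply: closedI => //; rewrite (_ : [set _ | _] = (fun x => enorm (x - y)) @^-1` [set t | t <= infdist y F + 1]) //.
  by apply: closed_comp; [move=> x _; exact: continuous_enormB|exact: closed_le].
have [|e e' ee' x /=|x [Fx _] hx] :=
    @compact_cluster _ _ A (fun e => [set x | enorm (y - x) <= infdist y F + e]) cA.
- move=> e e0; have [|x Fx xe] := @infdist_approx y F (Num.min e 1) F0.
    by rewrite lt_min e0 ltr01.
  have h1 : Num.min e 1 <= e by rewrite ge_min lexx.
  have h2 : Num.min e 1 <= 1 by rewrite ge_min lexx orbT.
  by exists x; [split=> //=; rewrite enormBC; lra|rewrite /=; lra].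
- by move=> h; rewrite (le_trans h) // lerD2l.
exists x => //; apply/eqP; rewrite eq_le infdist_le // andbT.
apply/ler_addgt0Pr => e e0; have [|z [_ /= zy] zx] := hx (e / 2); first by rewrite divr_gt0.
by have := ler_enorm_dist y z x; lra.
Qed.

Lemma infdist0 x F : F x -> infdist x F = 0.
Proof.
by move=> Fx; apply/eqP; rewrite eq_le infdist_ge0 (le_trans (infdist_le _ Fx)) // subrr enorm0.
Qed.

End InfDist.

Section NullUnions.
Context {R : realType} {n : nat}.
Variable m : nat.
Local Notation H := (@hausdorff R n m).

Lemma hausdorffU (A B : set 'rV[R]_n) : (H (A `|` B) <= H A + H B)%E.
Proof. exact: outer_measureU2. Qed.
Lemma hausdorff_null_bigcup (T : countType) (F : T -> set 'rV[R]_n) :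
  (forall t, H (F t) = 0%E) -> H (\bigcup_t F t) = 0%E.
Proof.
move=> F0; pose G k := if unpickle k is Some t then F t else set0.
have G0 k : H (G k) = 0%E by rewrite /G; case: unpickle => // [t|]; rewrite ?outer_measure0.
apply/eqP; rewrite eq_le outer_measure_ge0 andbT.
apply: (@le_trans _ _ (H (\bigcup_k G k))).
  by apply: le_outer_measure => x [t _ Fx]; exists (pickle t) => //; rewrite /G pickleK.
apply: le_trans (outer_measure_sigma_subadditive _ _) _.
by rewrite eseries0 // => k _ _; exact: G0.
Qed.

Lemma hausdorff_null_subset (A B : set 'rV[R]_n) : A `<=` B -> H B = 0%E -> H A = 0%E.
Proof.
by move=> AB HB; apply/eqP; rewrite eq_le outer_measure_ge0 andbT -HB le_outer_measure.
Qed.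

Lemma hausdorff_null_setU (A B : set 'rV[R]_n) :
  H A = 0%E -> H B = 0%E -> H (A `|` B) = 0%E.
Proof.
move=> HA HB; apply/eqP; rewrite eq_le outer_measure_ge0 andbT.
by rewrite (le_trans (hausdorffU _ _)) // HA HB adde0.
Qed.

End NullUnions.

(** * Compact sets with null sections are null *)

Section NullSections.
Context {R : realType} {n : nat}.
Variable i : 'I_n.
Local Notation mu := (@lebesgue_measure R).
Implicit Types (x y z : 'rV[R]_n) (C : set 'rV[R]_n).

Definition set_coord x (t : R) : 'rV[R]_n := \row_j (if j == i then t else x 0 j).

Lemma set_coordE x t : set_coord x t = set_coord x 0 + t *: delta_mx 0 i.
Proof.
apply/rowP => j; rewrite !mxE eqxx /=; case: eqP => _; first by rewrite add0r mulr1.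
by rewrite mulr0 addr0.
Qed.

(** A tube lemma. The section through [y] is closed and null, so a small open [O] contains it; by
    compactness the same [O] contains the nearby sections, and a second compactness argument makes
    the width [s] uniform in [y]. *)
Lemma null_sections_tube C (eta : R) : compact C -> 0 < eta ->
  (forall x, mu.-negligible [set t | C (set_coord x t)]) ->
  exists2 s, 0 < s & forall y, C y -> exists O : set R, [/\ open O, (mu O < eta%:E)%E &
    forall y' t, C y' -> (forall j, j != i -> `|y' 0 j - y 0 j| < s) -> `|t - y' 0 i| < s -> O t].
Proof.
move=> cC eta0 C0.
have Cc : closed C by apply: compact_closed => //; exact: norm_hausdorff.
have local y : C y -> exists O s, [/\ open O, (mu O < eta%:E)%E, 0 < s &
    forall y' t, C y' -> (forall j, j != i -> `|y' 0 j - y 0 j| < s) -> `|t - y' 0 i| < s -> O t].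
  move=> Cy.
  have cont : continuous (set_coord y : R -> 'rV[R]_n).
    move=> t A /nbhs_enormP[e e0 eA]; apply/nbhs_ballP.
    exists e => //= t' tt'; apply: eA.
    rewrite (set_coordE y t') (set_coordE y t) opprD addrACA subrr add0r -scalerBl enormZ.
    rewrite (_ : enorm (delta_mx 0 i) = 1) ?mulr1 1?distrC //.
    rewrite /enorm /dot (bigD1 i) //= big1 ?addr0 ?mxE ?eqxx ?mulr1 ?sqrtr1 // => j ji.
    by rewrite !mxE eqxx /= (negbTE ji) mul0r.
  have mC : measurable ([set t | C (set_coord y t)] : set (measurableTypeR R)).
    apply: closed_measurable.
    by apply: (@closed_comp _ _ (set_coord y) C) => // t _; exact: cont.
  have {}C0 : mu [set t | C (set_coord y t)] = 0%E by exact: (proj1 (negligibleP _ mC) (C0 y)).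
  have [|O [oO CO]] := lebesgue_regularity_outer mC _ eta0.
    by rewrite [X in (X < _)%E]C0 ltry.
  move=> muO.
  have muO' : (mu O < eta%:E)%E.
    have mO : measurable (O : set (measurableTypeR R)) by exact: open_measurable.
    rewrite (_ : O = [set t | C (set_coord y t)] `|` (O `\` [set t | C (set_coord y t)])); last first.
      by rewrite setDUK.
    apply: le_lt_trans (outer_measureU2 _ _ _) _.
    by rewrite [X in (X + _)%E]C0 add0e.
  exists O.
  apply: contrapT => /forallNP noS.
  (* Points that violate the tube of width [s] around [y]. A cluster point lies on the line through
     [y], so its coordinate [i] is interior to [O], a contradiction. *)
  pose T (s : R) : set 'rV[R]_n := [set y' : 'rV[R]_n | (forall j, j != i -> `|y' 0 j - y 0 j| < s) /\
                 exists2 t, `|t - y' 0 i| < s & ~ O t].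
  have [|e e' ee' y' [h1 [t h2 h3]]|x Cx xT] := @compact_cluster _ _ C T cC.
  - move=> e e0; apply: contrapT => noy; apply: (noS e); split=> // y' t Cy' y'y ty'.
    by apply: contrapT => nOt; apply: noy; exists y' => //; split => //; exists t.
  - split=> [j ji|]; first by rewrite (lt_le_trans (h1 j ji)).
    by exists t => //; rewrite (lt_le_trans h2).
  have xy j : j != i -> x 0 j = y 0 j.
    move=> ji; apply/eqP; rewrite -subr_eq0 -normr_le0; apply/ler_addgt0Pr => e e0; rewrite add0r.
    have [|y' [_ [h1 _]] y'x] := xT (e / 2); first by rewrite divr_gt0.
    have := h1 j ji; have := coord_le_enorm (y' - x) j; rewrite !mxE => h2 h3.
    rewrite (_ : x 0 j - y 0 j = (y' 0 j - y 0 j) - (y' 0 j - x 0 j)); last by ring.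
    by apply: le_trans (ler_normB _ _) _; lra.
  have xE : x = set_coord y (x 0 i).
    by apply/rowP => j; rewrite mxE; case: eqP => [->//|/eqP ji]; rewrite xy.
  have Ox : O (x 0 i) by apply: CO; rewrite /= -xE.
  have := open_nbhs_nbhs (conj oO Ox) => /nbhs_ballP[e /= e0 eO].
  have [|y' [_ [_ [t h1 h2]]] y'x] := xT (e / 2); first by rewrite divr_gt0.
  apply: h2; apply: eO; rewrite /ball /=.
  have := coord_le_enorm (y' - x) i; rewrite !mxE => h3.
  rewrite (_ : x 0 i - t = - (t - y' 0 i) - (y' 0 i - x 0 i)); last by ring.
  by apply: le_lt_trans (ler_normB _ _) _; rewrite normrN; lra.
apply: contrapT => noS.
(* Points for which no [O] works with width [s]. Near a cluster point [x], the set chosen for [x]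
   works with half its width. *)
pose T (s : R) : set 'rV[R]_n := [set y : 'rV[R]_n | forall O, open O -> (mu O < eta%:E)%E ->
  exists (y' : 'rV[R]_n) t, [/\ C y', forall j, j != i -> `|y' 0 j - y 0 j| < s, `|t - y' 0 i| < s & ~ O t]].
have [|e e' ee' y h O oO muO|x Cx xT] := @compact_cluster _ _ C T cC.
- move=> s s0; apply: contrapT => noy; apply: noS; exists s => // y Cy.
  apply: contrapT => noO; apply: noy; exists y => // O oO muO.
  apply: contrapT => noy'; apply: noO; exists O; split=> // y' t Cy' h1 h2.
  by apply: contrapT => nOt; apply: noy'; exists y', t.
- have [y' [t [h1 h2 h3 h4]]] := h O oO muO; exists y', t; split=> //.
    by move=> j ji; rewrite (lt_le_trans (h2 j ji)).
  by rewrite (lt_le_trans h3).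
have [U [s [oU muU s0 hU]]] := local x Cx.
have [|y [Cy yT] yx] := xT (s / 2); first by rewrite divr_gt0.
have [y' [t [Cy' h2 h3]]] := yT U oU muU; apply; apply: (hU y') => //; last first.
  by rewrite (lt_le_trans h3) //; lra.
move=> j ji; have := h2 j ji; have := coord_le_enorm (y - x) j; rewrite !mxE => h4 h5.
rewrite (_ : y' 0 j - x 0 j = (y' 0 j - y 0 j) + (y 0 j - x 0 j)); last by ring.
by apply: le_lt_trans (ler_normD _ _) _; lra.
Qed.

End NullSections.

Section NullSectionsCount.
Context {R : realType} {n : nat}.
Variable i : 'I_n.
Local Notation mu := (@lebesgue_measure R).
Implicit Types (x y z : 'rV[R]_n) (C : set 'rV[R]_n).

Lemma card_itv_le (M h eta : R) (K : nat) (Q : pred 'I_K) (U : set R) :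
  0 < h -> open U -> (mu U < eta%:E)%E ->
  (forall k, Q k -> `](- M + k%:R * h), (- M + k.+1%:R * h)]%classic `<=` U) ->
  #|Q|%:R * h <= eta.
Proof.
move=> h0 oU muU QU.
pose I (k : 'I_K) := `](- M + k%:R * h), (- M + k.+1%:R * h)]%classic : set (measurableTypeR R).
have mI k : measurable (I k) by exact: measurable_itv.
have muI k : mu (I k) = h%:E.
  rewrite /I lebesgue_measure_itv /= lte_fin ltrD2l ltr_pM2r // ltr_nat ltnSn -EFinB.
  by congr (_%:E); rewrite -natr1; ring.
have tI : trivIset [set` Q] I.
  move=> j k _ _ [x []]; rewrite /I /= !in_itv /= => /andP[j1 j2] /andP[k1 k2].
  have h1 := lt_le_trans j1 k2; have h2 := lt_le_trans k1 j2.
  rewrite !ltrD2l !ltr_pM2r // !ltr_nat !ltnS in h1 h2.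
  by apply/val_inj/eqP; rewrite eqn_leq h1.
rewrite -lee_fin; apply: le_trans (ltW muU).
apply: (@le_trans _ _ (mu (\big[setU/set0]_(k | Q k) I k))).
  rewrite (@measure_bigsetU_ord_cond _ _ _ mu K Q I) //.
  rewrite (eq_bigr (fun=> h%:E)) => [|k _]; last exact: muI.
  by rewrite sumEFin sumr_const mulr_natl.
apply: le_outer_measure.
apply: (big_ind (fun A : set R => A `<=` U)) => //.
by move=> A B AU BU x [/AU|/BU].
Qed.

(** Cut a cube around [C] into small cubes. By the tube lemma the cubes meeting [C] in one column
    parallel to axis [i] have total height at most [e / c]; multiplying by the [K ^ n.-1] columns
    bounds their total gauge by [e]. *)
Lemma null_sections C : compact C ->
  (forall x, mu.-negligible [set t | C (set_coord i x t)]) -> hausdorff n C = 0%E.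
Proof.
move=> cC C0; apply/eqP; rewrite eq_le outer_measure_ge0 andbT.
have n0 : (0 < n)%N by case: n i => // -[].
have [M M0 CM] := compact_enorm_bounded cC.
(* The factor [n%:R ^+ n] comes from the diameter bound [n%:R * h] of a cube of side [h], and the
   power of [2 * M] from [K%:R * h], the extent of the base of the columns. *)
pose c := gauge_const n * n%:R ^+ n * (2 * M) ^+ n.-1 : R.
have c0 : 0 < c.
  apply: mulr_gt0; last by rewrite exprn_gt0 // mulr_gt0.
  by apply: mulr_gt0; [exact: gauge_const_gt0|rewrite exprn_gt0 // ltr0n].
apply/lee_addgt0Pr => e e0; rewrite add0e.
have eta0 : 0 < e / c by rewrite divr_gt0.
have [s s0 sC] := null_sections_tube cC eta0 C0.
apply/hausdorff_leP => delta d0.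
have [K' hK'] : exists k : nat, k.+1%:R^-1 < Num.min s (delta / n%:R) / (2 * M).
  by apply: ex_natinv_lt; rewrite divr_gt0 ?mulr_gt0 // lt_min s0 divr_gt0 // ltr0n.
set K := K'.+1 in hK'.
pose h := 2 * M / K%:R.
have K0 : 0 < K%:R :> R by rewrite ltr0n.
have h0 : 0 < h by rewrite divr_gt0 ?mulr_gt0.
have : h < Num.min s (delta / n%:R).
  by move: hK'; rewrite ltr_pdivlMr ?mulr_gt0 // mulrC.
rewrite lt_min => /andP[hs hdelta].
rewrite ltr_pdivlMr ?ltr0n // in hdelta.
pose F (p : {ffun 'I_n -> 'I_K} * 'I_K) := C `&` [set x | forall j,
  if j == i then - M + p.2%:R * h <= x 0 j <= - M + p.2.+1%:R * h
  else - M + (p.1 j)%:R * h <= x 0 j <= - M + (p.1 j).+1%:R * h].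
(* Column indices: the entry at [i] is frozen to [ord0], the height being the second component of a
   cell index. *)
pose A := family (fun j => if j == i then pred1 (ord0 : 'I_K) else predT).
pose Q psi : pred 'I_K := fun k => `[< F (psi, k) !=set0 >].
pose P : pred ({ffun 'I_n -> 'I_K} * 'I_K) := fun p => (p.1 \in A) && Q p.1 p.2.
have cardA : #|A| = (K ^ n.-1)%N.
  rewrite /A card_family foldrE big_map big_enum /= (bigD1 i) //= eqxx card1 mul1n.
  rewrite (eq_bigr (fun=> K)) => [|j /negbTE ->]; last by rewrite card_ord.
  rewrite prod_nat_const; congr (_ ^ _)%N.
  by rewrite -[in RHS](card_ord n) -(cardC1 i); apply: eq_card => j; rewrite !inE.
have cardQ psi : #|Q psi|%:R * h <= e / c.
  have [Q0|] := posnP #|Q psi|.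
    by rewrite Q0 mul0r ltW.
  move=> /card_gt0P[k0 /asboolP[y0 [Cy0 Fy0]]].
  have [U [oU muU hU]] := sC y0 Cy0.
  apply: (@card_itv_le M h _ K (Q psi) U h0 oU muU) => k /asboolP[y [Cy Fy]] t.
  rewrite /= in_itv /= => /andP[t1 t2].
  apply: (hU y) => //.
    move=> j /negbTE ji; have := Fy j; have := Fy0 j; rewrite ji /=.
    move=> /andP[a1 a2] /andP[a3 a4]; apply: le_lt_trans hs.
    by rewrite ler_norml; rewrite -natr1 in a2 a4; apply/andP; split; nra.
  have := Fy i; rewrite eqxx /= => /andP[a3 a4].
  by rewrite ltr_norml; rewrite -natr1 in a4 t2; apply/andP; split; nra.
have cardP : #|P|%:R * h <= K%:R ^+ n.-1 * (e / c).
  rewrite -sum1_card -(pair_big_dep (mem A) Q (fun _ _ => 1%N)) /= natr_sum mulr_suml.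
  apply: (@le_trans _ _ (\sum_(psi in A) (e / c))).
    by apply: ler_sum => psi _; rewrite sum1_card; exact: cardQ.
  by rewrite sumr_const cardA -natrX mulr_natl.
apply: le_trans (hausdorff_delta_finite (P := P) (F := F) (e := n%:R * h) _ _ _ _) _.
- by rewrite mulr_ge0 ?(ltW h0) //= mulrC ltW.
- move=> x Cx.
  have idx j : exists k : 'I_K, - M + k%:R * h <= x 0 j <= - M + k.+1%:R * h.
    have := le_trans (coord_le_enorm x j) (CM x Cx); rewrite ler_norml => /andP[x1 x2].
    pose t := (x 0 j + M) / h.
    have xt : x 0 j = - M + t * h by rewrite /t divfK ?gt_eqF //; ring.
    have t0 : 0 <= t by rewrite divr_ge0 ?(ltW h0) //; lra.
    have tK : t <= K%:R.
      rewrite ler_pdivrMr // /h mulrC divfK ?gt_eqF //; lra.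
    have [tK'|Kt] := ltP t K%:R.
      have kK : (Num.truncn t < K)%N by rewrite -(ltr_nat R) (le_lt_trans _ tK') // truncn_le.
      exists (Ordinal kK); rewrite xt !lerD2l !ler_pM2r //=.
      by have /andP[-> /ltW ->] := truncn_itv t0.
    exists ord_max; rewrite xt !lerD2l !ler_pM2r //=.
    by rewrite tK (le_trans _ Kt) // ler_nat.
  pose psi := [ffun j => if j == i then ord0 else projT1 (cid (idx j))].
  have Fx : F (psi, projT1 (cid (idx i))) x.
    split=> // j; case: eqP => [->|/eqP ji] /=; first exact: (projT2 (cid (idx i))).
    by rewrite ffunE (negbTE ji); exact: (projT2 (cid (idx j))).
  exists (psi, projT1 (cid (idx i))) => //.
  apply/andP; split => /=; last by apply/asboolP; exists x.
  by apply/familyP => j; rewrite ffunE; case: eqP => // _; rewrite inE.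
- move=> [psi k] _; apply/ediam_leP => x y [_ Fx] [_ Fy].
  apply: enorm_le_coord => j; rewrite !mxE.
  move: (Fx j) (Fy j); case: ifP => _ /= /andP[a1 a2] /andP[a3 a4];
    by rewrite ler_norml; rewrite -natr1 in a2 a4; apply/andP; split; nra.
rewrite lee_fin exprMn.
have -> : h ^+ n = h ^+ n.-1 * h by rewrite -exprSr prednK.
have -> : #|P|%:R * (gauge_const n * (n%:R ^+ n * (h ^+ n.-1 * h))) =
    (gauge_const n * n%:R ^+ n * h ^+ n.-1) * (#|P|%:R * h) by ring.
apply: le_trans (ler_wpM2l _ cardP) _.
  apply: mulr_ge0; last by rewrite exprn_ge0 // ltW.
  by apply: mulr_ge0; [exact/ltW/gauge_const_gt0|exact: exprn_ge0].
have -> : gauge_const n * n%:R ^+ n * h ^+ n.-1 * (K%:R ^+ n.-1 * (e / c)) =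
    gauge_const n * n%:R ^+ n * (h * K%:R) ^+ n.-1 * (e / c) by rewrite (exprMn _ h K%:R) !mulrA.
by rewrite /h divfK ?gt_eqF // -/c mulrC divfK ?gt_eqF.
Qed.

End NullSectionsCount.

Lemma caratheodory_cvg_bigcap (R : realType) (T : pointedType)
    (mu : {outer_measure set T -> \bar R}) (F : (set (caratheodory_type mu))^nat) :
  (mu (F 0%N) < +oo)%E -> (forall k, measurable (F k)) -> measurable (\bigcap_k F k) ->
  nonincreasing_seq F -> mu \o F @ \oo --> mu (\bigcap_k F k).
Proof. exact: (@nonincreasing_cvg_mu _ (caratheodory_type mu) R mu F). Qed.

(** * Partial derivatives almost everywhere *)

Section PartialDerivatives.
Context {R : realType} {n : nat}.
Implicit Types (x y z : 'rV[R]_n) (f : 'rV[R]_n -> R).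
Local Notation H := (@hausdorff R n n).

Definition approx_partial f x (i : 'I_n) (tau : R) := exists c delta : R, 0 < delta /\
  forall h, `|h| < delta -> `|f (x + h *: delta_mx 0 i) - f x - c * h| <= tau * `|h|.

Lemma enorm_delta_mx (i : 'I_n) : enorm (delta_mx 0 i : 'rV[R]_n) = 1.
Proof.
rewrite /enorm /dot (bigD1 i) //= big1 ?addr0 ?mxE ?eqxx ?mulr1 ?sqrtr1 // => j ji.
by rewrite !mxE eqxx /= (negbTE ji) mul0r.
Qed.

Lemma closed_forall_lip {I : Type} (P : I -> Prop) (g : I -> 'rV[R]_n -> R) (L : I -> R) :
  (forall t x y, `|g t x - g t y| <= L t * enorm (x - y)) ->
  closed [set x | forall t, P t -> g t x <= 0].
Proof.
move=> gL; apply/closed_enormP => x hx t Pt; rewrite leNgt; apply/negP => gt0.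
have e0 : 0 < g t x / (`|L t| + 1) by rewrite divr_gt0 // ltr_wpDl.
have [y yP] := hx _ e0; rewrite ltr_pdivlMr ?ltr_wpDl // => yx.
have := yP t Pt; have := gL t x y; rewrite (enormBC x) => h1 h2.
have h3 : L t * enorm (y - x) <= enorm (y - x) * (`|L t| + 1).
  by rewrite mulrC ler_wpM2l ?enorm_ge0 // (le_trans (ler_norm _)) // lerDl.
have := ler_norm (g t x - g t y); lra.
Qed.

Variables (f : 'rV[R]_n -> R) (L : R).
Hypothesis L0 : 0 <= L.
Hypothesis fL : forall x y, `|f x - f y| <= L * enorm (x - y).
Variables (i : 'I_n) (tau : R).
Hypothesis tau0 : 0 < tau.
Let e : 'rV[R]_n := delta_mx 0 i.

(** Cauchy criterion for the difference quotients along axis [i], cleared of denominators. It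
    mentions no derivative, so it is a family of inequalities between Lipschitz functions and
    defines a closed set. *)
Definition slope_cauchy (k : nat) : set 'rV[R]_n := [set x : 'rV[R]_n | forall h h' : R,
  `|h| < k.+1%:R^-1 -> `|h'| < k.+1%:R^-1 ->
  `|h' * (f (x + h *: e) - f x) - h * (f (x + h' *: e) - f x)| <= tau * (`|h| * `|h'|)].

Lemma closed_slope_cauchy k : closed (slope_cauchy k).
Proof.
rewrite (_ : slope_cauchy k = [set x : 'rV[R]_n | forall p : R * R, `|p.1| < k.+1%:R^-1 /\ `|p.2| < k.+1%:R^-1 ->
    `|p.2 * (f (x + p.1 *: e) - f x) - p.1 * (f (x + p.2 *: e) - f x)|
      - tau * (`|p.1| * `|p.2|) <= 0]); last first.
  apply/seteqP; split=> x hx.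
    by move=> [h h'] /= [h1 h2]; rewrite subr_le0; exact: hx.
  by move=> h h' h1 h2; have := hx (h, h') (conj h1 h2); rewrite /= subr_le0.
apply: (@closed_forall_lip _ _ _ (fun p => (`|p.2| + `|p.1|) * (2 * L))) => -[h h'] x y /=.
rewrite opprB addrA subrK.
apply: le_trans (ler_dist_dist _ _) _.
have d t : `|(f (x + t *: e) - f x) - (f (y + t *: e) - f y)| <= 2 * L * enorm (x - y).
  rewrite (_ : _ - _ = (f (x + t *: e) - f (y + t *: e)) - (f x - f y)); last by ring.
  apply: le_trans (ler_normB _ _) _.
  have := fL (x + t *: e) (y + t *: e); have := fL x y.
  by rewrite opprD addrACA subrr addr0; lra.
rewrite (_ : _ - _ = h' * ((f (x + h *: e) - f x) - (f (y + h *: e) - f y)) -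
   h * ((f (x + h' *: e) - f x) - (f (y + h' *: e) - f y))); last by ring.
apply: le_trans (ler_normB _ _) _; rewrite !normrM -mulrA mulrDl.
by apply: lerD; rewrite ler_wpM2l.
Qed.

Lemma slope_cauchy_approx k : slope_cauchy k `<=` [set x : 'rV[R]_n | approx_partial f x i tau].
Proof.
move=> x hx; pose d : R := k.+1%:R^-1; have d0 : 0 < d by rewrite invr_gt0.
pose h' := d / 2; have h'0 : 0 < h' by rewrite divr_gt0.
exists ((f (x + h' *: e) - f x) / h'), d; split=> // h hd.
have h'd : `|h'| < d by rewrite gtr0_norm // /h'; lra.
have := hx h h' hd h'd; rewrite -(ler_pM2l h'0) => hh.
rewrite -(ler_pM2l h'0) -{1}(gtr0_norm h'0) -normrM.
rewrite (_ : h' * (_ - _) = h' * (f (x + h *: e) - f x) - h * (f (x + h' *: e) - f x)); last first.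
  by field; rewrite gt_eqF.
apply: le_trans (hx h h' hd h'd) _; rewrite (gtr0_norm h'0); lra.
Qed.

(** Where the restriction to the line has a slope, both quotients are within [tau / 2] of it at
    small scales, so [slope_cauchy k] holds for large [k]. *)
Lemma not_slope_cauchy_null_section x :
  (@lebesgue_measure R).-negligible [set t | forall k, ~ slope_cauchy k (set_coord i x t)].
Proof.
pose g t := f (set_coord i x t).
have gL s t : `|g s - g t| <= L * `|s - t|.
  apply: le_trans (fL _ _) _; rewrite (set_coordE i x s) (set_coordE i x t).
  by rewrite opprD addrACA subrr add0r -scalerBl enormZ enorm_delta_mx mulr1.
apply: negligibleS (lipschitz_ae_slope L0 gL) => t nt [c hc].
have t2 : 0 < tau / 2 by rewrite divr_gt0.
have [d d0 hd] := hc _ t2; have [k kd] := ex_natinv_lt d0.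
apply: (nt k) => h h' h1 h2.
have := hd h (lt_trans h1 kd); have := hd h' (lt_trans h2 kd); rewrite /g.
have sE s : set_coord i x (t + s) = set_coord i x t + s *: e.
  by rewrite (set_coordE i x (t + s)) (set_coordE i x t) scalerDl addrA.
rewrite !sE; set A := f _ - _; set B := f (_ + h *: e) - _ => hA hB.
rewrite (_ : _ - _ = h' * (B - c * h) - h * (A - c * h')); last by ring.
apply: le_trans (ler_normB _ _) _; rewrite !normrM.
have := ler_wpM2l (normr_ge0 h') hB; have := ler_wpM2l (normr_ge0 h) hA; lra.
Qed.

Let Bad := \bigcap_k ~` slope_cauchy k.

(** [Bad] is a countable intersection of open sets, while [null_sections] needs a compact set. Each
    open set is therefore replaced inside the finite-measure cube [B] by a closed subset
    [F k (js k)], at a cost of at most [eta / (2 ^ k.+1)%:R]; the compact intersection has null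
    sections. *)
Lemma bad_null_ball (M : nat) : H (Bad `&` [set x : 'rV[R]_n | forall j, `|x 0 j| <= M%:R]) = 0%E.
Proof.
set B := [set x | _].
have Bc : closed B.
  rewrite (_ : B = [set x | forall j : 'I_n, True -> `|x 0 j| - M%:R <= 0]); last first.
    by apply/seteqP; split=> x hx j => [_|]; have := hx j; rewrite subr_le0 //; apply.
  apply: (@closed_forall_lip _ _ _ (fun=> 1)) => j x y; rewrite opprB addrA subrK mul1r.
  by apply: le_trans (ler_dist_dist _ _) _; have := coord_le_enorm (x - y) j; rewrite !mxE.
have cB : compact B.
  by apply: (@bounded_enorm_compact _ _ _ (n%:R * M%:R)) => // x; exact: enorm_le_coord.
have HB : (H B < +oo)%E.
  apply: le_lt_trans (ltry _).
  apply: (@hausdorff_cube _ _ _ B (fun j x => x 0 j) (fun=> 0) M%:R n%:R) => //.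
    by move=> y j; rewrite subr0; apply.
  by move=> y y' d _ _ hd; apply: enorm_le_coord => j; rewrite !mxE.
pose O k := ~` slope_cauchy k.
pose F k j := [set x : 'rV[R]_n | forall y, slope_cauchy k y -> j.+1%:R^-1 <= enorm (x - y)].
have Fc k j : closed (F k j).
  rewrite (_ : F k j = [set x | forall y, slope_cauchy k y -> j.+1%:R^-1 - enorm (x - y) <= 0]).
    apply: (@closed_forall_lip _ _ _ (fun=> 1)) => z x y.
    rewrite opprB addrC addrA subrK distrC mul1r (le_trans (ler_dist_enorm _ _)) //.
    by rewrite opprB addrA subrK.
  by apply/seteqP; split=> x hx y /hx; rewrite subr_le0.
have FO k j : F k j `<=` O k.
  by move=> x hx /hx; rewrite subrr enorm0 leNgt invr_gt0 ltr0n.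
have mcl A : closed A -> measurable (A : set (caratheodory_type H)).
  exact: closed_caratheodory.
have mO k : measurable (O k : set (caratheodory_type H)).
  by apply: measurableC; apply: mcl; exact: closed_slope_cauchy.
have small k (eta : R) : 0 < eta -> exists j, (H (B `&` (O k `\` F k j)) < eta%:E)%E.
  move=> eta0; pose G j := B `&` (O k `\` F k j).
  have mG j : measurable (G j : set (caratheodory_type H)).
    by apply: measurableI; [exact: mcl|apply: measurableD => //; exact: mcl].
  have G0 : \bigcap_j G j = set0.
    apply/seteqP; split=> // x Gx.
    have Ox : O k x by case: (Gx 0%N I) => _ [].
    suff : slope_cauchy k x by exact: Ox.
    apply: (proj1 (closed_enormP (slope_cauchy k)) (@closed_slope_cauchy k)) => d d0.
    have [j jd] := ex_natinv_lt d0; apply: contrapT => noy.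
    have [_ [_]] := Gx j I; apply => y yk; rewrite leNgt; apply/negP => xy.
    by apply: noy; exists y => //; rewrite enormBC (lt_trans xy).
  have GB : (H (G 0%N) < +oo)%E.
    by apply: le_lt_trans HB; apply: le_outer_measure => x [].
  have mcap : measurable (\bigcap_j G j : set (caratheodory_type H)) by rewrite G0.
  have Gni : nonincreasing_seq (G : (set (caratheodory_type H))^nat).
    move=> j k' jk'; apply/subsetPset => x [Bx [Ox nFx]]; split=> //; split=> // Fx; apply: nFx.
    by move=> y /Fx; apply: le_trans; rewrite lef_pV2 ?posrE // ler_nat ltnS.
  have cvgG := caratheodory_cvg_bigcap GB mG mcap Gni.
  rewrite G0 outer_measure0 in cvgG.
  apply: contrapT => /forallNP noj.
  have : (eta%:E <= 0)%E.
    by apply: cvge_ge cvgG; apply: nearW => j; rewrite leNgt; apply/negP; exact: noj.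
  by rewrite lee_fin leNgt eta0.
have half_gt0 (eta : R) k : 0 < eta -> 0 < eta / (2 ^ k.+1)%:R by move=> ?; rewrite divr_gt0 // ltr0n expn_gt0.
apply/eqP; rewrite eq_le outer_measure_ge0 andbT; apply/lee_addgt0Pr => eta eta0; rewrite add0e.
pose js k := projT1 (cid (small k _ (half_gt0 eta k eta0))).
have jsP k : (H (B `&` (O k `\` F k (js k))) < (eta / (2 ^ k.+1)%:R)%:E)%E.
  exact: projT2 (cid (small k _ (half_gt0 eta k eta0))).
pose C := B `&` \bigcap_k F k (js k).
have HC : H C = 0%E.
  apply: (@null_sections _ _ i).
    by apply: subclosed_compact cB _; [apply: closedI => //; exact: closed_bigI|move=> x []].
  move=> x; apply: negligibleS (not_slope_cauchy_null_section x) => t [_ hF] k.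
  exact: FO (hF k I).
apply: (@le_trans _ _ (H (C `|` \bigcup_k (B `&` (O k `\` F k (js k)))))).
  apply: le_outer_measure => x [Badx Bx].
  have [xF|/existsNP[k xF]] := pselect (forall k, F k (js k) x).
    by left; split=> // k _; exact: xF.
  by right; exists k => //; split=> //; split=> //; exact: Badx.
apply: le_trans (hausdorffU _ _ _) _; rewrite HC add0e.
apply: le_trans (outer_measure_sigma_subadditive _ _) _.
apply: le_trans (epsilon_trick0 xpredT (ltW eta0)).
by apply: lee_nneseries => [k _ _|k _]; [exact: outer_measure_ge0|exact/ltW/jsP].
Qed.

Lemma approx_partial_ae : H [set x | ~ approx_partial f x i tau] = 0%E.
Proof.
apply: hausdorff_null_subset (hausdorff_null_bigcup bad_null_ball) => x nx.
exists (Num.truncn (enorm x)).+1 => //; split.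
  by move=> k _ /slope_cauchy_approx.
move=> j; apply: le_trans (coord_le_enorm x j) _.
by apply: le_trans (ltW (truncnS_gt _)) _; rewrite ler_nat.
Qed.

End PartialDerivatives.

(** * From partial to total differentiability *)

Section Rademacher.
Context {R : realType} {n : nat}.
Implicit Types (x y z h : 'rV[R]_n) (F : set 'rV[R]_n).
Local Notation H := (@hausdorff R n n).

Definition low_support (j : nat) h := forall i : 'I_n, (j <= i)%N -> h 0 i = 0.

(** Stands in for density points: [F] comes within o(|h|) of [x + h], for [h] in the span of the
    first [j] axes. *)
Definition nonporous (j : nat) F x := forall tau, 0 < tau -> exists2 delta, 0 < delta &
  forall h, low_support j h -> enorm h < delta -> infdist (x + h) F <= tau * enorm h.

Lemma enorm_low_part (j : 'I_n) h :
  enorm (h - h 0 j *: delta_mx 0 j) <= enorm h.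
Proof.
rewrite -(@ler_pXn2r _ 2) ?nnegrE ?enorm_ge0 // !sqr_enorm.
apply: ler_sum => k _; rewrite !mxE eqxx /=.
case: eqP => [->|_]; last by rewrite mulr0 subr0.
by rewrite mulr1 subrr mul0r -expr2 sqr_ge0.
Qed.

(* A point of [F] where [infdist _ F] is differentiable along a coordinate
   direction sees [F] at a relatively negligible distance in that direction,
   since [infdist _ F] is minimal there; then hop along the coordinates one at a
   time, staying near [F]. *)
Lemma nonporous_ae_low j F : closed F -> H (F `&` [set x | ~ nonporous j F x]) = 0%E.
Proof.
elim: j F => [|j ih] F Fc.
  rewrite (_ : _ `&` _ = set0) ?outer_measure0 //.
  apply/seteqP; split=> // x [Fx]; apply => tau tau0; exists 1 => // h h0 _.
  have -> : h = 0 by apply/rowP => k; rewrite h0 // mxE.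
  by rewrite addr0 infdist0 // enorm0 mulr0.
have [nj|jn] := leqP n j.
  apply: hausdorff_null_subset (ih F Fc) => x [Fx nx]; split => // jx; apply: nx.
  move=> tau tau0; have [delta d0 hd] := jx tau tau0; exists delta => // h _ h2.
  by apply: hd => // i ji; have := leq_trans nj ji; rewrite leqNgt ltn_ord.
pose i := Ordinal jn.
pose tq (q : nat) : R := q.+1%:R^-1.
have tq0 q : 0 < tq q by rewrite invr_gt0.
pose G (q k : nat) := F `&` [set x : 'rV[R]_n | forall t : R, `|t| < k.+1%:R^-1 ->
  infdist (x + t *: delta_mx 0 i) F - 2 * tq q * `|t| <= 0].
have Gc q k : closed (G q k).
  apply: closedI => //; apply: (@closed_forall_lip _ _ _ _ _ (fun=> 1)) => t x y.
  rewrite opprB addrA subrK mul1r; apply: le_trans (infdist_lip _ _ _) _.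
  by rewrite opprD addrACA subrr addr0.
have cover : F `&` [set x | ~ nonporous j.+1 F x] `<=`
    (\bigcup_q [set x | ~ approx_partial (fun y => infdist y F) x i (tq q)]) `|`
    (\bigcup_(p : nat * nat) (G p.1 p.2 `&` [set x | ~ nonporous j (G p.1 p.2) x])).
  move=> x [Fx nx]; apply: contrapT => /not_orP[nA nB]; apply: nx => tau tau0.
  have [q hq] : exists q, tq q < tau / 3 by apply: ex_natinv_lt; rewrite divr_gt0.
  have [c [d [d0 hd]]] : approx_partial (fun y => infdist y F) x i (tq q).
    by apply: contrapT => ap; apply: nA; exists q.
  have [k kd] := ex_natinv_lt d0.
  (* Adding the expansions at [t] and [- t] cancels the slope; the distance at [- t] is nonnegative,
     whence the factor 2. *)
  have Gx : G q k x.
    split=> // t tk; rewrite subr_le0.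
    have td := lt_trans tk kd.
    have := hd t td; have := hd (- t); rewrite normrN => /(_ td).
    rewrite (infdist0 Fx) !subr0 !ler_norml => /andP[_ a1] /andP[_ a2].
    have := infdist_ge0 (x + - t *: delta_mx 0 i) F.
    by have := tq0 q; have := normr_ge0 t; nra.
  (* The induction hypothesis is used for [G q k], not for [F]: the first [j] coordinates lead near
     a point of [G q k], from which the move along axis [i] is controlled. The total is three times
     [tq q], hence [tau / 3]. *)
  have np : nonporous j (G q k) x.
    by apply: contrapT => np; apply: nB; exists (q, k).
  have [d' d'0 hd'] := np _ (tq0 q).
  exists (Num.min d' k.+1%:R^-1); first by rewrite lt_min d'0 invr_gt0 ltr0n.
  move=> h hj; rewrite lt_min => /andP[h1 h2].
  pose h' := h - h 0 i *: delta_mx 0 i.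
  have h'h : enorm h' <= enorm h by exact: enorm_low_part.
  have h'j : low_support j h'.
    move=> l jl; rewrite !mxE eqxx /=; case: eqP => [->|/eqP li]; first by rewrite mulr1 subrr.
    rewrite mulr0 subr0 hj // ltn_neqAle jl andbT; apply: contra li => /eqP li.
    by apply/eqP/val_inj.
  have := hd' h' h'j (le_lt_trans h'h h1).
  have [y Gy <-] := infdist_attained (x + h') (@Gc q k) (ex_intro _ x Gx).
  move=> xy; case: Gy => Fy /(_ (h 0 i)).
  rewrite (le_lt_trans (coord_le_enorm h i) h2) subr_le0 => /(_ isT) ty.
  have := infdist_lip (x + h) (y + h 0 i *: delta_mx 0 i) F.
  rewrite (_ : x + h - (y + _) = x + h' - y); last first.
    by apply/rowP => l; rewrite !mxE; ring.
  rewrite ler_norml => /andP[_ dd].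
  have := coord_le_enorm h i; have := enorm_ge0 h; have := tq0 q; have := normr_ge0 (h 0 i).
  by nra.
apply: hausdorff_null_subset cover _; apply: hausdorff_null_setU.
  apply: hausdorff_null_bigcup => q.
  apply: (@approx_partial_ae _ _ _ 1) => //.
  by move=> x y; rewrite mul1r infdist_lip.
by apply: hausdorff_null_bigcup => -[q k]; exact: ih.
Qed.

Lemma nonporous_ae F : closed F -> H (F `&` [set x | ~ nonporous n F x]) = 0%E.
Proof. exact: nonporous_ae_low. Qed.
Definition diff_at (f : 'rV[R]_n -> R) x := exists c, forall tau, 0 < tau ->
  exists2 delta, 0 < delta & forall h, enorm h < delta ->
    `|f (x + h) - f x - dot h c| <= tau * enorm h.

Definition approx_diff (f : 'rV[R]_n -> R) x (tau : R) c := exists2 delta, 0 < delta &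
  forall h, enorm h < delta -> `|f (x + h) - f x - dot h c| <= tau * enorm h.

(** Compare the two expansions at a small multiple of [c - c'] itself. *)
Lemma approx_diff_dist f x tau tau' c c' : 0 <= tau -> 0 <= tau' ->
  approx_diff f x tau c -> approx_diff f x tau' c' -> enorm (c - c') <= tau + tau'.
Proof.
move=> t0 t0' [d d0 hd] [d' d'0 hd'].
have [c0|c0] := eqVneq (c - c') 0; first by rewrite c0 enorm0 addr_ge0.
pose N := enorm (c - c'); have N0 : 0 < N by rewrite /N enorm_gt0.
pose s := Num.min d d' / (2 * N).
have m0 : 0 < Num.min d d' by rewrite lt_min d0.
have s0 : 0 < s by rewrite divr_gt0 // mulr_gt0.
have hN : enorm (s *: (c - c')) = s * N by rewrite enormZ gtr0_norm.
have sN : s * N = Num.min d d' / 2 by rewrite /s; field; rewrite gt_eqF.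
have hm : s * N < Num.min d d' by rewrite sN; lra.
move: (hm); rewrite lt_min => /andP[h1 h2].
have := hd (s *: (c - c')); have := hd' (s *: (c - c')); rewrite !hN => /(_ h2) a1 /(_ h1) a2.
have : s * N ^+ 2 <= (tau + tau') * (s * N).
  rewrite /N sqr_enorm -dotZl dotBr.
  have -> : dot (s *: (c - c')) c - dot (s *: (c - c')) c' =
     (f (x + s *: (c - c')) - f x - dot (s *: (c - c')) c') -
     (f (x + s *: (c - c')) - f x - dot (s *: (c - c')) c) by ring.
  apply: le_trans (ler_norm _) _; apply: le_trans (ler_normB _ _) _.
  by rewrite mulrDl addrC lerD.
by rewrite expr2 mulrA [X in _ <= X]mulrC ler_pM2l // mulr_gt0.
Qed.

(** Approximate gradients of tolerance at most 1 lie within 2 of [c1], so they cluster at a point as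
    the tolerance tends to 0; that point is the gradient. *)
Lemma approx_diff_diff f x :
  (forall tau, 0 < tau -> exists c, approx_diff f x tau c) -> diff_at f x.
Proof.
move=> fx; have [c1 hc1] := fx 1 ltr01.
pose T tau : set 'rV[R]_n := [set c | approx_diff f x tau c].
have Tmono e e' : e <= e' -> T e `<=` T e'.
  move=> ee c [d d0 hd]; exists d => // h /hd /le_trans; apply.
  by rewrite ler_wpM2r ?enorm_ge0.
pose A := [set c : 'rV[R]_n | enorm (c - c1) <= 2].
have cA : compact A.
  apply: (@bounded_enorm_compact _ _ _ (2 + enorm c1)).
    move=> c /= cc; rewrite (_ : c = (c - c1) + c1); last by rewrite subrK.
    by rewrite (le_trans (ler_enormD _ _)) // lerD2r.
  rewrite (_ : A = (fun c => enorm (c - c1)) @^-1` [set t | t <= 2]) //.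
  by apply: closed_comp; [move=> c _; exact: continuous_enormB|exact: closed_le].
have [|c0 _ hc0] := compact_cluster cA _ Tmono.
  move=> e e0; have m0 : 0 < Num.min e 1 by rewrite lt_min e0 ltr01.
  have [c hc] := fx _ m0; exists c; last by apply: Tmono hc; rewrite ge_min lexx.
  apply: le_trans (approx_diff_dist (ltW m0) ler01 hc hc1) _.
  have m1 : Num.min e 1 <= 1 by rewrite ge_min lexx orbT.
  by lra.
exists c0 => tau tau0; have t2 : 0 < tau / 2 by rewrite divr_gt0.
have [c [_ [d d0 hd]] cc0] := hc0 _ t2; exists d => // h hh.
rewrite (_ : _ - _ - _ = (f (x + h) - f x - dot h c) + dot h (c - c0)); last first.
  by rewrite dotBr; ring.
apply: le_trans (ler_normD _ _) _.
have := normr_dot_le h (c - c0).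
by have := hd h hh; have := enorm_ge0 h; nra.
Qed.

Lemma enorm_mask (P : pred 'I_n) h : enorm (\row_i (if P i then h 0 i else 0)) <= enorm h.
Proof.
rewrite -(@ler_pXn2r _ 2) ?nnegrE ?enorm_ge0 // !sqr_enorm.
apply: ler_sum => k _; rewrite !mxE; case: ifP => _ //.
by rewrite mul0r -expr2 sqr_ge0.
Qed.

(** [E p] is a closed set on which all partial difference quotients are close to one rational
    vector, at one scale. At a point where [E p] is not porous, [h] is added one coordinate at a
    time: before each move the current point is exchanged for a nearby point of [E p], where the
    quotient along the next axis is known. *)
Theorem rademacher (f : 'rV[R]_n -> R) (L : R) : 0 <= L ->
  (forall x y, `|f x - f y| <= L * enorm (x - y)) ->
  H [set x | ~ diff_at f x] = 0%E.
Proof.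
move=> L0 fL.
pose tq (q : nat) : R := q.+1%:R^-1.
have tq0 q : 0 < tq q by rewrite invr_gt0.
pose E (p : 'rV[rat]_n * nat * nat) := [set x : 'rV[R]_n | forall it : 'I_n * R,
  `|it.2| < p.2.+1%:R^-1 ->
  `|f (x + it.2 *: delta_mx 0 it.1) - f x - ratr (p.1.1 0 it.1) * it.2|
    - tq p.1.2 * `|it.2| <= 0].
have Ec p : closed (E p).
  apply: (@closed_forall_lip _ _ _ _ _ (fun=> 2 * L)) => -[i t] x y /=.
  rewrite opprB addrA subrK; apply: le_trans (ler_dist_dist _ _) _.
  rewrite (_ : _ - _ - _ - _ = (f (x + t *: delta_mx 0 i) - f (y + t *: delta_mx 0 i)) - (f x - f y)); last by ring.
  apply: le_trans (ler_normB _ _) _.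
  have := fL (x + t *: delta_mx 0 i) (y + t *: delta_mx 0 i); have := fL x y.
  by rewrite opprD addrACA subrr addr0; lra.
have cover : [set x | ~ diff_at f x] `<=`
    (\bigcup_(p : nat * 'I_n) [set x | ~ approx_partial f x p.2 (tq p.1)]) `|`
    (\bigcup_p (E p `&` [set x | ~ nonporous n (E p) x])).
  move=> x nx; apply: contrapT => /not_orP[nA nB]; apply: nx.
  apply: approx_diff_diff => tau tau0.
  (* Budget of the [n] moves: each costs at most [(2 + 2 * L) * tq q * enorm h]. *)
  pose N := n.+1%:R * (2 + 2 * L) : R.
  have N0 : 0 < N by rewrite mulr_gt0 ?ltr0n //; lra.
  have [q hq] : exists q, tq q < tau / N / 2 by apply: ex_natinv_lt; rewrite !divr_gt0.
  (* The tolerance of index [(2 * q).+1] is half of [tq q]: one half for the quotient, one half for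
     rounding its slope to a rational. *)
  have ap i : exists c d : R, 0 < d /\ forall t, `|t| < d ->
      `|f (x + t *: delta_mx 0 i) - f x - c * t| <= tq (2 * q).+1 * `|t|.
    by apply: contrapT => nap; apply: nA; exists ((2 * q).+1, i).
  have [c hc] := choice ap.
  have rapp i : exists r : rat, `|c i - ratr r| < tq (2 * q).+1.
    have lt : c i - tq (2 * q).+1 < c i + tq (2 * q).+1 by have := tq0 (2 * q).+1; lra.
    have [r] := rat_in_itvoo lt.
    by rewrite in_itv /= => /andP[r1 r2]; exists r; rewrite ltr_norml; apply/andP; split; lra.
  have [r hr] := choice rapp.
  have [d hd] := choice hc.
  have [k hk] : exists k : nat, forall i, k.+1%:R^-1 < d i.
    have kk i : exists k : nat, k.+1%:R^-1 < d i by apply: ex_natinv_lt; case: (hd i).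
    have [kf hkf] := choice kk; exists (\max_i kf i) => i.
    apply: le_lt_trans (hkf i); rewrite lef_pV2 ?posrE // ler_nat ltnS.
    exact: leq_bigmax.
  have tqq : tq (2 * q).+1 + tq (2 * q).+1 = tq q.
    rewrite /tq (_ : (2 * q).+2%:R = 2 * q.+1%:R :> R); last by rewrite -natrM; congr (_%:R); lia.
    by field; rewrite addrC natr1 pnatr_eq0.
  pose p : 'rV[rat]_n * nat * nat := (\row_i r i, q, k).
  have Ex : E p x.
    move=> [i t] /= tk; rewrite subr_le0 mxE.
    have [_ /(_ t (lt_trans tk (hk i)))] := hd i => h1.
    rewrite (_ : _ - _ - _ = (f (x + t *: delta_mx 0 i) - f x - c i * t) + (c i - ratr (r i)) * t); last by ring.
    apply: le_trans (ler_normD _ _) _; rewrite -tqq [leRHS]mulrDl [X in _ + X <= _]normrM lerD //.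
    by rewrite ler_wpM2r // ltW.
  have np : nonporous n (E p) x by apply: contrapT => np; apply: nB; exists p.
  have [d' d'0 hd'] := np _ (tq0 q).
  exists (\row_i ratr (r i)), (Num.min d' k.+1%:R^-1).
    by rewrite lt_min d'0 invr_gt0 ltr0n.
  move=> h; rewrite lt_min => /andP[h1 h2].
  pose pre (j : nat) := \row_i (if (i < j)%N then h 0 i else 0) : 'rV[R]_n.
  have step j : (j <= n)%N -> `|f (x + pre j) - f x - \sum_(i < n | (i < j)%N) ratr (r i) * h 0 i| <=
      j%:R * ((2 + 2 * L) * tq q * enorm h).
    elim: j => [_|j ihj jn].
      rewrite (_ : pre 0 = 0); last by apply/rowP => i; rewrite !mxE.
      by rewrite addr0 subrr sub0r normrN big_pred0 // normr0 mul0r.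
    have {}ihj := ihj (ltnW jn); pose i := Ordinal jn.
    have preS : pre j.+1 = pre j + h 0 i *: delta_mx 0 i.
      apply/rowP => l; rewrite !mxE eqxx /= ltnS leq_eqVlt.
      case: (eqVneq l i) => [->|li]; first by rewrite /= eqxx ltnn /= mulr1 add0r.
      by rewrite (negbTE (_ : (l != j :> nat))) /= ?mulr0 ?addr0 // -[j]/(nat_of_ord i).
    have sumS : \sum_(l < n | (l < j.+1)%N) ratr (r l) * h 0 l =
        \sum_(l < n | (l < j)%N) ratr (r l) * h 0 l + ratr (r i) * h 0 i.
      rewrite (bigD1 i) //= addrC; congr (_ + _); apply: eq_bigl => l.
      by rewrite ltnS andbC -val_eqE /= -ltn_neqAle.
    have preh : enorm (pre j) <= enorm h by exact: (enorm_mask (fun i : 'I_n => (i < j)%N)).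
    have low : low_support n (pre j) by move=> l; rewrite leqNgt ltn_ord.
    have := hd' (pre j) low (le_lt_trans preh h1).
    have [y Ey <-] := infdist_attained (x + pre j) (@Ec p) (ex_intro _ x Ex).
    move=> xy; have := Ey (i, h 0 i) => /=.
    rewrite (le_lt_trans (coord_le_enorm h i) h2) subr_le0 mxE => /(_ isT) ty.
    have e1 := fL (x + pre j + h 0 i *: delta_mx 0 i) (y + h 0 i *: delta_mx 0 i).
    have e2 := fL (x + pre j) y.
    rewrite (_ : x + pre j + _ - (y + _) = x + pre j - y) in e1; last first.
      by apply/rowP => l; rewrite !mxE; ring.
    rewrite preS addrA sumS.
    rewrite (_ : _ - _ - _ = (f (x + pre j) - f x - \sum_(l < n | (l < j)%N) ratr (r l) * h 0 l) +
      ((f (y + h 0 i *: delta_mx 0 i) - f y - ratr (r i) * h 0 i) +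
       (f (x + pre j + h 0 i *: delta_mx 0 i) - f (y + h 0 i *: delta_mx 0 i)) -
       (f (x + pre j) - f y))); last by ring.
    apply: le_trans (ler_normD _ _) _; rewrite -natr1 mulrDl mul1r; apply: lerD => //.
    apply: le_trans (ler_normB _ _) _.
    have := ler_normD (f (y + h 0 i *: delta_mx 0 i) - f y - ratr (r i) * h 0 i)
       (f (x + pre j + h 0 i *: delta_mx 0 i) - f (y + h 0 i *: delta_mx 0 i)).
    have i1 : L * enorm (x + pre j - y) <= L * (tq q * enorm h).
      by rewrite ler_wpM2l // (le_trans xy) // ler_wpM2l // ltW.
    have i2 : tq q * `|h 0 i| <= tq q * enorm h by rewrite ler_wpM2l ?(ltW (tq0 q)) // coord_le_enorm.
    have := mulr_ge0 (ltW (tq0 q)) (enorm_ge0 h); lra.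
  have := step n (leqnn n); rewrite (_ : pre n = h); last first.
    by apply/rowP => i; rewrite mxE ltn_ord.
  rewrite (eq_bigl xpredT) => [|i]; last by rewrite ltn_ord.
  rewrite (_ : \sum_(i < n) _ = dot h (\row_i ratr (r i))); last first.
    by apply: eq_bigr => i _; rewrite mxE mulrC.
  move=> h3; apply: le_trans h3 _; rewrite mulrA; apply: ler_wpM2r; first exact: enorm_ge0.
  rewrite !ltr_pdivlMr // in hq; rewrite mulrA.
  apply: le_trans (_ : N * tq q <= _); last by rewrite mulrC; have := tq0 q; nra.
  rewrite /N ler_wpM2r ?(ltW (tq0 q)) // ler_wpM2r ?ler_nat //; lra.
apply: hausdorff_null_subset cover _; apply: hausdorff_null_setU.
  by apply: hausdorff_null_bigcup => -[q i]; exact: (@approx_partial_ae _ _ _ L).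
by apply: hausdorff_null_bigcup => p; exact: nonporous_ae.
Qed.

(* McShane's extension reduces the local statement to the global one. *)
Lemma rademacher_on (D : set 'rV[R]_n) (f : 'rV[R]_n -> R) (L : R) : 0 <= L ->
  (forall x y, D x -> D y -> `|f x - f y| <= L * enorm (x - y)) ->
  H (D° `&` [set x | ~ diff_at f x]) = 0%E.
Proof.
move=> L0 fL; have [->|/set0P[a Da]] := eqVneq D set0.
  by rewrite interior0 set0I outer_measure0.
pose g x := inf [set f y + L * enorm (x - y) | y in D].
have low x y : D y -> f a - L * enorm (x - a) <= f y + L * enorm (x - y).
  move=> Dy; have := fL a y Da Dy; rewrite ler_norml => /andP[_ h].
  have := ler_enorm_dist a x y; rewrite (enormBC a x) => /(ler_wpM2l L0); lra.
have lb x : has_lbound [set f y + L * enorm (x - y) | y in D].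
  by exists (f a - L * enorm (x - a)) => _ [y Dy <-]; exact: low.
have gE x : D x -> g x = f x.
  move=> Dx; apply/eqP; rewrite eq_le; apply/andP; split.
    by apply: ge_inf => //; exists x => //; rewrite subrr enorm0 mulr0 addr0.
  apply: lb_le_inf; first by exists (f a + L * enorm (x - a)), a.
  move=> _ [y Dy <-]; have := fL x y Dx Dy; rewrite ler_norml => /andP[_]; lra.
have gL x y : `|g x - g y| <= L * enorm (x - y).
  have h u v : g u <= g v + L * enorm (u - v).
    rewrite -lerBlDr; apply: lb_le_inf; first by exists (f a + L * enorm (v - a)), a.
    move=> _ [z Dz <-]; rewrite lerBlDr.
    apply: (@le_trans _ _ (f z + L * enorm (u - z))).
      by apply: ge_inf => //; exists z.
    have := ler_enorm_dist u v z => /(ler_wpM2l L0); lra.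
  rewrite ler_norml; have := h x y; have := h y x; rewrite (enormBC y x); lra.
apply: hausdorff_null_subset (rademacher L0 gL) => x [/nbhs_enormP[d d0 xd] nx] [c hc].
apply: nx; exists c => tau /hc[d' d'0 hd']; exists (Num.min d d'); first by rewrite lt_min d0.
move=> h; rewrite lt_min => /andP[h1 h2].
have Dx : D x by apply: xd; rewrite subrr enorm0.
have Dxh : D (x + h) by apply: xd; rewrite addrC addKr.
by rewrite -!gE //; exact: hd'.
Qed.

End Rademacher.

Lemma addrDBl (V : zmodType) (x y : V) : x + y - x = y.
Proof. by rewrite addrAC subrr add0r. Qed.

(** * Sets of positive reach *)

Section CompactMax.
Context {R : realType} {n : nat}.

Lemma compact_argmax (A : set 'rV[R]_n) (g : 'rV[R]_n -> R) (L : R) :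
  compact A -> A !=set0 -> 0 <= L ->
  (forall x y, A x -> A y -> `|g x - g y| <= L * enorm (x - y)) ->
  exists2 x, A x & forall y, A y -> g y <= g x.
Proof.
move=> cA [a Aa] L0 gL.
have [B B0 AB] := compact_enorm_bounded cA.
have ub : has_ubound [set g x | x in A].
  exists (g a + L * (B + B)) => _ [x Ax <-].
  have := gL x a Ax Aa; rewrite ler_norml => /andP[_ h].
  have : L * enorm (x - a) <= L * (B + B).
    by rewrite ler_wpM2l // (le_trans (ler_enormB _ _)) // lerD // AB.
  lra.
pose M := sup [set g x | x in A].
have gM y : A y -> g y <= M by move=> Ay; apply: ub_le_sup => //; exists y.
have [|e e' ee' x /=|x Ax hx] := @compact_cluster _ _ A (fun e => [set x | M - e <= g x]) cA.
- move=> e e0; have [_ [x Ax <-] xe] : exists2 t, [set g x | x in A] t & M - e < t.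
    by apply: sup_adherent => //; split=> //; exists (g a), a.
  by exists x => //=; exact: ltW.
- lra.
exists x => // y /gM /le_trans; apply; apply/ler_addgt0Pr => e e0.
have L1 : 0 < L + 1 by rewrite ltr_wpDl.
have [|z [Az Mz] zx] := hx (e / 2 / (L + 1)); first by rewrite !divr_gt0.
have := gL z x Az Ax; rewrite ler_norml => /andP[_ h].
have h1 : e / 2 / (L + 1) <= e / 2.
  by rewrite ler_pdivrMr // ler_peMr ?divr_ge0 ?(ltW e0) // lerDr.
rewrite ltr_pdivlMr // in zx; rewrite /= in Mz.
have := enorm_ge0 (z - x); nra.
Qed.

End CompactMax.

Section PositiveReach.
Context {R : realType} {n : nat}.
Implicit Types (x y z w v : 'rV[R]_n).
Variables (X : set 'rV[R]_n) (r : R).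
Hypothesis Xc : closed X.
Hypothesis r0 : 0 < r.
Hypothesis reach : forall y, infdist y X < r ->
  exists! x, X x /\ enorm (y - x) = infdist y X.
Local Notation d := (fun y => infdist y X).

(** The infimum of the empty set is 0, which is below [r]; the reach condition then provides a point
    of [X]. *)
Lemma reach_nonempty : X !=set0.
Proof.
apply: contrapT => /set0P/negP; rewrite negbK => /eqP X0.
by have := @reach 0; rewrite X0 infdist_set0 => /(_ r0)[x [[]]].
Qed.

Lemma near_pt_exists : exists P : 'rV[R]_n -> 'rV[R]_n,
  forall y, X (P y) /\ enorm (y - P y) = infdist y X.
Proof.
have h y : exists x, X x /\ enorm (y - x) = infdist y X.
  by have [x Xx xd] := infdist_attained y Xc reach_nonempty; exists x.
by have [P hP] := choice h; exists P.
Qed.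

Variable near_pt : 'rV[R]_n -> 'rV[R]_n.
Hypothesis near_ptP : forall y, X (near_pt y) /\ enorm (y - near_pt y) = infdist y X.

Lemma near_pt_in y : X (near_pt y). Proof. by case: (near_ptP y). Qed.
Lemma near_pt_dist y : enorm (y - near_pt y) = infdist y X.
Proof. by case: (near_ptP y). Qed.
Lemma near_pt_unique y x : infdist y X < r -> X x -> enorm (y - x) = infdist y X -> near_pt y = x.
Proof.
move=> yr Xx xd; have [x' [_ ux']] := reach yr.
by rewrite -(ux' x) // -(ux' (near_pt y)) //; exact: near_ptP.
Qed.

Lemma near_pt_mono y z : 0 <= dot (y - z) (near_pt y - near_pt z).
Proof.
have h u v : enorm (u - near_pt u) ^+ 2 <= enorm (u - near_pt v) ^+ 2.
  rewrite lerXn2r ?nnegrE ?enorm_ge0 // near_pt_dist; apply: infdist_le; exact: near_pt_in.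
have := h y z; have := h z y; rewrite !enorm_sqrB !dotE; lra.
Qed.

(** Nearest points of points tending to [y] cluster only at nearest points of [y], and there is just
    one. *)
Lemma near_pt_cont y e : infdist y X < r -> 0 < e ->
  exists2 delta, 0 < delta & forall z, enorm (z - y) < delta -> enorm (near_pt z - near_pt y) < e.
Proof.
move=> yr e0; apply: contrapT => noδ.
pose A := X `&` [set x | enorm (x - y) <= d y + 2].
have cA : compact A.
  apply: (@bounded_enorm_compact _ _ _ (d y + 2 + enorm y)).
    move=> x [_ /= xy]; rewrite (_ : x = (x - y) + y); last by rewrite subrK.
    by rewrite (le_trans (ler_enormD _ _)) // lerD2r.
  apply: closedI => //; rewrite (_ : [set _ | _] = (fun x => enorm (x - y)) @^-1` [set t | t <= d y + 2]) //.
  by apply: closed_comp; [move=> x _; exact: continuous_enormB|exact: closed_le].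
pose T (s : R) : set 'rV[R]_n := [set x : 'rV[R]_n | exists z,
  [/\ enorm (z - y) < Num.min s 1, x = near_pt z & e <= enorm (x - near_pt y)]].
have dz z : enorm (near_pt z - y) <= d y + 2 * enorm (z - y).
  have := ler_enorm_dist (near_pt z) z y; rewrite (enormBC (near_pt z) z) near_pt_dist.
  have := infdist_lip z y X; rewrite ler_norml => /andP[_]; lra.
have [|s s' ss' x [z [h1 h2 h3]]|x [Xx _] hx] := @compact_cluster _ _ A T cA.
- move=> s s0; apply: contrapT => nox; apply: noδ; exists (Num.min s 1); first by rewrite lt_min s0 ltr01.
  move=> z zs; rewrite ltNge; apply/negP => ez; apply: nox; exists (near_pt z); last by exists z.
  split; first exact: near_pt_in.
  by apply: le_trans (dz z) _; move: zs; rewrite lt_min => /andP[_]; lra.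
- by exists z; split=> //; apply: lt_le_trans h1 _; rewrite le_min ge_min ss' /= ge_min lexx orbT.
have xd : enorm (y - x) = d y.
  apply/eqP; rewrite eq_le [_ <= enorm _]infdist_le // andbT.
  apply/ler_addgt0Pr => s s0.
  have [|_ [_ [z [h1 -> _]]] h2] := hx (s / 3); first by rewrite divr_gt0.
  have := dz z; have := ler_enorm_dist y (near_pt z) x; rewrite (enormBC y (near_pt z)).
  by move: h1; rewrite lt_min => /andP[h1 _]; lra.
have [|_ [_ [z [h1 -> h2]]] h3] := hx e; first by [].
by rewrite (near_pt_unique yr Xx xd) in h2; lra.
Qed.

(** The nearest point of [z + h *: m] stays close to that of [z], so it is still seen almost exactly
    in direction [- m]; expanding the squared distance gives slope at least [1 - s]. *)
Lemma infdist_slope z s : 0 < infdist z X -> infdist z X < r -> 0 < s ->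
  exists2 delta, 0 < delta & forall h, 0 < h < delta ->
    infdist z X + (1 - s) * h <= infdist (z + h *: ((infdist z X)^-1 *: (z - near_pt z))) X.
Proof.
move=> d0 dr s0; pose m := (infdist z X)^-1 *: (z - near_pt z).
have m1 : enorm m = 1 by rewrite enormZ gtr0_norm ?invr_gt0 // near_pt_dist mulVf // gt_eqF.
have [|delta delta0 hdelta] := @near_pt_cont z (Num.min s 1 * infdist z X) dr.
  by rewrite mulr_gt0 // lt_min s0 ltr01.
exists delta => // h /andP[h0 hd]; rewrite -/m.
have hm : enorm (z + h *: m - z) = h by rewrite addrDBl enormZ m1 mulr1 gtr0_norm.
have := hdelta (z + h *: m); rewrite hm => /(_ hd) hclose.
set x := near_pt (z + h *: m) in hclose *.
have Xx : X x by exact: near_pt_in.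
have nz : dot (z - near_pt z) m = infdist z X.
  by rewrite dotZr dot_enorm near_pt_dist expr2 mulKf // gt_eqF.
have zx : infdist z X <= enorm (z - x) by exact: infdist_le.
have cs := cauchy_schwarz (x - near_pt z) m.
have key : infdist z X - enorm (x - near_pt z) <= dot (z - x) m.
  have -> : dot (z - x) m = dot (z - near_pt z) m - dot (x - near_pt z) m by rewrite -dotBl opprB addrA subrK.
  by rewrite nz; move: cs; rewrite m1 mulr1; lra.
have s1 : Num.min s 1 <= s by rewrite ge_min lexx.
have s1' : Num.min s 1 <= 1 by rewrite ge_min lexx orbT.
have dd : infdist (z + h *: m) X ^+ 2 = enorm (z - x) ^+ 2 + 2 * h * dot (z - x) m + h ^+ 2.
  rewrite -near_pt_dist -/x (_ : z + h *: m - x = (z - x) + h *: m); last by rewrite addrAC.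
  by rewrite enorm_sqrD dotZr enormZ m1 mulr1 (gtr0_norm h0) mulrA.
have q : (infdist z X + (1 - Num.min s 1) * h) ^+ 2 <= infdist (z + h *: m) X ^+ 2.
  rewrite dd; have e1 : infdist z X ^+ 2 <= enorm (z - x) ^+ 2.
    by rewrite lerXn2r ?nnegrE ?enorm_ge0 ?infdist_ge0.
  have e2 : (1 - Num.min s 1) * infdist z X <= dot (z - x) m by lra.
  have e3 : 0 <= Num.min s 1 by rewrite le_min ltW // ler01.
  have := ler_wpM2l (ltW h0) e2; nra.
have p0 : 0 <= infdist z X + (1 - Num.min s 1) * h.
  by rewrite addr_ge0 ?infdist_ge0 // mulr_ge0 ?(ltW h0) // subr_ge0.
rewrite ler_pXn2r ?nnegrE ?infdist_ge0 // in q; apply: le_trans q.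
by rewrite lerD2l ler_wpM2r ?(ltW h0) // lerD2l lerN2.
Qed.

Lemma enormD_extremal (a b : 'rV[R]_n) (eta : R) : enorm b <= eta -> enorm (a + b) = enorm a + eta ->
  enorm a *: b = eta *: a.
Proof.
move=> be abE; have cs := cauchy_schwarz a b.
have eq := enorm_sqrD a b; rewrite abE in eq.
have a0 := enorm_ge0 a; have b0 := enorm_ge0 b.
have bE : enorm b = eta by apply/eqP; rewrite eq_le be /=; nra.
have dE : dot a b = enorm a * eta by rewrite bE in eq cs; lra.
apply/eqP; rewrite -subr_eq0; apply/eqP/enorm_eq0.
apply/eqP; rewrite -sqrf_eq0 enorm_sqrB dotZl dotZr (dotC b a) dE !enormZ bE.
by rewrite !ger0_norm -?bE //; apply/eqP; ring.
Qed.

(* The distance function has slope 1 wherever it is positive and smaller than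
   the reach, so it grows by [eta] inside every ball of radius [eta]; by the
   triangle inequality the maximum is attained on the normal ray. *)
Lemma near_pt_ray y t : 0 < infdist y X -> infdist y X < r -> infdist y X <= t < r ->
  infdist (near_pt y + t *: ((infdist y X)^-1 *: (y - near_pt y))) X = t.
Proof.
move=> y0 yr /andP[yt tr].
pose eta := t - infdist y X; have eta0 : 0 <= eta by rewrite subr_ge0.
pose B := [set z : 'rV[R]_n | enorm (z - y) <= eta].
have By : B y by rewrite /B /= subrr enorm0.
have cB : compact B.
  apply: (@bounded_enorm_compact _ _ _ (eta + enorm y)).
    move=> x /= xy; rewrite (_ : x = (x - y) + y); last by rewrite subrK.
    by rewrite (le_trans (ler_enormD _ _)) // lerD2r.
  rewrite (_ : B = (fun x => enorm (x - y)) @^-1` [set t | t <= eta]) //.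
  by apply: closed_comp; [move=> x _; exact: continuous_enormB|exact: closed_le].
have dlip z z' : infdist z X <= infdist z' X + enorm (z - z').
  by have := infdist_lip z z' X; rewrite ler_norml => /andP[_]; rewrite lerBlDl.
have grow s : 0 < s <= 1 -> exists2 z, B z & infdist y X + (1 - s) * eta <= infdist z X.
  move=> /andP[s0 s1].
  (* The penalty slope [1 - s] is below the attainable slope [1 - s / 2], so the maximizer cannot
     lie at distance less than [eta] from [y]. *)
  have [|||z Bz zmax] := @compact_argmax _ _ B (fun z => infdist z X - (1 - s) * enorm (z - y)) 2 cB.
  - by exists y.
  - by [].
  - move=> u v _ _; rewrite (_ : _ - _ = (infdist u X - infdist v X) - (1 - s) * (enorm (u - y) - enorm (v - y))); last by ring.
    apply: le_trans (ler_normB _ _) _; rewrite normrM (ger0_norm (_ : 0 <= 1 - s)) ?subr_ge0 //.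
    have h1 := infdist_lip u v X; have h2 := ler_dist_enorm (u - y) (v - y).
    rewrite opprB addrA subrK in h2.
    have h3 : (1 - s) * `|enorm (u - y) - enorm (v - y)| <= enorm (u - v).
      apply: le_trans (_ : 1 * `|enorm (u - y) - enorm (v - y)| <= _); last by rewrite mul1r.
      by rewrite ler_wpM2r //; lra.
    lra.
  exists z => //; have := zmax y By; rewrite subrr enorm0 mulr0 subr0 => zy.
  have s1' : 0 <= 1 - s by rewrite subr_ge0.
  have [zeta|etaz] := ltP (enorm (z - y)) eta; last first.
    by have := ler_wpM2l s1' etaz; lra.
  have z0 : 0 < infdist z X.
    by have := mulr_ge0 s1' (enorm_ge0 (z - y)); lra.
  have zr : infdist z X < r by have := dlip z y; move: Bz; rewrite /B /= /eta; lra.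
  have s2 : 0 < s / 2 by rewrite divr_gt0.
  have [delta delta0 hdelta] := infdist_slope z0 zr s2.
  pose h := Num.min delta (eta - enorm (z - y)) / 2.
  have m0 : 0 < Num.min delta (eta - enorm (z - y)) by rewrite lt_min delta0 subr_gt0.
  have h0 : 0 < h by rewrite divr_gt0.
  have hm : h < Num.min delta (eta - enorm (z - y)) by rewrite /h; lra.
  move: (hm); rewrite lt_min => /andP[hd heta].
  have := hdelta h; rewrite h0 hd => /(_ isT).
  set m := _^-1 *: _ => hz.
  have m1 : enorm m = 1.
    by rewrite enormZ gtr0_norm ?invr_gt0 // (proj2 (near_ptP z)) mulVf // gt_eqF.
  have zh : enorm (z + h *: m - y) <= enorm (z - y) + h.
    rewrite addrAC (le_trans (ler_enormD _ _)) // enormZ m1 mulr1 gtr0_norm //.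
  have := zmax (z + h *: m); rewrite {1}/B /= => /(_ _)/wrap[]; first lra.
  have := ler_wpM2l s1' zh; have := mulr_gt0 s0 h0; nra.
pose T (s : R) : set 'rV[R]_n := [set z : 'rV[R]_n | infdist y X + (1 - s) * eta <= infdist z X].
have [|s s' ss' z /=|z Bz hz] := @compact_cluster _ _ B T cB.
- move=> s s0; have [|z Bz hz] := grow (Num.min s 1).
    by rewrite lt_min s0 ltr01 ge_min lexx orbT.
  exists z => //; apply: le_trans hz; rewrite lerD2l ler_wpM2r // lerD2l lerN2.
  by rewrite ge_min lexx.
- by apply: le_trans; rewrite lerD2l ler_wpM2r // lerD2l lerN2.
have zt : t <= infdist z X.
  apply/ler_addgt0Pr => e e0.
  have eta1 : 0 < eta + 1 by rewrite ltr_wpDl.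
  have [|z' [Bz' Tz'] z'z] := hz (e / 2 / (eta + 1)); first by rewrite !divr_gt0.
  have h1 := dlip z' z.
  have h2 : e / 2 / (eta + 1) <= e / 2.
    by rewrite ler_pdivrMr // ler_peMr ?divr_ge0 ?(ltW e0) // lerDr.
  have h3 : e / 2 / (eta + 1) * (eta + 1) = e / 2 by rewrite divfK // gt_eqF.
  rewrite /T /= in Tz'; rewrite /eta in h3 Tz' *.
  have : 0 <= e / 2 / (t - infdist y X + 1) by rewrite !divr_ge0 ?(ltW e0) ?(ltW eta1).
  nra.
have yn := proj2 (near_ptP y).
have zx : enorm (z - near_pt y) = enorm (y - near_pt y) + eta.
  apply/eqP; rewrite eq_le; apply/andP; split.
    by have := ler_enorm_dist z y (near_pt y); move: Bz; rewrite /B /=; lra.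
  by have := infdist_le z (proj1 (near_ptP y)); rewrite yn /eta; lra.
have : enorm (y - near_pt y) *: (z - y) = eta *: (y - near_pt y).
  by apply: enormD_extremal => //; rewrite -zx addrC addrA subrK.
rewrite yn => zE.
have -> : near_pt y + t *: ((infdist y X)^-1 *: (y - near_pt y)) = z.
  rewrite (_ : t = infdist y X + eta); last by rewrite /eta addrC subrK.
  rewrite scalerA mulrDl mulfV ?gt_eqF // scalerDl scale1r mulrC -scalerA -zE.
  rewrite scalerA mulVf ?gt_eqF // scale1r.
  by apply/rowP => i; rewrite !mxE; ring.
apply/eqP; rewrite eq_le zt andbT.
by have := infdist_le z (proj1 (near_ptP y)); rewrite zx yn /eta; lra.
Qed.

(** For a unit vector [v] this says that the open ball of radius [s] centred at [x + s *: v], which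
    touches [x], misses [X]. *)
Definition prox_normal (s : R) x v := forall w, X w -> 2 * s * dot (w - x) v <= enorm (w - x) ^+ 2.

Lemma near_pt_prox y t : 0 < infdist y X -> infdist y X < r -> 0 < t < r ->
  prox_normal t (near_pt y) ((infdist y X)^-1 *: (y - near_pt y)).
Proof.
move=> y0 yr /andP[t0 tr] w Xw; set v := _^-1 *: _.
have v1 : enorm v = 1.
  by rewrite enormZ gtr0_norm ?invr_gt0 // (proj2 (near_ptP y)) mulVf // gt_eqF.
(* [near_pt_ray] concerns radii at least the distance. A smaller [t] follows from the larger radius
   when the product is nonnegative, and trivially otherwise. *)
pose t' := Num.max t (infdist y X).
have t'r : t' < r by rewrite gt_max tr.
have t'0 : 0 < t' by rewrite lt_max t0.
have yt' : infdist y X <= t' by rewrite le_max lexx orbT.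
have tt' : t <= t' by rewrite le_max lexx.
have h : 2 * t' * dot (w - near_pt y) v <= enorm (w - near_pt y) ^+ 2.
  have := near_pt_ray y0 yr; move/(_ t'); rewrite yt' t'r => /(_ isT) hd.
  have := infdist_le (near_pt y + t' *: v) Xw; rewrite hd => hw.
  have : t' ^+ 2 <= enorm (near_pt y + t' *: v - w) ^+ 2 by rewrite lerXn2r ?nnegrE ?enorm_ge0 // ltW.
  rewrite (_ : _ - w = t' *: v - (w - near_pt y)); last by apply/rowP => i; rewrite !mxE; ring.
  rewrite [enorm (t' *: v - _) ^+ 2]enorm_sqrB enormZ v1 mulr1 gtr0_norm //.
  rewrite dotZl (dotC v); lra.
have [d0|d0] := leP 0 (dot (w - near_pt y) v).
  apply: le_trans h; rewrite ler_wpM2r // ler_wpM2l //.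
apply: le_trans (sqr_ge0 _); rewrite pmulr_rle0 ?ltW // mulr_gt0 //.
Qed.

Lemma prox_limit s x v : (forall e, 0 < e -> exists x' v',
    [/\ prox_normal s x' v', enorm (x' - x) <= e, enorm (v' - v) <= e & enorm v' <= 1]) ->
  0 <= s -> prox_normal s x v.
Proof.
move=> h s0 w Xw; apply/ler_addgt0Pr => e e0.
pose N := enorm (w - x); have N0 : 0 <= N by exact: enorm_ge0.
pose K := 2 * s * (N + 1) + 2 * N + 1.
have sN : 0 <= 2 * s * (N + 1) by rewrite !mulr_ge0 // addr_ge0.
have K1 : 1 <= K by rewrite /K; lra.
pose c := Num.min 1 (e / K).
have c0 : 0 < c by rewrite lt_min ltr01 divr_gt0 // (lt_le_trans ltr01).
have c1 : c <= 1 by rewrite ge_min lexx.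
have cK : c * K <= e by rewrite -ler_pdivlMr ?(lt_le_trans ltr01) // ge_min lexx orbT.
have [x' [v' [pv xx vv v1]]] := h c c0.
have := pv w Xw.
have e1 : enorm (w - x') <= N + c.
  by have := ler_enorm_dist w x x'; rewrite (enormBC x); rewrite /N; lra.
have e2 : enorm (w - x') ^+ 2 <= (N + c) ^+ 2 by rewrite lerXn2r ?nnegrE ?enorm_ge0 // addr_ge0 // ltW.
have d1 : dot (w - x) v <= dot (w - x') v' + c * (N + 1).
  have -> : dot (w - x) v = dot (w - x') v' + (dot (x' - x) v' + dot (w - x) (v - v')).
    by rewrite !dotE; ring.
  have := cauchy_schwarz (x' - x) v'; have := cauchy_schwarz (w - x) (v - v').
  rewrite (enormBC v) -/N.
  have a1 : enorm (x' - x) * enorm v' <= c.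
    by rewrite -[leRHS]mulr1; apply: ler_pM => //; exact: enorm_ge0.
  have a2 : N * enorm (v' - v) <= N * c by rewrite ler_wpM2l.
  lra.
have s2 : 0 <= 2 * s by rewrite mulr_ge0.
have := ler_wpM2l s2 d1.
have cKE : c * K = 2 * s * (c * (N + 1)) + 2 * (c * N) + c by rewrite /K; ring.
have cc : c * c <= c by rewrite ler_piMr // ltW.
have NcE : (N + c) ^+ 2 = N ^+ 2 + 2 * (c * N) + c * c by ring.
rewrite -/N; lra.
Qed.

(** Polarity gives only first-order information at [x]. It implies that the nearest point of
    [x + t *: v] is x + o(t): otherwise normalized displacements would cluster at a tangent vector
    making an acute angle with [v]. Hence the proximal normals at these nearest points tend to [v],
    and the tangent ball passes to the limit. *)
Lemma nor_prox p s : nor X p -> 0 < s < r -> prox_normal s (lsubmx p) (rsubmx p).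
Proof.
move=> [frx v1 pol] /andP[s0 sr].
set x := lsubmx p in frx pol *; set v := rsubmx p in v1 pol *.
have {}v1 : enorm v = 1 by exact: v1.
have Xx : X x by apply: Xc; case: frx.
pose q t := near_pt (x + t *: v).
have qd t : 0 < t -> enorm (t *: v - (q t - x)) <= t.
  move=> t0; rewrite opprB addrA [t *: v + x]addrC (proj2 (near_ptP _)).
  by apply: le_trans (infdist_le _ Xx) _; rewrite addrDBl enormZ v1 mulr1 gtr0_norm.
have qsq t : 0 < t -> enorm (q t - x) ^+ 2 <= 2 * t * dot (q t - x) v.
  move=> t0; have h : enorm (t *: v - (q t - x)) ^+ 2 <= t ^+ 2.
    by rewrite lerXn2r ?nnegrE ?enorm_ge0 ?(ltW t0) // qd.
  rewrite enorm_sqrB enormZ v1 mulr1 gtr0_norm // dotZl (dotC v) in h; lra.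
have q2 t : 0 < t -> enorm (q t - x) <= 2 * t.
  move=> t0; have := ler_enormB (t *: v) (t *: v - (q t - x)).
  rewrite opprB addrC subrK enormZ v1 mulr1 gtr0_norm //; have := qd t t0; lra.
have small c : 0 < c -> exists2 delta, 0 < delta & forall t, 0 < t < delta -> enorm (q t - x) <= c * t.
  move=> c0; apply: contrapT => nod.
  pose A := [set u : 'rV[R]_n | enorm u = 1].
  have cA : compact A.
    apply: (@bounded_enorm_compact _ _ _ 1); first by move=> u /= ->.
    rewrite (_ : A = enorm @^-1` [set 1]) //.
    by apply: closed_comp; [move=> u _; exact: continuous_enorm|exact: closed_eq].
  pose T (e : R) : set 'rV[R]_n := [set u : 'rV[R]_n | exists t,
    [/\ 0 < t < e, c * t < enorm (q t - x) & u = (enorm (q t - x))^-1 *: (q t - x)]].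
  have [|e e' ee' u [t [/andP[t0 te] h2 h3]]|u u1 hu] := @compact_cluster _ _ A T cA.
  - move=> e e0; apply: contrapT => nou; apply: nod; exists e => // t /andP[t0 te].
    rewrite leNgt; apply/negP => ct; apply: nou.
    have n0 : 0 < enorm (q t - x) by apply: lt_trans ct; rewrite mulr_gt0.
    exists ((enorm (q t - x))^-1 *: (q t - x)); last by exists t; rewrite t0.
    by rewrite /A /= enormZ gtr0_norm ?invr_gt0 // mulVf // gt_eqF.
  - by exists t; rewrite t0 (lt_le_trans te).
  have tu : tangent_cone X x u.
    move=> e e0; have [|u' [_ [t [/andP[t0 te] ct uE]]] uu] := hu (e / 2); first by rewrite divr_gt0.
    have n0 : 0 < enorm (q t - x) by apply: lt_trans ct; rewrite mulr_gt0.
    exists (q t), (enorm (q t - x))^-1; split.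
    - exact: (proj1 (near_ptP _)).
    - by rewrite invr_gt0.
    - by have := q2 t t0; lra.
    - by rewrite -uE; lra.
  have uv := pol u tu.
  have [|u' [_ [t [/andP[t0 te] ct uE]]] uu] := hu (c / 4); first by rewrite divr_gt0.
  have n0 : 0 < enorm (q t - x) by apply: lt_trans ct; rewrite mulr_gt0.
  have : c / 2 <= dot u' v.
    rewrite uE dotZl ler_pdivlMl // -(ler_pM2l (_ : 0 < 2 * t)) ?mulr_gt0 //.
    apply: le_trans (qsq t t0); rewrite expr2.
    rewrite (_ : 2 * t * _ = enorm (q t - x) * (c * t)); last by field.
    by rewrite ler_pM2l // ltW.
  have := cauchy_schwarz (u' - u) v; rewrite v1 mulr1 dotBl; lra.
apply: prox_limit (ltW s0) => e e0.
pose c := Num.min (1 / 2) (e / 4).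
have c0 : 0 < c by rewrite lt_min !divr_gt0.
have c12 : c <= 1 / 2 by rewrite ge_min lexx.
have ce : c <= e / 4 by rewrite ge_min lexx orbT.
have [delta delta0 hd] := small c c0.
pose t := Num.min (Num.min delta r) 1 / 2.
have m0 : 0 < Num.min (Num.min delta r) 1 by rewrite !lt_min delta0 r0 ltr01.
have t0 : 0 < t by rewrite divr_gt0.
have : t < Num.min (Num.min delta r) 1 by rewrite /t; lra.
rewrite !lt_min => /andP[/andP[td tr] t1].
have := hd t; rewrite t0 td => /(_ isT) qc.
pose y := x + t *: v.
have dE : infdist y X = enorm (t *: v - (q t - x)).
  by rewrite -(proj2 (near_ptP y)) opprB addrA [t *: v + x]addrC.
have ct : c * t <= t / 2 by have := ler_wpM2r (ltW t0) c12; lra.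
have dge : t - c * t <= infdist y X.
  have := ler_enormD (t *: v - (q t - x)) (q t - x); rewrite subrK -dE enormZ v1 mulr1 gtr0_norm //; lra.
have dle : infdist y X <= t by rewrite dE qd.
have d0 : 0 < infdist y X by lra.
exists (q t), ((infdist y X)^-1 *: (y - q t)); split.
- by apply: near_pt_prox => //; [lra|rewrite s0].
- by apply: le_trans qc _; have := mulr_ge0 (ltW c0) (ltW (t0)); nra.
- rewrite -(ler_pM2l d0) -{1}(gtr0_norm d0) -enormZ scalerBr scalerA mulfV ?gt_eqF // scale1r.
  rewrite (_ : y - q t - _ = (t - infdist y X) *: v - (q t - x)); last first.
    by apply/rowP => i; rewrite !mxE; ring.
  apply: le_trans (ler_enormB _ _) _; rewrite enormZ v1 mulr1 ger0_norm ?subr_ge0 //.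
  have : t / 2 * e <= infdist y X * e by rewrite ler_wpM2r ?(ltW e0) //; lra.
  have := ler_wpM2r (ltW t0) ce; lra.
- by rewrite enormZ gtr0_norm ?invr_gt0 // (proj2 (near_ptP y)) mulVf // gt_eqF.
Qed.

(** An interior point would put [x + h *: v] in [X], inside the forbidden ball. For tangent vectors
    the bound is quadratic in [b - x], so its rescaled limit is 0. *)
Lemma prox_nor p s : X (lsubmx p) -> enorm (rsubmx p) = 1 -> 0 < s ->
  prox_normal s (lsubmx p) (rsubmx p) -> nor X p.
Proof.
set x := lsubmx p; set v := rsubmx p => Xx v1 s0 pv; split => //.
  split; first exact: subset_closure.
  move=> /nbhs_enormP[e e0 ex].
  pose h := Num.min (e / 2) s.
  have h0 : 0 < h by rewrite lt_min divr_gt0.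
  have hE : enorm (x + h *: v - x) = h by rewrite addrDBl enormZ v1 mulr1 gtr0_norm.
  have he : h <= e / 2 by rewrite ge_min lexx.
  have hs : h <= s by rewrite ge_min lexx orbT.
  have := pv (x + h *: v) (ex _ _); rewrite hE => /(_ _)/wrap[]; first lra.
  rewrite addrDBl dotZl dot_enorm v1; have := ler_wpM2r (ltW h0) hs; have := mulr_gt0 h0 h0; nra.
move=> u tu; apply/ler_addgt0Pr => e e0; rewrite add0r.
pose K := (enorm u + 1) / (2 * s) + 1.
have K0 : 0 < K by rewrite ltr_wpDl // divr_ge0 ?addr_ge0 ?enorm_ge0 ?mulr_ge0 // ltW.
pose c := Num.min 1 (e / K).
have c0 : 0 < c by rewrite lt_min ltr01 divr_gt0.
have c1 : c <= 1 by rewrite ge_min lexx.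
have cK : c * K <= e by rewrite -ler_pdivlMr // ge_min lexx orbT.
have [b [t [Xb t0 bx bu]]] := tu c c0.
have hb := pv b Xb.
have tb : t * enorm (b - x) <= enorm u + c.
  rewrite -{1}(gtr0_norm t0) -enormZ.
  by have := ler_enormD (t *: (b - x) - u) u; rewrite subrK; lra.
have d1 : dot u v <= dot (t *: (b - x)) v + c.
  have := cauchy_schwarz (u - t *: (b - x)) v; rewrite v1 mulr1 dotBl (enormBC u); lra.
have d2 : dot (t *: (b - x)) v <= (enorm u + 1) * c / (2 * s).
  rewrite dotZl ler_pdivlMr ?mulr_gt0 //.
  have := ler_wpM2l (ltW t0) hb; rewrite expr2.
  have : t * (enorm (b - x) * enorm (b - x)) <= (enorm u + 1) * c.
    rewrite mulrA; apply: ler_pM; rewrite ?mulr_ge0 ?enorm_ge0 ?(ltW t0) ?(ltW bx) //; lra.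
  lra.
have : (enorm u + 1) * c / (2 * s) + c <= e.
  by apply: le_trans cK; rewrite /K mulrDr mulr1 lerD2r mulrAC mulrC.
lra.
Qed.

Lemma near_pt_var y s w : 0 < s < r -> infdist y X < r -> X w ->
  dot (w - near_pt y) (y - near_pt y) <= infdist y X / (2 * s) * enorm (w - near_pt y) ^+ 2.
Proof.
move=> /andP[s0 sr] yr Xw; have [d0|d0] := eqVneq (infdist y X) 0.
  have : y - near_pt y = 0 by apply: enorm_eq0; rewrite (proj2 (near_ptP y)).
  by move=> ->; rewrite dot0r d0 !mul0r.
have {}d0 : 0 < infdist y X by rewrite lt_neqAle eq_sym d0 infdist_ge0.
have := near_pt_prox d0 yr; move=> /(_ s); rewrite s0 sr => /(_ isT w Xw).
rewrite dotZr => h.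
rewrite -(ler_pM2l (_ : 0 < 2 * s / infdist y X)) ?divr_gt0 ?mulr_gt0 //.
rewrite (_ : 2 * s / infdist y X * (_ / _ * _) = enorm (w - near_pt y) ^+ 2); last first.
  by field; rewrite !gt_eqF.
by apply: le_trans h; rewrite !mulrA.
Qed.

(** Take the proximal inequalities with radius [r / 2]. At distances below [r / 4] each of them
    loses at most a quarter of the squared distance of the projections, which leaves one half and
    hence the constant 2. *)
Lemma near_pt_lip y z : infdist y X < r / 4 -> infdist z X < r / 4 ->
  enorm (near_pt y - near_pt z) <= 2 * enorm (y - z).
Proof.
move=> y4 z4; have r2 : 0 < r / 2 < r by apply/andP; split; have := r0; lra.
have yr : infdist y X < r by have := r0; lra.
have zr : infdist z X < r by have := r0; lra.
have h1 := near_pt_var r2 yr (proj1 (near_ptP z)).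
have h2 := near_pt_var r2 zr (proj1 (near_ptP y)).
rewrite (enormBC (near_pt z)) in h1.
set N := enorm (near_pt y - near_pt z) in h1 h2 *.
have c a : a < r / 4 -> a / (2 * (r / 2)) * N ^+ 2 <= N ^+ 2 / 4.
  move=> ar; rewrite mulrC ler_wpM2l ?sqr_ge0 // ler_pdivrMr ?mulr_gt0 ?divr_gt0 ?r0 //.
  by have := r0; lra.
have h3 := c _ y4; have h4 := c _ z4.
have cs := cauchy_schwarz (near_pt y - near_pt z) (y - z); rewrite -/N in cs.
have e : N ^+ 2 = dot (near_pt y - near_pt z) (y - z) +
   (dot (near_pt z - near_pt y) (y - near_pt y) + dot (near_pt y - near_pt z) (z - near_pt z)).
  by rewrite /N sqr_enorm !dotE; ring.
have {}h : N ^+ 2 <= 2 * (N * enorm (y - z)) by lra.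
have [N0|N0] := eqVneq N 0; first by rewrite N0 mulr_ge0 // enorm_ge0.
have Np : 0 < N by rewrite lt_neqAle eq_sym N0 enorm_ge0.
by rewrite -(ler_pM2l Np); move: h; rewrite expr2; lra.
Qed.

End PositiveReach.

(** * Differential of the nearest-point projection *)

Section RowMx.
Context {R : realType} {n k : nat}.
Implicit Types (a : 'rV[R]_n) (b : 'rV[R]_k).

Lemma dot_row_mx a a' b b' : dot (row_mx a b) (row_mx a' b') = dot a a' + dot b b'.
Proof.
rewrite /dot big_split_ord /=; congr (_ + _); apply: eq_bigr => i _.
  by rewrite !row_mxEl.
by rewrite !row_mxEr.
Qed.

Lemma sqr_enorm_row_mx a b : enorm (row_mx a b) ^+ 2 = enorm a ^+ 2 + enorm b ^+ 2.
Proof. by rewrite !sqr_enorm dot_row_mx. Qed.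
Lemma enorm_row_mx_le a b : enorm (row_mx a b) <= enorm a + enorm b.
Proof.
rewrite -(@ler_pXn2r _ 2) ?nnegrE ?addr_ge0 ?enorm_ge0 // sqr_enorm_row_mx.
by have := mulr_ge0 (enorm_ge0 a) (enorm_ge0 b); nra.
Qed.

Lemma enorm_row_mxl a b : enorm a <= enorm (row_mx a b).
Proof.
rewrite -(@ler_pXn2r _ 2) ?nnegrE ?enorm_ge0 // sqr_enorm_row_mx lerDl.
exact: sqr_ge0.
Qed.

Lemma enorm_row_mxr a b : enorm b <= enorm (row_mx a b).
Proof.
rewrite -(@ler_pXn2r _ 2) ?nnegrE ?enorm_ge0 // sqr_enorm_row_mx lerDr.
exact: sqr_ge0.
Qed.

Lemma enorm_lsubmx (p : 'rV[R]_(n + k)) : enorm (lsubmx p) <= enorm p.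
Proof. by rewrite -{2}(hsubmxK p) enorm_row_mxl. Qed.
Lemma enorm_rsubmx (p : 'rV[R]_(n + k)) : enorm (rsubmx p) <= enorm p.
Proof. by rewrite -{2}(hsubmxK p) enorm_row_mxr. Qed.
Lemma row_mxB (a a' : 'rV[R]_n) (b b' : 'rV[R]_k) :
  row_mx a b - row_mx a' b' = row_mx (a - a') (b - b').
Proof. by rewrite opp_row_mx add_row_mx. Qed.

End RowMx.

(** Over N equal steps the quadratic errors add up to only K / N. *)
Lemma discrete_mvt (R : realType) (g : R -> R) (M K : R) : 0 <= K ->
  (forall t t', 0 <= t <= 1 -> 0 <= t' <= 1 -> t <= t' ->
    `|g t' - g t| <= M * (t' - t) + K * (t' - t) ^+ 2) ->
  `|g 1 - g 0| <= M.
Proof.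
move=> K0 hg; apply/ler_addgt0Pr => e e0.
have [N hN] : exists N : nat, N.+1%:R^-1 < e / (K + 1).
  by apply: ex_natinv_lt; rewrite divr_gt0 // ltr_wpDl.
have N0 : 0 < N.+1%:R :> R by rewrite ltr0n.
have step k : (k <= N.+1)%N ->
    `|g (k%:R / N.+1%:R) - g 0| <= k%:R * (M / N.+1%:R + K / N.+1%:R ^+ 2).
  elim: k => [|k ih kN]; first by rewrite mul0r subrr normr0 mul0r.
  have h1 : 0 <= (k%:R / N.+1%:R : R) <= 1.
    by rewrite divr_ge0 //= ler_pdivrMr // mul1r ler_nat ltnW.
  have h2 : 0 <= (k.+1%:R / N.+1%:R : R) <= 1.
    by rewrite divr_ge0 //= ler_pdivrMr // mul1r ler_nat.
  have h3 : k%:R / N.+1%:R <= k.+1%:R / N.+1%:R :> R.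
    by rewrite ler_pM2r ?invr_gt0 // ler_nat.
  have := hg _ _ h1 h2 h3; have := ih (ltnW kN).
  have -> : k.+1%:R / N.+1%:R - k%:R / N.+1%:R = N.+1%:R^-1 :> R.
    by rewrite -mulrBl -natr1 addrAC subrr add0r mul1r.
  rewrite exprVn => i1 i2.
  rewrite (_ : g _ - g 0 = (g (k.+1%:R / N.+1%:R) - g (k%:R / N.+1%:R)) + (g (k%:R / N.+1%:R) - g 0)); last by ring.
  by apply: le_trans (ler_normD _ _) _; rewrite (_ : k.+1%:R * _ = (M / N.+1%:R + K / N.+1%:R ^+ 2) + k%:R * (M / N.+1%:R + K / N.+1%:R ^+ 2)) ?lerD // -natr1 mulrDl mul1r addrC.
have := step N.+1 (leqnn _); rewrite divff ?gt_eqF // => /le_trans; apply.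
rewrite mulrDr mulrC divfK ?gt_eqF // lerD2l.
rewrite (_ : _ * _ = K / N.+1%:R); last by field; rewrite gt_eqF.
have K1 : 0 < K + 1 by rewrite ltr_wpDl.
rewrite ltr_pdivlMr // in hN.
have : 0 < N.+1%:R^-1 :> R by rewrite invr_gt0.
move: hN; move: (N.+1%:R^-1) => a; nra.
Qed.

Section MatrixDifferential.
Context {R : realType} {n : nat}.
Implicit Types (x y z u w h : 'rV[R]_n) (A : 'M[R]_n).

Definition mdiff_at (f : 'rV[R]_n -> 'rV[R]_n) z A := forall tau, 0 < tau ->
  exists2 delta, 0 < delta & forall h, enorm h < delta ->
    enorm (f (z + h) - f z - h *m A) <= tau * enorm h.

Lemma diff_at_mdiff (f : 'rV[R]_n -> 'rV[R]_n) z : (forall j, diff_at (fun y => f y 0 j) z) -> exists A, mdiff_at f z A.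
Proof.
move=> fz; have [c hc] := choice fz.
exists (\matrix_(i, j) c j 0 i) => tau tau0.
have t0 : 0 < tau / (n%:R + 1) by rewrite divr_gt0 // ltr_wpDl.
have hd j : exists d, 0 < d /\ forall h, enorm h < d ->
    `|f (z + h) 0 j - f z 0 j - dot h (c j)| <= tau / (n%:R + 1) * enorm h.
  by have [d d0 h] := hc j _ t0; exists d.
have [d dP] := choice hd.
have [delta delta0 hdelta] : exists2 delta, 0 < delta & forall j, delta <= d j.
  exists (\big[Num.min/1]_j d j).
    by apply: lt_bigmin => // j _; case: (dP j).
  by move=> j; exact: bigmin_le.
exists delta => // h hh.
apply: le_trans (enorm_le_coord (e := tau / (n%:R + 1) * enorm h) _) _.
  move=> j; have [_ /(_ h (lt_le_trans hh (hdelta j)))] := dP j.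
  rewrite !mxE; congr (`| _ - _ | <= _).
  by rewrite /dot; apply: eq_bigr => i _; rewrite mxE.
rewrite mulrA ler_wpM2r ?enorm_ge0 // mulrCA ler_piMr ?(ltW tau0) //.
by rewrite ler_pdivrMr ?ltr_wpDl // mul1r lerDl.
Qed.

Lemma mulmx_enorm_bound k (A : 'M[R]_(n, k)) : exists2 K, 0 < K & forall u, enorm (u *m A) <= K * enorm u.
Proof.
pose K := \sum_j enorm (\row_i A i j).
have K0 : 0 <= K by apply: sumr_ge0 => j _; exact: enorm_ge0.
exists (K + 1); first by rewrite ltr_wpDl.
move=> u; apply: le_trans (enorm_le_sum _) _.
apply: le_trans (_ : K * enorm u <= _); last by rewrite ler_wpM2r ?enorm_ge0 // lerDl.
rewrite mulr_suml; apply: ler_sum => j _.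
rewrite (_ : (u *m A) 0 j = dot u (\row_i A i j)); last first.
  by rewrite mxE; apply: eq_bigr => i _; rewrite mxE.
by rewrite mulrC normr_dot_le.
Qed.

End MatrixDifferential.

Section ProjectionDifferential.
Context {R : realType} {n : nat}.
Implicit Types (x y z u w h : 'rV[R]_n) (A : 'M[R]_n).
Variables (X : set 'rV[R]_n) (r : R).
Hypothesis Xc : closed X.
Hypothesis r0 : 0 < r.
Hypothesis reach : forall y, infdist y X < r ->
  exists! x, X x /\ enorm (y - x) = infdist y X.
Variable near_pt : 'rV[R]_n -> 'rV[R]_n.
Hypothesis near_ptP : forall y, X (near_pt y) /\ enorm (y - near_pt y) = infdist y X.

(* [phi] is a supremum of affine functions, with the nearest point as a
   subgradient. *)
Let phi y := (enorm y ^+ 2 - infdist y X ^+ 2) / 2.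
Let phi_subgradient y y' : dot (y' - y) (near_pt y) <= phi y' - phi y.
Proof.
have h : infdist y' X ^+ 2 <= enorm (y' - near_pt y) ^+ 2.
  rewrite lerXn2r ?nnegrE ?enorm_ge0 ?infdist_ge0 //.
  by apply: infdist_le; exact: (proj1 (near_ptP y)).
rewrite /phi -(proj2 (near_ptP y)).
move: h; rewrite !enorm_sqrB dotBl; lra.
Qed.

(** A tangent ball of radius [s > rho] misses [X] and contains the one of radius [rho]. *)
Lemma nor_near_pt p rho : nor X p -> 0 < rho < r ->
  infdist (lsubmx p + rho *: rsubmx p) X = rho /\ near_pt (lsubmx p + rho *: rsubmx p) = lsubmx p.
Proof.
move=> np /andP[rho0 rhor].
pose s := (rho + r) / 2.
have s0r : 0 < s < r by rewrite /s; apply/andP; split; lra.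
have pv := nor_prox Xc r0 reach near_ptP np s0r.
have [frx v1 _] := np; have {}v1 : enorm (rsubmx p) = 1 by exact: v1.
have Xx : X (lsubmx p) by apply: Xc; case: frx.
set x := lsubmx p in pv Xx *; set v := rsubmx p in pv v1 *.
have xrho : enorm (x + rho *: v - x) = rho by rewrite addrDBl enormZ v1 mulr1 gtr0_norm.
have dge : rho <= infdist (x + rho *: v) X.
  apply: infdist_ge; first by exists x.
  move=> w Xw; rewrite -(@ler_pXn2r _ 2) ?nnegrE ?enorm_ge0 ?(ltW rho0) //.
  rewrite (_ : x + rho *: v - w = rho *: v - (w - x)); last by apply/rowP => i; rewrite !mxE; ring.
  rewrite enorm_sqrB enormZ v1 mulr1 gtr0_norm // dotZl (dotC v).
  have := pv w Xw; have [d0|d0] := leP 0 (dot (w - x) v).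
    have : 2 * rho * dot (w - x) v <= 2 * s * dot (w - x) v.
      by rewrite ler_wpM2r // ler_wpM2l // /s; lra.
    lra.
  by have := sqr_ge0 (enorm (w - x)); have := mulr_gt0 rho0 (_ : 0 < - dot (w - x) v); rewrite oppr_gt0 => /(_ d0); lra.
have dE : infdist (x + rho *: v) X = rho.
  by apply/eqP; rewrite eq_le dge andbT -{2}xrho infdist_le.
by split=> //; apply: (near_pt_unique reach near_ptP) => //; rewrite dE.
Qed.

Variables (z : 'rV[R]_n) (A : 'M[R]_n).
Hypothesis z4 : infdist z X < r / 4.
Hypothesis dA : mdiff_at near_pt z A.
Let near_z4 : exists2 delta, 0 < delta & forall h, enorm h < delta -> infdist (z + h) X < r / 4.
Proof.
exists (r / 4 - infdist z X); first by rewrite subr_gt0.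
move=> h hh; have := infdist_lip (z + h) z X; rewrite addrDBl ler_norml => /andP[_]; lra.
Qed.

(** Along the segment, [near_pt] is a subgradient of [phi] and is Lipschitz, so [phi] has the linear
    increments given by [near_pt] up to a quadratic error; [discrete_mvt] integrates the first-order
    expansion of [near_pt] into a second-order one of [phi]. *)
Lemma phi_taylor tau : 0 < tau -> exists2 delta, 0 < delta & forall h, enorm h < delta ->
  `|phi (z + h) - phi z - dot h (near_pt z) - dot h (h *m A) / 2| <= tau * enorm h ^+ 2.
Proof.
move=> tau0; have [d1 d10 hd1] := dA tau0; have [d2 d20 hd2] := near_z4.
exists (Num.min d1 d2); first by rewrite lt_min d10.
move=> h; rewrite lt_min => /andP[h1 h2].
pose g t := phi (z + t *: h) - t * dot h (near_pt z) - t ^+ 2 * (dot h (h *m A) / 2).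
have := @discrete_mvt R g (tau * enorm h ^+ 2) (2 * enorm h ^+ 2 + `|dot h (h *m A) / 2|).
rewrite {3 4}/g expr0n /= !mul0r scale0r addr0 !subr0 !scale1r expr1n !mul1r.
rewrite (_ : phi (z + h) - _ - _ - phi z = phi (z + h) - phi z - dot h (near_pt z) - dot h (h *m A) / 2); last by ring.
apply; first by rewrite addr_ge0 // mulr_ge0 // sqr_ge0.
move=> t t' /andP[t0 t1] /andP[t'0 t'1] tt'.
have th s : 0 <= s <= 1 -> enorm (s *: h) <= enorm h.
  by move=> /andP[s0 s1]; rewrite enormZ ger0_norm // ler_piMl // enorm_ge0.
have th1 : enorm (t *: h) <= enorm h by apply: th; rewrite t0.
have th2 : enorm (t' *: h) <= enorm h by apply: th; rewrite t'0.
have a4 := hd2 _ (le_lt_trans th1 h2); have b4 := hd2 _ (le_lt_trans th2 h2).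
have Pt := hd1 _ (le_lt_trans th1 h1).
set y := z + t *: h in a4 Pt *; set y' := z + t' *: h in b4 *.
have yy : y' - y = (t' - t) *: h.
  by rewrite /y' /y opprD addrACA subrr add0r scalerBl.
have lipP := near_pt_lip Xc r0 reach near_ptP b4 a4.
have s1 := phi_subgradient y y'; have s2 := phi_subgradient y' y.
have tt0 : 0 <= t' - t by rewrite subr_ge0.
have N0 := enorm_ge0 h.
have s3 : phi y' - phi y - dot (y' - y) (near_pt y) <= 2 * enorm h ^+ 2 * (t' - t) ^+ 2.
  have cs := cauchy_schwarz (y' - y) (near_pt y' - near_pt y).
  have e1 : phi y' - phi y - dot (y' - y) (near_pt y) <= dot (y' - y) (near_pt y' - near_pt y).
    by move: s2; rewrite dotBr -(opprB y' y) dotNl; lra.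
  apply: le_trans e1 (le_trans cs _).
  rewrite yy enormZ ger0_norm // in lipP *.
  have := ler_wpM2l (mulr_ge0 tt0 N0) lipP; nra.
have dP : `|dot h (near_pt y) - dot h (near_pt z) - t * dot h (h *m A)| <= tau * enorm h ^+ 2.
  rewrite (_ : _ - _ = dot h (near_pt y - near_pt z - (t *: h) *m A)); last first.
    by rewrite -scalemxAl !dotBr dotZr.
  apply: le_trans (normr_dot_le _ _) _.
  apply: le_trans (ler_wpM2l N0 Pt) _; rewrite mulrCA ler_wpM2l ?(ltW tau0) // expr2.
  by rewrite ler_wpM2l.
have -> : g t' - g t = (phi y' - phi y - dot (y' - y) (near_pt y)) +
   (t' - t) * (dot h (near_pt y) - dot h (near_pt z) - t * dot h (h *m A)) -
   (t' - t) ^+ 2 * (dot h (h *m A) / 2).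
  by rewrite /g yy dotZl -/y -/y'; field.
apply: le_trans (ler_normB _ _) _.
rewrite (mulrDl _ _ ((t' - t) ^+ 2)) addrA; apply: lerD; last first.
  by rewrite normrM ger0_norm ?sqr_ge0 // mulrC.
apply: le_trans (ler_normD _ _) _; rewrite addrC; apply: lerD.
  by rewrite ger0_norm ?s3 // subr_ge0.
by rewrite normrM ger0_norm // mulrC ler_wpM2r.
Qed.

(** [A] is the differential of the gradient map of the convex function [phi]. Blowing up the
    subgradient inequality at [z] makes [u *m A] a subgradient at [u] of the quadratic form [q],
    whose gradient comes from the symmetric part of [A]. *)
Lemma mdiff_symmetric u w : dot (u *m A) w = dot u (w *m A).
Proof.
suff h u' w' : dot w' (u' *m A) <= dot u' (w' *m A).
  by apply/eqP; rewrite eq_le (dotC (u *m A)) h /= h.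
pose q v := dot v (v *m A) / 2.
have qZ t v : q (t *: v) = t ^+ 2 * q v.
  by rewrite /q -scalemxAl dotZl dotZr; ring.
(* The subgradient inequality at [z + t *: u'], expanded to second order and divided by [t ^+ 2]. *)
have key k : dot k (u' *m A) <= q (u' + k) - q u'.
  apply/ler_addgt0Pr => e e0.
  pose N := enorm (u' + k) ^+ 2 + enorm u' ^+ 2 + enorm k * enorm u' + 1.
  have N0 : 0 < N by rewrite ltr_wpDl // !addr_ge0 ?sqr_ge0 ?mulr_ge0 ?enorm_ge0.
  have [c eN eE] : exists2 c, 0 < c & e = c * N.
    by exists (e / N); rewrite ?divr_gt0 // divfK // gt_eqF.
  have [d1 d10 hd1] := phi_taylor eN; have [d2 d20 hd2] := dA eN.
  pose M := enorm (u' + k) + enorm u' + 1.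
  have M0 : 0 < M by rewrite ltr_wpDl // addr_ge0 ?enorm_ge0.
  have [t [t0 tM1 tM2]] : exists t, [/\ 0 < t, t * M < d1 & t * M < d2].
    have m0 : 0 < Num.min d1 d2 by rewrite lt_min d10.
    exists (Num.min d1 d2 / (2 * M)); rewrite divr_gt0 ?mulr_gt0 //.
    have : Num.min d1 d2 / (2 * M) * M < Num.min d1 d2.
      by rewrite invfM mulrA -mulrA mulVf ?gt_eqF // mulr1; lra.
    by rewrite lt_min => /andP[].
  have t1 : enorm (t *: (u' + k)) < d1.
    rewrite enormZ gtr0_norm //; apply: le_lt_trans tM1; rewrite ler_wpM2l ?(ltW t0) //.
    by rewrite /M; have := enorm_ge0 u'; lra.
  have t2 : enorm (t *: u') < d1.
    rewrite enormZ gtr0_norm //; apply: le_lt_trans tM1; rewrite ler_wpM2l ?(ltW t0) //.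
    by rewrite /M; have := enorm_ge0 (u' + k); lra.
  have t3 : enorm (t *: u') < d2.
    rewrite enormZ gtr0_norm //; apply: le_lt_trans tM2; rewrite ler_wpM2l ?(ltW t0) //.
    by rewrite /M; have := enorm_ge0 (u' + k); lra.
  have a1 := hd1 _ t1; have a2 := hd1 _ t2; have a3 := hd2 _ t3.
  have s1 := phi_subgradient (z + t *: u') (z + t *: (u' + k)).
  rewrite (_ : z + t *: (u' + k) - (z + t *: u') = t *: k) in s1; last first.
    by apply/rowP => i; rewrite !mxE; ring.
  rewrite -[dot _ _ / 2]/(q _) qZ enormZ (gtr0_norm t0) (exprMn 2 t) in a1.
  rewrite -[dot _ _ / 2]/(q _) qZ enormZ (gtr0_norm t0) (exprMn 2 t) in a2.
  rewrite enormZ gtr0_norm // in a3.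
  have a4 : `|dot (t *: k) (near_pt (z + t *: u') - near_pt z - (t *: u') *m A)| <=
      t * enorm k * (c * (t * enorm u')).
    apply: le_trans (normr_dot_le _ _) _.
    by rewrite enormZ (gtr0_norm t0) ler_wpM2l // mulr_ge0 ?enorm_ge0 // ltW.
  rewrite -(ler_pM2l (_ : 0 < t ^+ 2)) ?exprn_gt0 //.
  rewrite !ler_norml in a1 a2 a4; move: a1 a2 a4 => /andP[b1 b2] /andP[b3 b4] /andP[b5 b6].
  rewrite -scalemxAl !dotBr !dotZl !dotZr in b5 b6 s1.
  rewrite !dotZl in b1 b2 b3 b4; rewrite dotDl in b1 b2.
  rewrite eE mulrDr mulrBr /N; clear tM1 tM2 t1 t2 t3 a3; nra.
(* Take [k = s *: w'] and let [s] tend to 0: the linear term of [q] is the mean of the two mixed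
   products, so one of them is at most the other. *)
apply/ler_addgt0Pr => e e0.
pose K := `|q w'| + 1.
have K0 : 0 < K by rewrite ltr_wpDl.
pose s := e / (2 * K); have s0 : 0 < s by rewrite divr_gt0 // mulr_gt0.
have := key (s *: w').
have -> : q (u' + s *: w') - q u' = s * (dot u' (w' *m A) + dot w' (u' *m A)) / 2 + s ^+ 2 * q w'.
  by rewrite /q mulmxDl -scalemxAl !dotE; field.
rewrite dotZl => h.
have h1 : s * q w' <= e / 2.
  have : s * q w' <= s * K by rewrite ler_wpM2l ?(ltW s0) // /K (le_trans (ler_norm _)) // lerDl.
  have -> : s * K = e / 2 by rewrite /s; field; rewrite gt_eqF.
  by [].
have : s * dot w' (u' *m A) <= s * (dot u' (w' *m A) + e).
  have : s * (s * q w') <= s * (e / 2) by rewrite ler_pM2l.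
  by rewrite expr2 in h; nra.
by rewrite ler_pM2l.
Qed.

Lemma mdiff_ge0 u : 0 <= dot u (u *m A).
Proof.
apply/ler_addgt0Pr => e e0.
pose N := enorm u ^+ 2 + 1; have N0 : 0 < N by rewrite ltr_wpDl // sqr_ge0.
have [c eN eE] : exists2 c, 0 < c & e = c * N.
  by exists (e / N); rewrite ?divr_gt0 // divfK // gt_eqF.
have [d d0 hd] := dA eN.
pose M := enorm u + 1; have M0 : 0 < M by rewrite ltr_wpDl ?enorm_ge0.
pose t := d / (2 * M); have t0 : 0 < t by rewrite divr_gt0 // mulr_gt0.
have tu : enorm (t *: u) < d.
  rewrite enormZ gtr0_norm //; apply: le_lt_trans (_ : t * M < d).
    by rewrite ler_wpM2l ?(ltW t0) // /M lerDl.
  by rewrite /t invfM mulrA -mulrA mulVf ?gt_eqF // mulr1; lra.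
have := hd _ tu; have := near_pt_mono near_ptP (z + t *: u) z.
rewrite addrDBl enormZ gtr0_norm // => h1 h2.
have cs := cauchy_schwarz (t *: u) (near_pt (z + t *: u) - near_pt z - (t *: u) *m A).
rewrite dotBr -scalemxAl dotZr dotZl dotZl enormZ gtr0_norm // in cs.
have h3 : t * enorm u * enorm (near_pt (z + t *: u) - near_pt z - t *: (u *m A)) <=
    t * enorm u * (c * (t * enorm u)).
  by rewrite scalemxAl; apply: ler_wpM2l h2; rewrite mulr_ge0 ?enorm_ge0 ?(ltW t0).
rewrite dotZl in h1.
rewrite -(ler_pM2l (_ : 0 < t ^+ 2)) ?exprn_gt0 // mulr0 mulrDr eE /N.
have c2 : 0 < c * t ^+ 2 by rewrite mulr_gt0 // exprn_gt0.
clear tu h2 hd; clearbody t; move: h1 h3 cs; lra.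
Qed.

End ProjectionDifferential.

(** * Principal curvatures *)

Section Orthonormal.
Context {R : realType} {n : nat}.
Implicit Types (x u v w : 'rV[R]_n) (e : nat -> 'rV[R]_n).

Definition orthonormal e k := forall i j, (i < k)%N -> (j < k)%N -> dot (e i) (e j) = (i == j)%:R.

Lemma dot_row k (a : 'M[R]_(k, n)) u i : (u *m a^T) 0 i = dot u (row i a).
Proof. by rewrite mxE; apply: eq_bigr => j _; rewrite !mxE. Qed.
Lemma mulmx_trE k (a b : 'M[R]_(k, n)) i j : (a *m b^T) i j = dot (row i a) (row j b).
Proof. by rewrite mxE; apply: eq_bigr => l _; rewrite !mxE. Qed.
Lemma orthogonal_exists e k : (k < n)%N -> exists2 u, enorm u = 1 & forall i, (i < k)%N -> dot u (e i) = 0.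
Proof.
move=> kn; pose M := \matrix_(i < k) e i.
have : kermx M^T != 0.
  rewrite kermx_eq0 /row_free neq_ltn; apply/orP; left.
  by rewrite (leq_ltn_trans (rank_leq_col _)).
move=> /rowV0Pn[u /sub_kermxP uM u0].
have uN : 0 < enorm u by rewrite enorm_gt0.
exists ((enorm u)^-1 *: u) => [|i ik].
  by rewrite enormZ gtr0_norm ?invr_gt0 // mulVf // gt_eqF.
have := congr1 (fun a : 'rV[R]_k => a 0 (Ordinal ik)) uM.
by rewrite /= dot_row rowK mxE dotZl => ->; rewrite mulr0.
Qed.

Lemma orthonormal_full e : orthonormal e n ->
  forall w, w = \sum_(i < n) dot w (e i) *: e i.
Proof.
move=> eo w; pose M := \matrix_(i < n) e i.
have : M *m M^T = 1%:M.
  by apply/matrixP => i j; rewrite mulmx_trE !rowK eo ?mxE.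
move=> /mulmx1C MM.
rewrite -{1}[w]mulmx1 -MM mulmxA mulmx_sum_row; apply: eq_bigr => i _.
by rewrite dot_row rowK.
Qed.

End Orthonormal.

(** * Spectral theorem for symmetric matrices *)

Section Spectral.
Context {R : realType} {n : nat}.
Implicit Types (x u v w : 'rV[R]_n).
Variable A : 'M[R]_n.
Hypothesis symA : forall u w, dot (u *m A) w = dot u (w *m A).

(* A maximizer of the Rayleigh quotient on the orthogonal complement of the
   eigenvectors found so far is a new eigenvector. *)
Lemma rayleigh (e : nat -> 'rV[R]_n) (mu : nat -> R) k : (k < n)%N ->
  (forall i, (i < k)%N -> e i *m A = mu i *: e i) ->
  exists u l, [/\ enorm u = 1, forall i, (i < k)%N -> dot u (e i) = 0 & u *m A = l *: u].
Proof.
move=> kn eig.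
pose C := [set u : 'rV[R]_n | enorm u = 1 /\ forall i, (i < k)%N -> dot u (e i) = 0].
have [K K0 hK] := mulmx_enorm_bound A.
have cC : compact C.
  apply: (@bounded_enorm_compact _ _ _ 1) => [u [u1 _]|]; first by rewrite u1.
  apply/closed_enormP => u hu; split.
    apply/eqP; rewrite -subr_eq0 -normr_le0; apply/ler_addgt0Pr => eps eps0; rewrite add0r.
    have [w [w1 _] wu] := hu _ eps0; rewrite -w1 distrC.
    exact: le_trans (ler_dist_enorm _ _) (ltW wu).
  move=> i ik; apply/eqP; rewrite -normr_le0; apply/ler_addgt0Pr => eps eps0; rewrite add0r.
  have E0 : 0 < enorm (e i) + 1 by rewrite ltr_wpDl ?enorm_ge0.
  have [w [_ wi] wu] := hu _ (divr_gt0 eps0 E0).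
  have -> : dot u (e i) = - dot (w - u) (e i) by rewrite dotBl wi // sub0r opprK.
  rewrite normrN; apply: le_trans (normr_dot_le _ _) _.
  move: wu; rewrite ltr_pdivlMr // mulrDr mulr1.
  by have := enorm_ge0 (w - u); lra.
have [u0 u01 u0e] := orthogonal_exists e kn.
pose q u := dot u (u *m A).
have qL u w : C u -> C w -> `|q u - q w| <= 2 * K * enorm (u - w).
  move=> [u1 _] [w1 _].
  have -> : q u - q w = dot (u - w) (u *m A) + dot (w *m A) (u - w).
    by rewrite /q dotBl dotBr (symA w u) (dotC (w *m A) w); ring.
  apply: le_trans (ler_normD _ _) _.
  have := normr_dot_le (u - w) (u *m A); have := normr_dot_le (w *m A) (u - w).
  have := hK u; have := hK w; rewrite u1 w1 !mulr1.
  have := enorm_ge0 (u - w); nra.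
have [u Cu umax] := @compact_argmax _ _ C q (2 * K) cC (ex_intro _ u0 (conj u01 u0e))
  (mulr_ge0 (ler0n R 2) (ltW K0)) qL.
have [u1 ue] := Cu.
(* First variation: the quotient at [u + t *: w] is at most [q u] for both signs of [t], which kills
   the term linear in [t]. *)
have stat w : (forall i, (i < k)%N -> dot w (e i) = 0) -> dot w u = 0 -> dot w (u *m A) = 0.
  move=> we wu.
  have ineq t : 2 * t * dot w (u *m A) + t ^+ 2 * q w <= q u * t ^+ 2 * enorm w ^+ 2.
    pose s := enorm (u + t *: w).
    have s2 : s ^+ 2 = 1 + t ^+ 2 * enorm w ^+ 2.
      by rewrite enorm_sqrD u1 enormZ (exprMn _ `|t|) real_normK ?num_real // dotZr (dotC u) wu; ring.
    have s0 : 0 < s.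
      rewrite lt_neqAle enorm_ge0 andbT; apply/eqP => s0; move: s2; rewrite -s0 expr0n /=.
      have := mulr_ge0 (sqr_ge0 t) (sqr_ge0 (enorm w)); lra.
    have Cs : C (s^-1 *: (u + t *: w)).
      split; first by rewrite enormZ gtr0_norm ?invr_gt0 // mulVf // gt_eqF.
      by move=> i ik; rewrite dotZl dotDl dotZl ue // we // mulr0 addr0 mulr0.
    have := umax _ Cs; rewrite /q -scalemxAl dotZl dotZr mulrA -expr2 exprVn.
    rewrite ler_pdivrMl ?exprn_gt0 // mulmxDl -scalemxAl !dotE -(symA u w) (dotC _ w) s2 -/(q u) -/(q w).
    lra.
  apply/eqP; rewrite -normr_le0; apply/ler_addgt0Pr => eps eps0; rewrite add0r.
  pose M := `|q u * enorm w ^+ 2 - q w| + 1.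
  have M0 : 0 < M by rewrite ltr_wpDl.
  have MM : q u * enorm w ^+ 2 - q w <= M by rewrite /M (le_trans (ler_norm _)) // lerDl.
  have half (t : R) : 0 < t -> t * M <= eps -> `|dot w (u *m A)| <= eps.
    move=> t0 tM; have h1 := ineq t; have h2 := ineq (- t).
    have t2 : 0 < t ^+ 2 by rewrite exprn_gt0.
    have h3 : t ^+ 2 * (q u * enorm w ^+ 2 - q w) <= t * (t * M).
      by rewrite mulrA -expr2 ler_pM2l.
    have h4 : t * (t * M) <= t * eps by rewrite ler_pM2l.
    have c1 : t * dot w (u *m A) <= t * eps by have := mulr_ge0 (ltW t0) (ltW eps0); lra.
    have c2 : t * - dot w (u *m A) <= t * eps by have := mulr_ge0 (ltW t0) (ltW eps0); lra.
    by rewrite ler_norml lerNl -(ler_pM2l t0) c2 -(ler_pM2l t0) c1.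
  by apply: (half (eps / M)); [rewrite divr_gt0 | rewrite divfK // gt_eqF].
exists u, (q u); split=> //.
(* The residual is itself an admissible direction, so stationarity makes it orthogonal to itself. *)
pose w := u *m A - q u *: u.
have we i : (i < k)%N -> dot w (e i) = 0.
  by move=> ik; rewrite dotBl symA eig // dotZr dotZl ue // !mulr0 subrr.
have wu : dot w u = 0.
  by rewrite dotBl dotZl -sqr_enorm u1 expr1n mulr1 (dotC _ u) subrr.
have := stat _ we wu; rewrite -[u *m A](subrK (q u *: u)) -/w dotDr dotZr wu mulr0 addr0.
rewrite -sqr_enorm => /eqP; rewrite sqrf_eq0 => /eqP /enorm_eq0 w0.
by rewrite w0 add0r.
Qed.

(** The prescribed eigenvector stays at index 0. It will be the unit normal, with eigenvalue 0, so
    that the others span the tangent hyperplane. *)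
Lemma eigenbasis v l : enorm v = 1 -> v *m A = l *: v ->
  exists e mu, [/\ e 0%N = v, orthonormal e n & forall i, (i < n)%N -> e i *m A = mu i *: e i].
Proof.
move=> v1 vA.
suff h : forall k, (k <= n)%N -> exists (e : nat -> 'rV[R]_n) (mu : nat -> R),
    [/\ e 0%N = v, orthonormal e k & forall i, (i < k)%N -> e i *m A = mu i *: e i].
  exact: (h n (leqnn n)).
elim=> [|k ih] kn; first by exists (fun=> v), (fun=> 0).
have [k0|k0] := posnP k.
  exists (fun=> v), (fun=> l); rewrite k0; split=> // -[|//] [|//] _ _.
  by rewrite -sqr_enorm v1 expr1n.
have [e [mu [e0 eo eig]]] := ih (ltnW kn).
have [u [m [u1 ue um]]] := rayleigh kn eig.
exists (fun i => if i == k then u else e i), (fun i => if i == k then m else mu i); split.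
- by rewrite eq_sym gtn_eqF.
- move=> i j; rewrite !ltnS (leq_eqVlt i) (leq_eqVlt j).
  case: (eqVneq i k) => [->|_] /=; case: (eqVneq j k) => [->|_] //=.
  + by rewrite -sqr_enorm u1 expr1n.
  + by move=> _ jk; rewrite ue // gtn_eqF.
  + by move=> ik _; rewrite dotC ue // ltn_eqF.
  + exact: eo.
- move=> i; rewrite ltnS leq_eqVlt; case: eqP => [->|_] //=; exact: eig.
Qed.

End Spectral.

Lemma small_mul (R : realType) (s : seq (R * R)) : all (fun q => 0 < q.2) s ->
  exists2 h : R, 0 < h & all (fun q => h * q.1 < q.2) s.
Proof.
move=> sp; suff [h h0 hs] : exists2 h : R, 0 < h & all (fun q => h * `|q.1| < q.2) s.
  exists h => //; apply: sub_all hs => q; apply: le_lt_trans.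
  by rewrite ler_wpM2l ?(ltW h0) // ler_norm.
elim: s sp => [|[a b] s ih] /=; first by exists 1.
move=> /andP[b0 /ih[h h0 hs]].
have a1 : 0 < `|a| + 1 by rewrite ltr_wpDl.
have t0 : 0 < Num.min h (b / (`|a| + 1)) by rewrite lt_min h0 divr_gt0.
exists (Num.min h (b / (`|a| + 1))) => //; apply/andP; split.
  apply: (@lt_le_trans _ _ (Num.min h (b / (`|a| + 1)) * (`|a| + 1))).
    by rewrite ltr_pM2l // ltrDl.
  by rewrite -ler_pdivlMr // ge_min lexx orbT.
apply: sub_all hs => q; apply: le_lt_trans.
by rewrite ler_wpM2r // ge_min lexx.
Qed.

(** [M] is the orthogonal projection onto the complement of the row space. Difference vectors of [S]
    are nearly in the row space, so [M] annihilates their rescaled limits. *)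
Lemma tangent_cone_rowspace (R : realType) n k (S : set 'rV[R]_n) p (b : 'M[R]_(k, n)) :
  b *m b^T = 1%:M ->
  (forall tau, 0 < tau -> exists2 delta, 0 < delta & forall p', S p' -> enorm (p' - p) < delta ->
    exists u : 'rV[R]_n, (u <= b)%MS /\ enorm (p' - p - u) <= tau * enorm (p' - p)) ->
  (forall u, (u <= b)%MS -> tangent_cone S p u) ->
  tangent_cone S p = [set u | (u <= b)%MS].
Proof.
move=> bb app tan; apply/seteqP; split=> [u cu|]; last exact: tan.
pose M : 'M[R]_n := 1%:M - b^T *m b.
have Mb (w : 'rV[R]_n) : (w <= b)%MS -> w *m M = 0.
  move=> /submxP[c ->]; rewrite /M mulmxBr mulmx1 mulmxA -(mulmxA c b) bb mulmx1 subrr //.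
have [K K0 hK] := mulmx_enorm_bound M.
suff : u *m M = 0.
  rewrite /M mulmxBr mulmx1 => /eqP; rewrite subr_eq0 => /eqP uE.
  by rewrite /= uE mulmxA submxMl.
apply: enorm_eq0; apply/eqP; rewrite eq_le enorm_ge0 andbT.
apply/ler_addgt0Pr => e e0; rewrite add0r.
have U0 : 0 < K * (enorm u + 2) by rewrite mulr_gt0 // ltr_wpDl ?enorm_ge0.
pose e' := Num.min 1 (e / (K * (enorm u + 2))).
have e'0 : 0 < e' by rewrite lt_min ltr01 divr_gt0.
have e'1 : e' <= 1 by rewrite ge_min lexx.
have e'e : K * (e' * (enorm u + 2)) <= e.
  by rewrite mulrCA -ler_pdivlMr // ge_min lexx orbT.
have [delta delta0 hd] := app _ e'0.
have m0 : 0 < Num.min e' delta by rewrite lt_min e'0.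
have [q [t [Sq t0 qp tq]]] := cu _ m0.
move: qp tq; rewrite !(lt_min _ e' delta) => /andP[_ qd] /andP[tq _].
have [w [wb wq]] := hd _ Sq qd.
have -> : u *m M = (u - t *: w) *m M by rewrite mulmxBl -scalemxAl (Mb w) // scaler0 subr0.
apply: le_trans (hK _) _; apply: le_trans e'e; rewrite ler_pM2l //.
have h1 : enorm (u - t *: w) <= enorm (t *: (q - p) - u) + enorm (t *: (q - p - w)).
  rewrite (enormBC (t *: (q - p))).
  rewrite (_ : u - t *: w = u - t *: (q - p) + t *: (q - p - w)) ?ler_enormD //.
  by rewrite !scalerBr; apply/rowP => i; rewrite !mxE; ring.
have h2 : enorm (t *: (q - p)) <= enorm u + e'.
  rewrite -{1}(subrK u (t *: (q - p))) (le_trans (ler_enormD _ _)) // addrC lerD2l; exact: ltW.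
rewrite !enormZ (gtr0_norm t0) in h1 h2.
have h3 : t * enorm (q - p - w) <= e' * (t * enorm (q - p)).
  by rewrite mulrCA ler_pM2l.
have h4 : e' * (t * enorm (q - p)) <= e' * (enorm u + e') by rewrite ler_pM2l.
have h5 : e' * e' <= e' * 1 by rewrite ler_pM2l.
lra.
Qed.

Section CurvatureNumbers.
Context {R : realType}.

Lemma curv_sqrD (k : \bar R) : curv_cos k ^+ 2 + curv_sin k ^+ 2 = 1.
Proof.
case: k => [t||] /=; rewrite ?expr0n ?expr1n ?add0r //.
have t0 : 0 < 1 + t ^+ 2 by rewrite ltr_pwDl // sqr_ge0.
have s0 : Num.sqrt (1 + t ^+ 2) != 0 by rewrite gt_eqF // sqrtr_gt0.
rewrite exprVn expr_div_n sqr_sqrtr ?(ltW t0) //; field; rewrite gt_eqF //.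
Qed.

Lemma curv_cos_ge0 (k : \bar R) : 0 <= curv_cos k.
Proof. by case: k => [t||] //=; rewrite invr_ge0 sqrtr_ge0. Qed.
Lemma curv_sin_le1 (k : \bar R) : curv_sin k <= 1.
Proof.
have := curv_sqrD k; have := sqr_ge0 (curv_cos k) => h1 h2.
have [s0|/ltW s0] := leP 0 (curv_sin k); last exact: le_trans ler01.
by rewrite -(@expr_le1 _ 2) // -h2 lerDr.
Qed.

(** An eigenvalue [mu] of the differential of the projection at distance [rho] corresponds to the
    curvature (1 - mu) / (rho mu), infinite when [mu = 0]. [N] normalizes the vector with components
    [mu] and [(1 - mu) / rho]. *)
Lemma curv_exists (mu rho : R) : 0 <= mu -> 0 < rho -> exists k, exists2 N, 0 < N &
  [/\ k != -oo%E, curv_cos k * N = mu & curv_sin k * N = (1 - mu) / rho].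
Proof.
move=> mu0 rho0; have [->|mu1] := eqVneq mu 0.
  by exists +oo%E, rho^-1; rewrite ?invr_gt0 //= mul0r subr0.
have {}mu0 : 0 < mu by rewrite lt_neqAle eq_sym mu1.
pose t := (1 - mu) / (rho * mu).
have s0 : 0 < Num.sqrt (1 + t ^+ 2) by rewrite sqrtr_gt0 ltr_pwDl // sqr_ge0.
exists t%:E, (mu * Num.sqrt (1 + t ^+ 2)); first by rewrite mulr_gt0.
rewrite /=; move: s0; move: (Num.sqrt _) => s s0; split=> //.
  by field; rewrite gt_eqF.
by rewrite /t; field; rewrite !gt_eqF.
Qed.

End CurvatureNumbers.

(** * Tangent space of the normal bundle *)

Section TangentSpace.
Context {R : realType} {n : nat}.
Implicit Types (x y u w h : 'rV[R]_n).
Variables (X : set 'rV[R]_n) (r : R).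
Hypothesis Xc : closed X.
Hypothesis r0 : 0 < r.
Hypothesis reach : forall y, infdist y X < r ->
  exists! x, X x /\ enorm (y - x) = infdist y X.
Variable near_pt : 'rV[R]_n -> 'rV[R]_n.
Hypothesis near_ptP : forall y, X (near_pt y) /\ enorm (y - near_pt y) = infdist y X.
Variables (p : 'rV[R]_(n + n)) (rho : R) (A : 'M[R]_n).
Hypothesis np : nor X p.
Hypothesis rho0 : 0 < rho.
Hypothesis rho4 : rho < r / 4.
Let x0 := lsubmx p.
Let v0 := rsubmx p.
Let z := x0 + rho *: v0.
Hypothesis dA : mdiff_at near_pt z A.
Let v1 : enorm v0 = 1. Proof. by case: np. Qed.
Let infdist_z : infdist z X = rho /\ near_pt z = x0.
Proof.
apply: (nor_near_pt Xc r0 reach near_ptP) => //; rewrite rho0 /=.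
by have := rho4; have := r0; lra.
Qed.

Let z4 : infdist z X < r / 4. Proof. by rewrite (proj1 infdist_z). Qed.
(** The projection is constant along the normal ray. *)
Lemma mdiff_normal : v0 *m A = 0.
Proof.
apply: enorm_eq0; apply/eqP; rewrite eq_le enorm_ge0 andbT.
apply/ler_addgt0Pr => e e0; rewrite add0r.
have [delta delta0 hd] := dA e0.
pose t := Num.min (delta / 2) (r / 4).
have t0 : 0 < t by rewrite lt_min !divr_gt0.
have td : t < delta by apply: (@le_lt_trans _ _ (delta / 2)); [rewrite ge_min lexx | lra].
have tr : t <= r / 4 by rewrite ge_min lexx orbT.
have tn : enorm (t *: v0) = t by rewrite enormZ v1 mulr1 gtr0_norm.
have := hd (t *: v0); rewrite tn => /(_ td).
have [|_] := @nor_near_pt R n X r Xc r0 reach near_pt near_ptP p (rho + t) np.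
  by rewrite addr_gt0 //=; have := rho4; have := r0; lra.
rewrite -/x0 -/v0 scalerDl addrA -/z => ->.
rewrite (proj2 infdist_z) subrr sub0r enormN -scalemxAl enormZ gtr0_norm // mulrC.
by rewrite ler_pM2r.
Qed.

Let symA := mdiff_symmetric Xc r0 reach near_ptP z4 dA.

Lemma mdiff_tangent w : dot (w *m A) v0 = 0.
Proof. by rewrite symA mdiff_normal dot0r. Qed.
(** If [X] lies locally in the half-space below [x0], then moving [z] by a tangent vector does not
    decrease the distance to [X]. So [phi] grows no faster than half the squared norm, and comparing
    quadratic terms bounds [A] by the identity; this is what makes the curvatures nonnegative. *)
Lemma mdiff_le1 w : (exists2 e, 0 < e & forall y, X y -> enorm (y - x0) < e -> dot (y - x0) v0 <= 0) ->
  dot w v0 = 0 -> dot w (w *m A) <= enorm w ^+ 2.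
Proof.
move=> [e e0 half] wv; apply/ler_addgt0Pr => eps eps0.
have W0 : 0 < enorm w ^+ 2 + 1 by rewrite ltr_wpDl // sqr_ge0.
have [d1 d10 hd1] := phi_taylor Xc r0 reach near_ptP z4 dA (divr_gt0 eps0 (mulr_gt0 (ltr0n _ 2) W0)).
have [|h h0 /and3P[h1 h2 h3]] := @small_mul R
  [:: (enorm w, d1); (2 * enorm w, e); (enorm w, r / 4 - rho)].
  by rewrite /= d10 e0 subr_gt0 rho4.
move: h3; rewrite /= andbT => h3; rewrite /= in h1 h2.
have hw : enorm (h *: w) = h * enorm w by rewrite enormZ gtr0_norm.
have := hd1 (h *: w); rewrite hw => /(_ h1).
have zh4 : infdist (z + h *: w) X < r / 4.
  have := infdist_lip (z + h *: w) z X; rewrite addrDBl hw (proj1 infdist_z) ler_norml => /andP[_]; lra.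
set y := z + h *: w in zh4 *.
have Py := near_pt_lip Xc r0 reach near_ptP zh4 z4.
rewrite (proj2 infdist_z) {2}/y addrDBl hw in Py.
have hy := half (near_pt y) (proj1 (near_ptP y)) (le_lt_trans Py (_ : _ < e)).
have {}hy : dot (near_pt y - x0) v0 <= 0 by apply: hy; rewrite mulrCA.
have dy : rho <= infdist y X.
  rewrite -(proj2 (near_ptP y)).
  have := cauchy_schwarz (y - near_pt y) v0; rewrite v1 mulr1; apply: le_trans.
  rewrite (_ : y - near_pt y = rho *: v0 + h *: w - (near_pt y - x0)); last first.
    by rewrite /y /z; apply/rowP => i; rewrite !mxE; ring.
  rewrite (dotBl (rho *: v0 + h *: w)) (dotDl (rho *: v0)) (dotZl rho) (dotZl h) wv.
  by rewrite -[dot v0 v0]sqr_enorm v1 expr1n; lra.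
have dy2 : rho ^+ 2 <= infdist y X ^+ 2.
  by rewrite lerXn2r ?nnegrE ?infdist_ge0 ?(ltW rho0).
rewrite (proj1 infdist_z) (proj2 infdist_z) -scalemxAl !dotZl !dotZr ler_norml => /andP[tay _].
have yE : enorm y ^+ 2 = enorm z ^+ 2 + 2 * h * dot w x0 + h ^+ 2 * enorm w ^+ 2.
  rewrite /y enorm_sqrD hw dotZr (dotC z) {2}/z dotDr dotZr wv; ring.
rewrite yE (exprMn _ h) in tay.
have c2 : eps / (2 * (enorm w ^+ 2 + 1)) * enorm w ^+ 2 <= eps / 2.
  rewrite (_ : _ * _ = eps / 2 * (enorm w ^+ 2 / (enorm w ^+ 2 + 1))); last by field; rewrite gt_eqF.
  rewrite ler_piMr ?divr_ge0 ?(ltW eps0) // ler_pdivrMr // mul1r lerDl //.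
have c3 : h ^+ 2 * (eps / (2 * (enorm w ^+ 2 + 1)) * enorm w ^+ 2) <= h ^+ 2 * (eps / 2).
  by rewrite ler_pM2l // exprn_gt0.
rewrite -(@ler_pM2l _ (h ^+ 2)) ?exprn_gt0 //.
move: tay c3; move: (eps / (2 * _)) => c; lra.
Qed.

(** Differential at [z] of the map sending y to (P(y), (y - P(y)) / rho), with P the projection
    [near_pt]; on the level set at distance [rho] this map parametrizes the normal bundle. *)
Definition tangent_mx : 'M[R]_(n, n + n) := row_mx A (rho^-1 *: (1%:M - A)).

Lemma tangent_mxE w : w *m tangent_mx = row_mx (w *m A) (rho^-1 *: (w - w *m A)).
Proof. by rewrite mul_mx_row -scalemxAr mulmxBr mulmx1. Qed.
(** [p'] comes from the point [z' = x' + rho *: v'] of the same level set, and [w] is the tangential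
    part of [z' - z]. Discarding the normal part costs only a quadratic error, because [p] and [p']
    both carry tangent balls of radius [rho]. *)
Lemma nor_tangent_approx tau : 0 < tau -> exists2 delta, 0 < delta &
  forall p', nor X p' -> enorm (p' - p) < delta -> exists w, dot w v0 = 0 /\
    enorm (p' - p - w *m tangent_mx) <= tau * enorm (p' - p).
Proof.
(* [K1] pays for passing from [p' - p] to [z' - z] and back through both components of [tangent_mx];
   [C] bounds the normal part of [z' - z]. *)
move=> tau0; pose K1 := (1 + rho) * (1 + rho^-1); pose C := 1 / (2 * rho) + 1 + rho / 2.
have ri0 : 0 < rho^-1 by rewrite invr_gt0.
have K10 : 0 < K1 by rewrite mulr_gt0 // addr_gt0.
have C0 : 0 < C by rewrite /C !addr_gt0 // divr_gt0 // mulr_gt0.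
have t10 : 0 < tau / (2 * K1) by rewrite divr_gt0 // mulr_gt0.
have [d1 d10 hd1] := dA t10.
pose delta := Num.min (d1 / (1 + rho)) (tau * rho / (2 * C)).
have delta0 : 0 < delta by rewrite lt_min !divr_gt0 ?mulr_gt0 // addr_gt0.
exists delta => // p' np' pp'.
set x' := lsubmx p'; set v' := rsubmx p'.
have v'1 : enorm v' = 1 by case: np'.
have rr : 0 < rho < r by rewrite rho0 /=; have := r0; have := rho4; lra.
have [dz' Pz'] := nor_near_pt Xc r0 reach near_ptP np' rr.
pose z' := x' + rho *: v'; pose e := enorm (p' - p).
have e0 : 0 <= e by exact: enorm_ge0.
have ppE : p' - p = row_mx (x' - x0) (v' - v0).
  by rewrite -{1}(hsubmxK p') -{1}(hsubmxK p) row_mxB.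
have ex : enorm (x' - x0) <= e by rewrite /e ppE enorm_row_mxl.
have ev : enorm (v' - v0) <= e by rewrite /e ppE enorm_row_mxr.
pose w0 := z' - z.
have w0E : w0 = (x' - x0) + rho *: (v' - v0).
  by rewrite /w0 /z' /z; apply/rowP => i; rewrite !mxE; ring.
have w0e : enorm w0 <= (1 + rho) * e.
  rewrite w0E (le_trans (ler_enormD _ _)) // enormZ gtr0_norm // mulrDl mul1r lerD // ler_pM2l //.
have w0d : enorm w0 < d1.
  apply: le_lt_trans w0e _; rewrite mulrC -ltr_pdivlMr ?addr_gt0 //.
  by apply: lt_le_trans pp' _; rewrite ge_min lexx.
have := hd1 _ w0d; rewrite (_ : z + w0 = z'); last by rewrite /w0 addrC subrK.
rewrite Pz' (proj2 infdist_z) -/x' => err1.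
pose w := w0 - dot w0 v0 *: v0.
have wv : dot w v0 = 0 by rewrite dotBl dotZl -[dot v0 v0]sqr_enorm v1 expr1n mulr1 subrr.
have wA : w *m A = w0 *m A by rewrite mulmxBl -scalemxAl mdiff_normal scaler0 subr0.
exists w; split => //.
have wvb : `|dot w0 v0| <= C * e ^+ 2.
  have p1 := nor_prox Xc r0 reach near_ptP np rr (_ : X x').
  have p2 := nor_prox Xc r0 reach near_ptP np' rr (_ : X x0).
  have Xx' : X x' by rewrite /x' -Pz'; case: (near_ptP (x' + rho *: v')).
  have Xx0 : X x0 by rewrite -(proj2 infdist_z); case: (near_ptP z).
  have {}p1 := p1 Xx'; have {}p2 := p2 Xx0.
  rewrite -/x0 -/v0 in p1; rewrite -/x' -/v' in p2.
  have vv : dot (v' - v0) v0 = - (enorm (v' - v0) ^+ 2 / 2).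
    by rewrite enorm_sqrB v1 v'1 dotBl -[dot v0 v0]sqr_enorm v1 expr1n; field.
  have cs : `|dot (x' - x0) (v' - v0)| <= e ^+ 2.
    by apply: le_trans (normr_dot_le _ _) _; rewrite expr2 ler_pM ?enorm_ge0.
  have exe : enorm (x' - x0) ^+ 2 <= e ^+ 2 by rewrite lerXn2r ?nnegrE ?enorm_ge0.
  have eve : enorm (v' - v0) ^+ 2 <= e ^+ 2 by rewrite lerXn2r ?nnegrE ?enorm_ge0.
  rewrite -opprB dotNl enormN in p2.
  have sp : dot (x' - x0) v' = dot (x' - x0) v0 + dot (x' - x0) (v' - v0) by rewrite dotBr; ring.
  rewrite sp in p2; rewrite w0E dotDl dotZl vv.
  have q1 : dot (x' - x0) v0 <= e ^+ 2 / (2 * rho).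
    by rewrite ler_pdivlMr ?mulr_gt0 //; lra.
  have q2 : - (dot (x' - x0) v0 + dot (x' - x0) (v' - v0)) <= e ^+ 2 / (2 * rho).
    by rewrite ler_pdivlMr ?mulr_gt0 //; lra.
  have q3 : rho * (enorm (v' - v0) ^+ 2 / 2) <= rho / 2 * e ^+ 2 by have := ler_wpM2l (ltW rho0) eve; lra.
  have q4 : 0 <= rho * (enorm (v' - v0) ^+ 2 / 2) by rewrite mulr_ge0 ?(ltW rho0) // divr_ge0 // sqr_ge0.
  have -> : C * e ^+ 2 = e ^+ 2 / (2 * rho) + e ^+ 2 + rho / 2 * e ^+ 2.
    by rewrite /C; field; rewrite gt_eqF.
  rewrite ler_norml.
  move: cs q1 q2 q3 q4; rewrite ler_norml => /andP[cs1 cs2]; move: (e ^+ 2 / _) => E.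
  have e20 := sqr_ge0 e; move=> *; apply/andP; split; lra.
rewrite ppE tangent_mxE row_mxB wA; apply: le_trans (enorm_row_mx_le _ _) _.
have -> : v' - v0 - rho^-1 *: (w - w0 *m A) = rho^-1 *: (dot w0 v0 *: v0 - (x' - x0 - w0 *m A)).
  have -> : v' - v0 = rho^-1 *: (w0 - (x' - x0)).
    by rewrite w0E addrDBl scalerA mulVf ?gt_eqF // scale1r.
  by rewrite -scalerBr /w; congr (_ *: _); apply/rowP => i; rewrite !mxE; ring.
rewrite enormZ gtr0_norm //.
have b1 : enorm (dot w0 v0 *: v0 - (x' - x0 - w0 *m A)) <= C * e ^+ 2 + tau / (2 * K1) * ((1 + rho) * e).
  apply: le_trans (ler_enormB _ _) _; rewrite enormZ v1 mulr1 lerD //.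
  by apply: le_trans err1 _; rewrite ler_pM2l.
have b2 : enorm (x' - x0 - w0 *m A) <= tau / (2 * K1) * ((1 + rho) * e).
  by apply: le_trans err1 _; rewrite ler_pM2l.
apply: le_trans (lerD b2 (ler_wpM2l (ltW ri0) b1)) _.
have -> : tau / (2 * K1) * ((1 + rho) * e) + rho^-1 * (C * e ^+ 2 + tau / (2 * K1) * ((1 + rho) * e)) =
   tau / 2 * e + rho^-1 * C * e * e.
  by rewrite /K1; field; rewrite !gt_eqF ?addr_gt0.
rewrite -ppE -/e [leRHS](_ : _ = tau / 2 * e + tau / 2 * e); last by field.
rewrite lerD2l ler_wpM2r //.
have : e <= tau * rho / (2 * C) by apply: le_trans (ltW pp') _; rewrite ge_min lexx orbT.
rewrite ler_pdivlMr ?mulr_gt0 // => h.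
by rewrite -mulrA ler_pdivrMl //; lra.
Qed.

(** Move [z] by [h *: w], project, and normalize the remaining vector: [prox_nor] puts the resulting
    pair in [nor X]. Its length [d'] differs from [rho] by o(h), since [w] and [w *m A] are
    orthogonal to [v0]. *)
Lemma nor_tangent_vec w : dot w v0 = 0 -> tangent_cone (nor X) p (w *m tangent_mx).
Proof.
move=> wv e e0; rewrite tangent_mxE.
set q := w *m A; pose E := enorm (w - q) + enorm w + 1.
have E0 : 0 < E by rewrite ltr_wpDl // addr_ge0 ?enorm_ge0.
have wE : enorm w <= E by rewrite /E; have := enorm_ge0 (w - q); lra.
have ri0 : 0 < rho^-1 by rewrite invr_gt0.
pose C := E + 2 * rho^-1 * (3 * E * (1 + E / rho) + E).
have C0 : 0 < C.
  apply: addr_gt0 => //; apply: mulr_gt0; first by apply: mulr_gt0.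
  apply: addr_gt0 => //; apply: mulr_gt0; first by apply: mulr_gt0.
  by apply: addr_gt0 => //; apply: divr_gt0.
pose tau := Num.min 1 (e / (2 * C)).
have tau0 : 0 < tau by rewrite lt_min ltr01 divr_gt0 // mulr_gt0.
have tau1 : tau <= 1 by rewrite ge_min lexx.
have tauC : tau * C < e.
  apply: (@le_lt_trans _ _ (e / 2)); last by lra.
  rewrite -ler_pdivlMr //; apply: (@le_trans _ _ (e / (2 * C))); first by rewrite ge_min lexx orbT.
  by rewrite invfM mulrA.
have [d1 d10 hd1] := dA tau0.
set u := row_mx _ _.
(* In order: [h < 1]; the expansion at [z] applies; the quadratic error is below [tau]; [d'] is at
   least [rho / 2]; the new pair is within [e] of [p]; the moved point is within [r / 4] of [X]. *)
have [|h h0] := @small_mul R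
  [:: (1, 1); (enorm w, d1); (E ^+ 2, tau * rho); (6 * E, rho); (e + enorm u, e); (enorm w, r / 4 - rho)].
  by rewrite /= ltr01 d10 e0 rho0 mulr_gt0 // subr_gt0 rho4.
rewrite /= andbT mulr1 => /andP[h01 /and5P[h1 h2 h3 h4 h5]].
have hw : enorm (h *: w) = h * enorm w by rewrite enormZ gtr0_norm.
have zh4 : infdist (z + h *: w) X < r / 4.
  have := infdist_lip (z + h *: w) z X; rewrite addrDBl hw (proj1 infdist_z) ler_norml => /andP[_]; lra.
have := hd1 (h *: w); rewrite hw => /(_ h1).
set y := z + h *: w in zh4 *; rewrite (proj2 infdist_z) -scalemxAl -/q.
set x' := near_pt y; set er := x' - x0 - h *: q => ner.
pose c := h *: (w - q) - er.
have yx : y - x' = rho *: v0 + c.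
  by rewrite /c /er /y /z; apply/rowP => i; rewrite !mxE; ring.
have tw : tau * enorm w <= enorm w by rewrite ler_piMl // enorm_ge0.
have ner' : enorm er <= h * (tau * enorm w) by rewrite mulrCA.
have cE : enorm c <= h * E.
  apply: le_trans (ler_enormB _ _) _; rewrite enormZ gtr0_norm //.
  have : h * (tau * enorm w) <= h * enorm w by rewrite ler_pM2l.
  rewrite /E !mulrDr mulr1; lra.
pose d' := infdist y X.
have dE : d' = enorm (rho *: v0 + c) by rewrite -yx /d' -(proj2 (near_ptP y)).
(* The two terms come from the linear error of the projection and from the squared tangential
   displacement. *)
pose eta := 2 * (tau * enorm w) + h * E ^+ 2 / rho.
have drho : `|d' - rho| <= h * eta.
  have d2 : d' ^+ 2 - rho ^+ 2 = enorm c ^+ 2 - 2 * rho * dot er v0.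
    rewrite dE enorm_sqrD enormZ v1 mulr1 gtr0_norm // dotZl (dotC v0) {2}/c dotBl dotZl dotBl wv mdiff_tangent; ring.
  have ev : `|dot er v0| <= h * (tau * enorm w).
    by apply: le_trans (normr_dot_le _ _) _; rewrite v1 mulr1.
  have c2 : enorm c ^+ 2 <= h ^+ 2 * E ^+ 2.
    by rewrite -exprMn lerXn2r ?nnegrE ?enorm_ge0 // mulr_ge0 ?ltW.
  have d0 : 0 <= d' by exact: infdist_ge0.
  have m : `|d' - rho| * rho <= `|d' - rho| * (d' + rho) by rewrite ler_wpM2l // lerDr.
  have : `|d' - rho| * (d' + rho) = `|d' ^+ 2 - rho ^+ 2|.
    by rewrite subr_sqr normrM (ger0_norm (_ : 0 <= d' + rho)) // addr_ge0 // ltW.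
  have : `|d' ^+ 2 - rho ^+ 2| <= h ^+ 2 * E ^+ 2 + 2 * rho * (h * (tau * enorm w)).
    rewrite d2 (le_trans (ler_normB _ _)) // lerD ?(ger0_norm (sqr_ge0 _)) //.
    by rewrite normrM gtr0_norm ?mulr_gt0 // ler_pM2l // mulr_gt0.
  have etaM : h * eta * rho = h ^+ 2 * E ^+ 2 + 2 * rho * (h * (tau * enorm w)).
    by rewrite /eta; field; rewrite gt_eqF.
  by move=> a b; rewrite -(ler_pM2r rho0) etaM; rewrite b in m; apply: le_trans m a.
have etaE : eta <= 3 * E * tau.
  have : h * E ^+ 2 / rho <= tau by rewrite ler_pdivrMr // ltW.
  have : tau * enorm w <= tau * E by rewrite ler_pM2l.
  have : tau * 1 <= tau * E by rewrite ler_pM2l // /E; have := enorm_ge0 w; have := enorm_ge0 (w - q); lra.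
  rewrite /eta; lra.
have heta : h * eta <= h * (3 * E * tau) by rewrite ler_pM2l.
have d'2 : rho / 2 <= d'.
  have : h * (3 * E * tau) <= h * (3 * E) by rewrite ler_pM2l // ler_piMr // mulr_ge0 // ltW.
  by move: drho; rewrite ler_norml => /andP[]; lra.
have d'0 : 0 < d' by apply: lt_le_trans d'2; rewrite divr_gt0.
pose v' := d'^-1 *: (y - x').
pose p' := row_mx x' v' : 'rV[R]_(n + n).
have rr : 0 < rho < r by rewrite rho0 /=; have := r0; have := rho4; lra.
have np' : nor X p'.
  apply: (@prox_nor R n X _ rho); rewrite /p' ?row_mxKl ?row_mxKr //.
  - by case: (near_ptP y).
  - by rewrite enormZ gtr0_norm ?invr_gt0 // (proj2 (near_ptP y)) mulVf // gt_eqF.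
  - have y4 : infdist y X < r by have := r0; move: zh4; lra.
    exact: (near_pt_prox Xc reach near_ptP d'0 y4 rr).
have ppE : h^-1 *: (p' - p) - u = row_mx (h^-1 *: er) (h^-1 *: (v' - v0) - rho^-1 *: (w - q)).
  rewrite /p' -{1}(hsubmxK p) row_mxB scale_row_mx row_mxB; congr row_mx.
  by rewrite /er (scalerBr _ (x' - x0)) scalerA mulVf ?gt_eqF // scale1r.
have hi0 : 0 < h^-1 by rewrite invr_gt0.
have close : enorm (h^-1 *: (p' - p) - u) < e.
  rewrite ppE; apply: le_lt_trans (enorm_row_mx_le _ _) _.
  have e1 : enorm (h^-1 *: er) <= tau * E.
    rewrite enormZ gtr0_norm // ler_pdivrMl //; apply: le_trans ner' _.
    by rewrite ler_pM2l // ler_pM2l.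
  have e2 : enorm (h^-1 *: (v' - v0) - rho^-1 *: (w - q)) <= tau * (2 * rho^-1 * (3 * E * (1 + E / rho) + E)).
    have -> : h^-1 *: (v' - v0) - rho^-1 *: (w - q) =
      d'^-1 *: ((h^-1 * (rho - d')) *: v0 - h^-1 *: er + ((rho - d') * rho^-1) *: (w - q)).
      rewrite /v' yx /c; apply/rowP => i; rewrite !mxE; field; by rewrite !gt_eqF.
    rewrite enormZ gtr0_norm ?invr_gt0 //.
    have b1 : enorm ((h^-1 * (rho - d')) *: v0) <= 3 * E * tau.
      rewrite enormZ v1 mulr1 normrM gtr0_norm // distrC ler_pdivrMl //.
      exact: le_trans drho heta.
    have b2 : enorm (((rho - d') * rho^-1) *: (w - q)) <= 3 * E * tau * (E / rho).
      rewrite enormZ normrM (gtr0_norm ri0) distrC.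
      have a1 : `|d' - rho| <= 3 * E * tau.
        apply: le_trans drho (le_trans heta _).
        by rewrite ler_piMl ?(ltW h01) // !mulr_ge0 // ltW.
      have wqE : enorm (w - q) <= E by rewrite /E; have := enorm_ge0 w; lra.
      rewrite -(mulrA `|d' - rho|); apply: ler_pM => //; first by rewrite mulr_ge0 ?enorm_ge0 ?(ltW ri0).
      by rewrite mulrC; apply: ler_wpM2r wqE; exact: ltW.
    have b3 : enorm ((h^-1 * (rho - d')) *: v0 - h^-1 *: er + ((rho - d') * rho^-1) *: (w - q)) <=
        3 * E * tau + tau * E + 3 * E * tau * (E / rho).
      by rewrite (le_trans (ler_enormD _ _)) // lerD // (le_trans (ler_enormB _ _)) // lerD.
    have d'i : d'^-1 <= 2 * rho^-1.
      by rewrite -[2 * _]invrK lef_pV2 ?posrE ?invr_gt0 ?mulr_gt0 // invfM invrK mulrC.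
    rewrite [leRHS](_ : _ = 2 * rho^-1 * (3 * E * tau + tau * E + 3 * E * tau * (E / rho))); last by ring.
    by apply: ler_pM => //; rewrite ?invr_ge0 ?enorm_ge0 // ltW.
  rewrite /C mulrDr in tauC; lra.
exists p', h^-1; split => //.
have -> : p' - p = h *: (h^-1 *: (p' - p) - u + u) by rewrite subrK scalerA divff ?gt_eqF // scale1r.
rewrite enormZ gtr0_norm //; apply: le_lt_trans h4; rewrite ler_pM2l //.
by apply: le_trans (ler_enormD _ _) _; rewrite lerD2r ltW.
Qed.

End TangentSpace.

Section PrincipalCurvatures.
Context {R : realType} {m : nat}.
Let n := m.+1.
Implicit Types (x y u w h : 'rV[R]_n).
Variables (X : set 'rV[R]_n) (r : R).
Hypothesis Xc : closed X.
Hypothesis r0 : 0 < r.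
Hypothesis reach : forall y, infdist y X < r ->
  exists! x, X x /\ enorm (y - x) = infdist y X.
Variable near_pt : 'rV[R]_n -> 'rV[R]_n.
Hypothesis near_ptP : forall y, X (near_pt y) /\ enorm (y - near_pt y) = infdist y X.
Variables (p : 'rV[R]_(n + n)) (rho : R) (A : 'M[R]_n).
Hypothesis np : nor X p.
Hypothesis rho0 : 0 < rho.
Hypothesis rho4 : rho < r / 4.
Hypothesis dA : mdiff_at near_pt (lsubmx p + rho *: rsubmx p) A.
Let v0 := rsubmx p.
Let v1 : enorm v0 = 1. Proof. by case: np. Qed.
Let rr : 0 < rho < r. Proof. by rewrite rho0 /=; have := r0; have := rho4; lra. Qed.
Let z4 : infdist (lsubmx p + rho *: rsubmx p) X < r / 4.
Proof. by rewrite (proj1 (nor_near_pt Xc r0 reach near_ptP np rr)). Qed.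
Let symA := mdiff_symmetric Xc r0 reach near_ptP z4 dA.
Let TM := tangent_mx rho A.

(** The principal directions are the eigenvectors of [A] orthogonal to [v0]; [tangent_mx] sends each
    to a positive multiple of the corresponding row of [b]. The last clause depends on the tangent
    space only and will be applied to any other family. *)
Lemma tangent_cone_norE : exists (k : 'I_m -> \bar R) (a : 'M[R]_(m, n)),
  let b := \matrix_(i < m) row_mx (curv_cos (k i) *: row i a) (curv_sin (k i) *: row i a) in
  [/\ forall i, k i != -oo%E, a *m a^T = 1%:M /\ b *m b^T = 1%:M,
    tangent_cone (nor X) p = [set u | (u <= b)%MS] &
    forall u : 'rV[R]_(n + n), (u <= b)%MS -> exists2 w, dot w v0 = 0 & u = w *m TM].
Proof.
have vA : v0 *m A = 0 *: v0.
  by rewrite scale0r; apply: (mdiff_normal Xc r0 reach near_ptP np rho0 rho4 dA).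
have [e [mu [e0 eo eig]]] := eigenbasis symA v1 vA.
have im (i : 'I_m) : (i.+1 < n)%N by rewrite ltnS.
have mu0 (i : 'I_m) : 0 <= mu i.+1.
  have := mdiff_ge0 near_ptP dA (e i.+1).
  by rewrite eig // dotZr eo // eqxx mulr1.
have hk (i : 'I_m) : exists q : (\bar R * R), [/\ 0 < q.2, q.1 != -oo%E,
    curv_cos q.1 * q.2 = mu i.+1 & curv_sin q.1 * q.2 = (1 - mu i.+1) / rho].
  by have [k [N N0 [k1 k2 k3]]] := curv_exists (mu0 i) rho0; exists (k, N).
have [q hq] := choice hk.
pose a : 'M[R]_(m, n) := \matrix_(i < m) e i.+1.
exists (fun i => (q i).1), a => b.
have aE i : row i a = e i.+1 by rewrite rowK.
have bE (i : 'I_m) : e i.+1 *m TM = (q i).2 *: row i b.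
  have [_ _ c1 c2] := hq i; rewrite tangent_mxE rowK aE scale_row_mx !scalerA eig //.
  rewrite ![(q i).2 * _]mulrC c1 c2 -{2}[e _]scale1r -scalerBl scalerA; congr (row_mx _ (_ *: _)).
  by rewrite mulrC.
have aa : a *m a^T = 1%:M.
  by apply/matrixP => i j; rewrite mulmx_trE !aE eo // mxE.
have bb : b *m b^T = 1%:M.
  apply/matrixP => i j; rewrite mulmx_trE !rowK dot_row_mx !dotZl !dotZr eo // eqSS mxE val_eqE.
  case: eqVneq => [->|_]; last by rewrite !mulr0 addr0.
  by rewrite !mulr1 -!expr2 curv_sqrD.
have sub (u : 'rV[R]_(n + n)) : (u <= b)%MS -> exists2 w, dot w v0 = 0 & u = w *m TM.
  move=> /submxP[c ->]; exists (\sum_(i < m) (c 0 i / (q i).2) *: e i.+1).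
    have ev (i : 'I_m) : dot (e i.+1) v0 = 0 by rewrite -e0 eo.
    elim/big_ind: _ => [|x y hx hy|i _]; first exact: dot0l.
    - by rewrite dotDl hx hy addr0.
    - by rewrite dotZl ev mulr0.
  rewrite mulmx_suml mulmx_sum_row; apply: eq_bigr => i _.
  have [N0 _ _ _] := hq i.
  by rewrite -scalemxAl bE scalerA divfK // gt_eqF.
split=> //; first by move=> i; case: (hq i).
apply: tangent_cone_rowspace => //; last first.
  move=> u /sub[w wv ->].
  exact: (nor_tangent_vec Xc r0 reach near_ptP np rho0 rho4 dA).
move=> tau tau0.
have [delta delta0 hd] := nor_tangent_approx Xc r0 reach near_ptP np rho0 rho4 dA tau0.
exists delta => // p' np' pp'; have [w [wv hw]] := hd _ np' pp'.
exists (w *m TM); split=> //.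
rewrite (orthonormal_full eo w) big_ord_recl e0 wv scale0r add0r mulmx_suml.
apply: summx_sub => i _; rewrite -scalemxAl scalemx_sub //.
by rewrite (_ : e (lift ord0 i) = e i.+1) // bE scalemx_sub // row_sub.
Qed.

Hypothesis half : exists2 e, 0 < e &
  forall y, X y -> enorm (y - lsubmx p) < e -> dot (y - lsubmx p) v0 <= 0.

(** The family picked by [xget] need not be the one just constructed, but it spans the same tangent
    cone. This alone identifies its directions as eigenvectors of [A] up to scaling, and the bounds
    on [A] give the signs. *)
Lemma curvature_local : exists (s : 'I_m -> R) (a : 'M[R]_(m, n)),
  [/\ @curv_density R n X p = \prod_i s i, forall i, 0 <= s i <= 1,
      a *m a^T = 1%:M /\ (forall i, dot (row i a) v0 = 0) &
      forall tau, 0 < tau -> exists2 delta, 0 < delta & forall p', nor X p' -> enorm (p' - p) < delta ->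
        forall i, `|dot (rsubmx p' - v0) (row i a)| <= (s i + tau) * enorm (p' - p)].
Proof.
have [k0 [a0 [k0P [aa0 bb0] T0 sub0]]] := tangent_cone_norE.
pose k := xget (fun=> 0%E) (@principal_curvatures R n X p).
have [kP [a [aa bb Tb]]] : @principal_curvatures R n X p k.
  by apply: xgetPex; exists k0; split=> //; exists a0.
set b := \matrix_(i < _) _ in bb Tb.
have bsub (u : 'rV[R]_(n + n)) : (u <= b)%MS -> exists2 w, dot w v0 = 0 & u = w *m TM.
  move=> ub; apply: sub0; have : tangent_cone (nor X) p u by rewrite Tb.
  by rewrite T0.
have av i : dot (row i a) v0 = 0 /\ 0 <= curv_sin (k i).
  have [w wv wE] := bsub _ (row_sub i b).
  have [] := eq_row_mx (etrans (esym (rowK _ i)) (etrans wE (tangent_mxE _ _ w))).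
  set c := curv_cos _; set s := curv_sin _ => cE sE.
  have cs : c ^+ 2 + s ^+ 2 = 1 := curv_sqrD (k i).
  have wAv : dot (w *m A) v0 = 0.
    exact: (mdiff_tangent Xc r0 reach near_ptP np rho0 rho4 dA).
  have a1 : dot (row i a) (row i a) = 1 by rewrite -mulmx_trE aa mxE eqxx.
  (* Combining both components of row [i] of [b] shows that its preimage [w] is a multiple of the
     direction [row i a]. *)
  have wa : w = (c + rho * s) *: row i a.
    rewrite scalerDl cE -scalerA sE scalerA divff ?gt_eqF // scale1r.
    by rewrite addrC subrK.
  split.
    have h1 : c * dot (row i a) v0 = 0 by rewrite -dotZl cE.
    have h2 : s * dot (row i a) v0 = 0 by rewrite -dotZl sE dotZl dotBl wv wAv subrr mulr0.
    rewrite -[LHS]mul1r -cs mulrDl !expr2 -!mulrA h1 h2 !mulr0 addr0 //.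
  have c0 : 0 <= c := curv_cos_ge0 (k i).
  (* A vanishing cosine means an infinite curvature; minus infinity is excluded by [kP], so the sine
     is 1. *)
  have [c00|c00] := eqVneq c 0.
    by move: (kP i) c00; rewrite /c /s; case: (k i) => //= t _ /eqP; rewrite invr_eq0 gt_eqF // sqrtr_gt0 ltr_pwDl // sqr_ge0.
  have qw : dot w (w *m A) = (c + rho * s) * c.
    by rewrite -cE {1}wa dotZl dotZr a1 mulr1.
  have ww : enorm w ^+ 2 = (c + rho * s) ^+ 2.
    by rewrite sqr_enorm wa dotZl dotZr a1; ring.
  have g0 := mdiff_ge0 near_ptP dA w.
  have l1 := mdiff_le1 Xc r0 reach near_ptP np rho0 rho4 dA half wv.
  rewrite qw in g0 l1; rewrite ww in l1.
  have {}c0 : 0 < c by rewrite lt_neqAle eq_sym c00.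
  have h0 : 0 <= c + rho * s by rewrite -(pmulr_lge0 _ c0).
  have : 0 <= (c + rho * s) * (rho * s) by move: l1; lra.
  have n0 : c + rho * s != 0.
    apply/eqP => cs0; have : c = dot (c *: row i a) (row i a) by rewrite dotZl a1 mulr1.
    rewrite cE wa cs0 scale0r mul0mx dot0l => /eqP; exact/negP.
  rewrite pmulr_rge0 ?pmulr_rge0 // lt_neqAle eq_sym n0 //.
exists (fun i => curv_sin (k i)), a; split=> //.
- by move=> i; rewrite curv_sin_le1 andbT; case: (av i).
- by split=> // i; case: (av i).
move=> tau tau0.
have t2 : 0 < tau / 2 by rewrite divr_gt0.
have [delta delta0 hd] := nor_tangent_approx Xc r0 reach near_ptP np rho0 rho4 dA t2.
exists delta => // p' np' pp' i; have [w [wv hw]] := hd _ np' pp'.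
have : ((w *m TM) <= b)%MS.
  have : tangent_cone (nor X) p (w *m TM) by apply: (nor_tangent_vec Xc r0 reach near_ptP np rho0 rho4 dA).
  by rewrite Tb.
rewrite -/TM in hw; move=> /submxP[c cE]; rewrite cE in hw.
have ce : enorm (c *m b) = enorm c.
  by rewrite /enorm !dot_mulmx_tr trmx_mul mulmxA -(mulmxA c) bb mulmx1.
have ci : `|c 0 i| <= (1 + tau / 2) * enorm (p' - p).
  apply: le_trans (coord_le_enorm _ _) _; rewrite -ce mulrDl mul1r.
  rewrite (_ : c *m b = p' - p - (p' - p - c *m b)); last by rewrite subKr.
  by apply: le_trans (ler_enormB _ _) _; rewrite lerD2l.
have rE : dot (rsubmx (c *m b)) (row i a) = c 0 i * curv_sin (k i).
  rewrite mulmx_sum_row linear_sum /=.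
  rewrite (bigD1 i) //= dotDl linearZ /= rowK row_mxKr !dotZl -mulmx_trE aa mxE eqxx mulr1.
  rewrite (_ : dot _ _ = 0) ?addr0 //.
  elim/big_ind: _ => [|x y hx hy|j ji]; first exact: dot0l.
  - by rewrite dotDl hx hy addr0.
  - by rewrite linearZ /= rowK row_mxKr !dotZl -mulmx_trE aa mxE (negbTE ji) !mulr0.
have -> : rsubmx p' - v0 = rsubmx (c *m b) + rsubmx (p' - p - c *m b).
  by move: (c *m b) => cb; apply/rowP => j; rewrite !mxE; ring.
rewrite dotDl rE; apply: le_trans (ler_normD _ _) _.
have [_ s0] := av i.
have s1 := curv_sin_le1 (k i).
have e2 : `|dot (rsubmx (p' - p - c *m b)) (row i a)| <= tau / 2 * enorm (p' - p).
  apply: le_trans (normr_dot_le _ _) _.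
  have -> : enorm (row i a) = 1 by rewrite /enorm -mulmx_trE aa mxE eqxx sqrtr1.
  by rewrite mulr1; apply: le_trans hw; exact: enorm_rsubmx.
rewrite normrM (ger0_norm s0).
have := ler_wpM2r s0 ci; have := enorm_ge0 (p' - p) => N0.
have : tau / 2 * enorm (p' - p) * curv_sin (k i) <= tau / 2 * enorm (p' - p).
  by rewrite ler_piMr // mulr_ge0 // ltW.
lra.
Qed.

End PrincipalCurvatures.

(** * Area inequality for the Gauss map *)

Section AreaInequality.
Context {R : realType} {N n m : nat}.
Local Notation H := (@hausdorff R _ m).
Local Open Scope ereal_scope.
Implicit Types (E : set 'rV[R]_N) (f : 'rV[R]_N -> 'rV[R]_n).

(** A set of diameter [e] is mapped into a box with half-sides [(s i)%:R / L * e]. Integer [s i]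
    lets this box be cut into whole cubes of side [e / L], so the measure is multiplied by the
    product of the stretches, up to [(2 * C) ^+ m]. *)
Lemma hausdorff_image_le_box E f (g : 'I_m -> 'rV[R]_n -> R) (s : 'I_m -> nat) (L C delta0 : R) :
  (0 < L)%R -> (0 < C)%R -> (0 < delta0)%R -> (forall i, (0 < s i)%N) ->
  (forall p p' i, E p -> E p' -> (enorm (p' - p) < delta0)%R ->
    (`|g i (f p') - g i (f p)| <= (s i)%:R / L * enorm (p' - p))%R) ->
  (forall p p' e, E p -> E p' -> (0 <= e)%R -> (enorm (p' - p) < delta0)%R ->
    (forall i, (`|g i (f p') - g i (f p)| <= e)%R) -> (enorm (f p' - f p) <= C * e)%R) ->
  H (f @` E) <= ((2 * C) ^+ m * \prod_i ((s i)%:R / L))%:E * H E.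
Proof.
move=> L0 C0 d00 s0 fs fC.
have K0 : (0 < (2 * C) ^+ m * \prod_i ((s i)%:R / L))%R.
  rewrite mulr_gt0 ?exprn_gt0 ?mulr_gt0 //; apply: prodr_gt0 => i _.
  by rewrite divr_gt0 // ltr0n.
apply/hausdorff_leP => delta delta_gt0.
pose d1 : R := (Num.min (delta0 / 2) (L * delta / C))%R.
have d10 : (0 < d1)%R by rewrite lt_min !divr_gt0 // mulr_gt0.
have d1d0 : (d1 < delta0)%R.
  by apply: (@le_lt_trans _ _ (delta0 / 2)%R); [rewrite ge_min lexx|lra].
have d1d : (C * (d1 / L) <= delta)%R.
  rewrite mulrA ler_pdivrMr // mulrC -ler_pdivlMr // (mulrC delta).
  by rewrite ge_min lexx orbT.
apply: (@le_trans _ _ (((2 * C) ^+ m * \prod_i ((s i)%:R / L))%:E * hausdorff_delta m d1 E)); last first.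
  by apply: lee_wpmul2l; [rewrite lee_fin ltW|exact: hausdorff_delta_le].
rewrite -lee_pdivrMl //.
apply: le_ereal_inf_tmp => _ [B [Bd EB] <-].
rewrite lee_pdivrMl // -nneseriesZl //.
apply: (@le_trans _ _ (\sum_(0 <= k <oo) hausdorff_delta m delta (f @` (B k `&` E)))).
  apply: le_trans (outer_measure_sigma_subadditive _ _).
  apply: le_outer_measure => _ [p Ep <-]; have [k _ Bp] := EB p Ep.
  by exists k => //; exists p.
apply: lee_nneseries => [k _ _|k _]; first exact: outer_measure_ge0.
have [D0|/set0P[p [Bp Ep]]] := eqVneq (B k `&` E) set0.
  by rewrite D0 image_set0 outer_measure0; apply: mule_ge0; [rewrite lee_fin ltW|exact: hausdorff_gauge_ge0].
have B0 : B k !=set0 by exists p.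
have [e [/andP[e0 ed] eB ->]] := ediam_fin m B0 (Bd k).
have Be x y : B k x -> B k y -> (enorm (x - y) <= e)%R.
  have /ediam_leP h : ediam (B k) <= e%:E by rewrite eB.
  exact: h.
have close x y : (B k `&` E) x -> (B k `&` E) y -> (enorm (y - x) < delta0)%R.
  by move=> [Bx _] [By _]; apply: le_lt_trans d1d0; exact: le_trans (Be _ _ By Bx) ed.
apply: le_trans (hausdorff_delta_box (f := g) (c := fun i => g i (f p)) (s := s)
  (eta := (e / L)%R) (C := C) _ _ _ s0 _ _) _.
- by rewrite divr_ge0 // ltW.
- exact: ltW.
- by apply: le_trans d1d; rewrite ler_pM2l // ler_pM2r ?invr_gt0.
- move=> _ i [q [Bq Eq] <-]; apply: le_trans (fs _ _ i Ep Eq (close _ _ (conj Bp Ep) (conj Bq Eq))) _.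
  rewrite mulrCA mulrA mulrC mulrA; apply: ler_wpM2r; first by rewrite invr_ge0 ltW.
  by rewrite ler_wpM2r // Be.
- move=> _ _ [q [Bq Eq] <-] [q' [Bq' Eq'] <-] hg.
  apply: fC => //; [by rewrite divr_ge0 // ltW|exact: close].
rewrite -EFinM lee_fin natr_prod.
under eq_bigr do rewrite natrM.
rewrite big_split prodr_const card_ord big_split prodr_const card_ord !exprMn /=.
by rewrite le_eqVlt; apply/orP; left; apply/eqP; ring.
Qed.

End AreaInequality.

(** * Integrals of possibly nonmeasurable functions *)

Section LayerIntegral.
Local Open Scope ereal_scope.
Context d (T : measurableType d) (R : realType) (mu : {measure set T -> \bar R}).

(** The integral of a nonnegative function is the supremum over the simple functions below it, so
    monotonicity needs no measurability. *)
Lemma ge0_le_integral_nonmeasurable (D : set T) (f g : T -> \bar R) :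
  (forall x, D x -> 0 <= f x) -> (forall x, D x -> f x <= g x) ->
  \int[mu]_(x in D) f x <= \int[mu]_(x in D) g x.
Proof.
move=> f0 fg; rewrite !ge0_integralE // => [|x Dx]; last exact: le_trans (f0 x Dx) (fg x Dx).
apply: le_ereal_sup => _ [h hf <-]; exists h => // x.
apply: le_trans (hf x) _; rewrite /patch; case: ifPn => // /set_mem; exact: fg.
Qed.

Lemma integral_null_support (D B : set T) (f : T -> \bar R) : measurable B -> mu B = 0 ->
  (forall x, 0 <= f x) -> (forall x, D x -> ~ B x -> f x = 0) -> \int[mu]_(x in D) f x = 0.
Proof.
move=> mB B0 f0 fB; apply/eqP; rewrite eq_le integral_ge0 // andbT.
pose h : T -> \bar R := (cst +oo) \_ B.
have h0 x : 0 <= h x by rewrite /h /patch; case: ifP => // _; rewrite leey.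
rewrite integral_mkcond.
apply: (@le_trans _ _ (\int[mu]_(x in setT) h x)).
  apply: ge0_le_integral_nonmeasurable => [x _|x _].
    by rewrite /patch; case: ifP.
  rewrite /h /patch; case: ifPn => [/set_mem Dx|_]; last exact: h0.
  case: ifPn => [_|]; first exact: leey.
  by move=> /negP nB; rewrite fB // => Bx; apply: nB; exact/mem_set.
rewrite /h -integral_mkcond null_set_integral //; exact: measurable_cst.
Qed.

(** The sign of [g] is known only off the null set [B]. The negative part of the integrand lives on
    [B] and integrates to 0; the positive part dominates the simple function of the layers with [B]
    removed. *)
Lemma measure_layer_le (D A B : set T) (E : nat -> set T) (g : T -> R) (tau : R) M :
  (0 <= tau)%R -> measurable A -> measurable B -> mu B = 0 -> A `<=` D ->
  (forall l, measurable (E l)) -> (forall l, E l `<=` A) -> trivIset setT E ->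
  (forall x, A x -> ~ B x -> (0 <= g x)%R) ->
  (forall l x, E l x -> ~ B x -> (l%:R * tau <= g x)%R) ->
  \sum_(l < M) (l%:R * tau)%:E * mu (E l) <= \int[mu]_(x in D) (\1_A x * g x)%:E.
Proof.
move=> tau0 mA mB B0 AD mE EA tE g0 gE.
have lt0 l : (0 <= l%:R * tau)%R by rewrite mulr_ge0.
pose phi x : \bar R := (\1_A x * g x)%:E.
have indE (U : set T) x : (U x -> \1_U x = 1%R :> R) * (~ U x -> \1_U x = 0%R :> R).
  split=> hx; rewrite indicE; first by rewrite mem_set.
  by rewrite memNset.
have phi0 x : ~ B x -> 0 <= phi x.
  move=> nB; rewrite /phi lee_fin; have [Ax|nAx] := pselect (A x).
    by rewrite indE // mul1r g0.
  by rewrite (indE A x).2 // mul0r.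
pose h l x : \bar R := ((l%:R * tau) * \1_(E l `\` B) x)%:E.
have h0 l x : 0 <= h l x by rewrite lee_fin mulr_ge0.
have mh l : measurable_fun A (h l).
  by apply/measurable_EFinP; apply: measurable_funM; [exact: measurable_cst|exact/measurable_indic/measurableD].
have hsum x : \sum_(l < M) h l x <= Order.max (phi x) 0.
  have [[l [lM [Elx nBx]]]|nex] := pselect (exists l, (l < M)%N /\ (E l x /\ ~ B x)).
    rewrite (bigD1 (Ordinal lM)) //= big1 ?adde0; last first.
      move=> j /eqP jl; rewrite /h (indE _ x).2 ?mulr0 // => -[Ejx _]; apply: jl; apply/val_inj => /=.
      by apply: (tE j l) => //; exists x.
    rewrite le_max; apply/orP; left; rewrite /h /phi indE; last by split.
    by rewrite indE ?mulr1 ?mul1r ?lee_fin; [exact: gE|exact: EA Elx].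
  rewrite big1 ?le_max ?lexx ?orbT // => l _; rewrite /h (indE _ x).2 ?mulr0 // => hl.
  by apply: nex; exists l.
have muE l : mu (E l) = mu (E l `\` B).
  apply/eqP; rewrite eq_le; apply/andP; split; last first.
    by apply: le_measure; rewrite ?inE; [exact: measurableD|exact: mE|exact: subDsetl].
  apply: (@le_trans _ _ (mu ((E l `\` B) `|` B))).
    apply: le_measure; rewrite ?inE; [exact: mE|by apply: measurableU => //; exact: measurableD|].
    by move=> x Ex; have [Bx|nBx] := pselect (B x); [right|left].
  apply: le_trans (measureU2 _ _ _) _ => //; first exact: measurableD.
  by rewrite [X in _ + X <= _]B0 adde0.
rewrite integralE (integral_null_support (f := phi^\-) mB B0) ?sube0; last 2 first.
- exact: funeneg_ge0.
- by move=> x _ nB; rewrite funenegE; apply/max_idPr; rewrite leeNl oppe0 phi0.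
apply: (@le_trans _ _ (\int[mu]_(x in A) \sum_(l < M) h l x)).
  rewrite (@ge0_integral_sum _ _ _ mu A mA _ (fun l : 'I_M => h l)) //.
  apply: lee_sum => l _; rewrite /h.
  rewrite (@integralZl_indic _ _ _ mu A mA (fun=> E l `\` B)) //; last 2 first.
  - by move=> /lt_geF; rewrite lt0.
  - exact: measurableD.
  rewrite integral_indic //; last exact: measurableD.
  by rewrite (_ : _ `&` A = E l `\` B) -?muE //; apply/setIidPl => x [Ex _]; exact: EA Ex.
rewrite integral_mkcond [leRHS]integral_mkcond.
apply: ge0_le_integral_nonmeasurable => x _.
  by rewrite /patch; case: ifP => // _; apply: sume_ge0.
rewrite /patch; case: ifPn => [/set_mem Ax|_].
  rewrite (mem_set (AD x Ax)) funeposE; exact: hsum.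
case: ifPn => // _; exact: funepos_ge0.
Qed.

Lemma image_le_cover T' (nu : {outer_measure set T' -> \bar R}) (f : T -> T')
    (P : nat -> set T) (E : set T) c : (0 <= c)%R ->
  (forall j, measurable (P j)) -> measurable E -> E `<=` \bigcup_j P j ->
  (forall j (E' : set T), measurable E' -> E' `<=` P j -> nu (f @` E') <= c%:E * mu E') ->
  nu (f @` E) <= c%:E * mu E.
Proof.
move=> c0 mP mE EP nuP.
have mS j : measurable (E `&` seqDU P j) by apply: measurableI => //; exact: seqDU_measurable.
have EE : E = \bigcup_j (E `&` seqDU P j).
  by rewrite -setI_bigcupr -seqDU_bigcup_eq; apply/esym/setIidPl.
rewrite [in leRHS]EE measure_semi_bigcup //; last 2 first.
- exact: trivIset_setIl.
- exact: bigcupT_measurable.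
rewrite -nneseriesZl //.
apply: (@le_trans _ _ (\sum_(j <oo) nu (f @` (E `&` seqDU P j)))).
  apply: le_trans (outer_measure_sigma_subadditive _ _).
  apply: le_outer_measure => _ [x Ex <-]; move: (Ex); rewrite {1}EE => -[j _ xj].
  by exists j => //; exists x.
apply: lee_nneseries => [j _ _|j _]; first exact: outer_measure_ge0.
apply: (nuP j) => //.
by move=> x [_]; exact: subset_seqDU.
Qed.

(** [E l] collects the points in a piece of weight at most [l.+1%:R * tau] but in none of weight at
    most [l%:R * tau]. There [g] is at least the lower value, while the image is bounded with the
    upper one; the discrepancy costs [C * tau] times the measure of [A]. *)
Lemma image_le_integral T' (nu : {outer_measure set T' -> \bar R}) (f : T -> T')
    (D A B : set T) (P : nat -> set T) (w : nat -> R) (g : T -> R) (C : R) :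
  (0 < C)%R -> measurable A -> measurable B -> mu A < +oo -> mu B = 0 -> nu (f @` B) = 0 -> A `<=` D ->
  (forall j, measurable (P j)) -> (forall j, 0 < w j)%R ->
  (forall j (E : set T), measurable E -> E `<=` P j -> nu (f @` E) <= (C * w j)%:E * mu E) ->
  (forall x, A x -> ~ B x -> (0 <= g x <= 1)%R) ->
  (forall x c, A x -> ~ B x -> (g x < c)%R -> exists2 j, P j x & (w j <= c)%R) ->
  nu (f @` A) <= C%:E * \int[mu]_(x in D) (\1_A x * g x)%:E.
Proof.
move=> C0 mA mB Afin B0 fB0 AD mP w0 nuP g01 gP.
have Afin' : mu A \is a fin_num by rewrite ge0_fin_numE.
apply/lee_addgt0Pr => e e0.
pose a := fine (mu A); have a0 : (0 <= a)%R by exact: fine_ge0.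
have Ca : (0 < C * (a + 1))%R by rewrite mulr_gt0 // ltr_wpDl.
have [tau tau0 tauE] : exists2 tau : R, (0 < tau)%R & (tau * (C * (a + 1)) = e)%R.
  by exists (e / (C * (a + 1)))%R; rewrite ?divr_gt0 // divfK // gt_eqF.
(* Since [g] is at most 1, finitely many layers exhaust [A] off [B]. *)
have [M hM] : exists M, (1 < M%:R * tau)%R.
  have [k hk] := ex_natinv_lt tau0; exists k.+1.
  by rewrite -ltr_pdivrMl // mulr1.
pose Q (l : nat) j : set T := if (w j <= l%:R * tau)%R then P j else set0.
have mQ l j : measurable (Q l j) by rewrite /Q; case: ifP.
pose L l := \bigcup_j Q l j.
have mL l : measurable (L l) by exact: bigcupT_measurable.
have Lmono l l' : (l <= l')%N -> L l `<=` L l'.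
  move=> ll x [j _]; rewrite /Q; case: ifPn => // wj Px; exists j => //; rewrite /Q ifT //.
  by rewrite (le_trans wj) // ler_wpM2r ?(ltW tau0) // ler_nat.
pose E l := A `&` (L l.+1 `\` L l).
have mE l : measurable (E l) by apply: measurableI => //; exact: measurableD.
have EA l : E l `<=` A by move=> x [].
have tE : trivIset [set: nat] E.
  move=> i j _ _ [x [[_ [Li nLi]] [_ [Lj nLj]]]].
  case: (ltngtP i j) => // ij; exfalso.
    by apply: nLj; exact: (Lmono _ _ ij).
  by apply: nLi; exact: (Lmono _ _ ij).
have gE l x : E l x -> ~ B x -> (l%:R * tau <= g x)%R.
  move=> [Ax [_ nL]] nB; rewrite leNgt; apply/negP => /(gP _ _ Ax nB)[j Pj wj].
  by apply: nL; exists j => //; rewrite /Q wj.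
have layers := @measure_layer_le D A B E g tau M (ltW tau0) mA mB B0 AD mE EA tE
  (fun x Ax nB => (andP (g01 x Ax nB)).1) gE.
have cover : A `<=` \big[setU/set0]_(l < M) E l `|` B.
  move=> x Ax; have [Bx|nBx] := pselect (B x); [by right|left].
  have LM : L M x.
    have /andP[_ g1] := g01 x Ax nBx.
    have [j Pj wj] := gP _ _ Ax nBx (le_lt_trans g1 hM).
    by exists j => //; rewrite /Q wj.
  have : exists l, `[< L l x >] by exists M; apply/asboolP.
  move=> /ex_minnP[l /asboolP Ll lmin].
  (* Weights are positive, so no piece has weight at most 0 and [L 0] is empty. *)
  have [l0|l0] := posnP l.
    by move: Ll; rewrite l0 => -[j _]; rewrite /Q mul0r ifN // -ltNge.
  rewrite -bigcup_mkord; exists l.-1.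
    by rewrite /= prednK //; apply: lmin; apply/asboolP.
  split=> //; rewrite prednK //; split=> // /asboolP /lmin.
  by rewrite leqNgt prednK // leqnn.
have fE l : nu (f @` E l) <= (C * (l.+1%:R * tau))%:E * mu (E l).
  apply: (@image_le_cover _ _ _ (Q l.+1)) => //.
  - by rewrite mulr_ge0 ?(ltW C0) // mulr_ge0 // ltW.
  - by move=> x [_ []].
  - move=> j E' mE'; rewrite /Q; case: ifPn => [wj EP|_].
      apply: le_trans (nuP _ _ mE' EP) _; apply: lee_wpmul2r => //.
      by rewrite lee_fin ler_pM2l.
    by rewrite subset0 => ->; rewrite image_set0 outer_measure0 measure0 mule0.
have sumE : \sum_(l < M) mu (E l) <= mu A.
  have <- := @measure_bigsetU _ _ _ mu E mE tE M.
  apply: le_measure; rewrite ?inE //; first exact: bigsetU_measurable.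
  by rewrite -bigcup_mkord => x [l _ []].
apply: (@le_trans _ _ (\sum_(l < M) (C * (l.+1%:R * tau))%:E * mu (E l))).
  apply: (@le_trans _ _ (nu (\big[setU/set0]_(l < M) (f @` E l)) + nu (f @` B))).
    apply: le_trans (outer_measureU2 _ _ _).
    rewrite -(bigcup_mkord M (fun l => f @` E l)).
    apply: le_outer_measure => _ [x Ax <-].
    have := cover x Ax; rewrite -bigcup_mkord => -[[l lM El]|Bx]; [left|right]; last by exists x.
    by exists l => //; exists x.
  rewrite fB0 adde0; apply: le_trans (outer_measure_subadditive _ (fun l => f @` E l) _) _.
  by apply: lee_sum => l _; exact: fE.
have -> : \sum_(l < M) (C * (l.+1%:R * tau))%:E * mu (E l) =
    C%:E * (\sum_(l < M) (l%:R * tau)%:E * mu (E l)) + (C * tau)%:E * \sum_(l < M) mu (E l).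
  rewrite !ge0_sume_distrr; last 2 first.
  - by move=> l _.
  - by move=> l _; apply: mule_ge0 => //; rewrite lee_fin mulr_ge0 // ltW.
  rewrite -big_split; apply: eq_bigr => l _ /=.
  rewrite muleA -EFinM -ge0_muleDl ?lee_fin ?mulr_ge0 ?(ltW C0) ?(ltW tau0) //.
  by congr (_%:E * _); rewrite -natr1; ring.
apply: leeD; first by apply: lee_wpmul2l => //; rewrite lee_fin ltW.
apply: (@le_trans _ _ ((C * tau)%:E * mu A)).
  by apply: lee_wpmul2l => //; rewrite lee_fin mulr_ge0 // ltW.
rewrite -(fineK Afin') -/a -EFinM lee_fin -tauE -mulrA mulrCA.
by rewrite ler_pM2l // ler_pM2l // lerDl.
Qed.

End LayerIntegral.

(** * Curvature of a hole *)

Section Sphere.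
Context {R : realType} {m : nat}.
Local Notation H := (@hausdorff R _ m).

(** The sphere contains a graph over a small cube; scaling the coordinates by [m.+1%:R] turns that
    cube into the unit cube. *)
Lemma sphere_hausdorff_pos : (0 < H (@usphere R m.+1))%E.
Proof.
have m1 : 0 < m.+1%:R :> R by rewrite ltr0n.
apply: (@hausdorff_pos R m.+1 m _ (fun i x => m.+1%:R * x 0 (lift ord_max i)) m.+1%:R).
- exact: ltW.
- move=> i x y _ _; rewrite -mulrBr normrM (gtr0_norm m1) ler_pM2l //.
  by have := coord_le_enorm (x - y) (lift ord_max i); rewrite !mxE.
- move=> w w01.
  pose u : 'rV[R]_m.+1 := \row_j (if unlift ord_max j is Some i then w i / m.+1%:R else 0).
  have uu : dot u u <= 1.
    apply: (@le_trans _ _ (\sum_(j < m.+1) m.+1%:R^-1)).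
      apply: ler_sum => j _; rewrite mxE; case: unliftP => [i _|_]; last by rewrite mulr0 invr_ge0 ltW.
      have /andP[w0 w1] := w01 i.
      rewrite mulrACA -invfM; apply: (@le_trans _ _ (1 * (m.+1%:R * m.+1%:R)^-1)).
        by rewrite ler_wpM2r ?invr_ge0 ?mulr_ge0 // mulr_ile1.
      by rewrite mul1r lef_pV2 ?posrE ?mulr_gt0 // ler_peMl ?(ltW m1) // ler1n.
    by rewrite sumr_const card_ord -[_ *+ _]mulr_natl divff // gt_eqF.
  pose t := Num.sqrt (1 - dot u u).
  have um : u 0 ord_max = 0 by rewrite mxE unlift_none.
  exists (u + t *: delta_mx 0 ord_max).
    have du : dot u (delta_mx 0 ord_max) = 0.
      rewrite /dot (bigD1 ord_max) //= um mul0r add0r big1 // => j jm.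
      by rewrite !mxE (negbTE jm) andbF mulr0.
    have e1 : enorm (delta_mx 0 ord_max : 'rV[R]_m.+1) = 1 by exact: enorm_delta_mx.
    rewrite /usphere /=; apply/eqP; rewrite -(@eqrXn2 _ 2) ?enorm_ge0 // expr1n.
    have t2 : t ^+ 2 = 1 - dot u u by rewrite sqr_sqrtr ?subr_ge0.
    rewrite enorm_sqrD dotZr du enormZ e1 mulr1 real_normK ?num_real // t2 sqr_enorm.
    by rewrite !mulr0 addr0 addrC subrK.
  move=> i; rewrite !mxE liftK eqxx /= (_ : lift ord_max i == ord_max = false) ?mulr0 ?addr0.
    by rewrite mulrCA divff ?mulr1 // gt_eqF.
  by apply/negbTE; rewrite eq_sym neq_lift.
Qed.

Lemma hausdorff_finite_bigcup (I : finType) {n} (F : I -> set 'rV[R]_n) :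
  (forall i, H (F i) < +oo)%E -> (H (\bigcup_i F i) < +oo)%E.
Proof.
move=> Ffin.
have -> : \bigcup_i F i = \bigcup_(i in [set` enum I]) F i.
  by apply/seteqP; split=> x [i _ Fx]; exists i => //=; rewrite mem_enum.
rewrite bigcup_seq; elim: (enum I) => [|i s ih].
  by rewrite big_nil outer_measure0.
by rewrite big_cons (le_lt_trans (hausdorffU _ _ _)) // lte_add_pinfty.
Qed.

Definition cube_boundary (r : R) : set 'rV[R]_m.+1 := [set z | `|z| = r].

Lemma cube_boundary_hausdorff_fin (r : R) : 0 <= r -> (H (cube_boundary r) < +oo)%E.
Proof.
move=> r0.
pose F (jb : 'I_m.+1 * bool) := [set z : 'rV[R]_m.+1 | `|z| <= r /\ z 0 jb.1 = (if jb.2 then r else - r)].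
have sub : cube_boundary r `<=` \bigcup_jb F jb.
  move=> z zr.
  have [j jz] : exists j, `|z 0 j| = r.
    apply: contrapT => nj.
    have lt j : `|z 0 j| < r.
      rewrite lt_neqAle; apply/andP; split; first by apply/eqP => zj; apply: nj; exists j.
      by rewrite -zr coord_le_mxnorm.
    have : `|z| < r.
      rewrite /Num.norm /= mx_normrE; apply: bigmax_lt => [|[i j] _ /=]; last by rewrite ord1; exact: lt.
      exact: le_lt_trans (normr_ge0 _) (lt ord0).
    by rewrite zr ltxx.
  have [z0|z0] := leP 0 (z 0 j); [exists (j, true)|exists (j, false)] => //; split; rewrite /= ?zr //.
    by rewrite -jz ger0_norm.
  by rewrite -jz ltr0_norm // opprK.
apply: le_lt_trans; first exact: (le_outer_measure (@hausdorff R m.+1 m) _ _ sub).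
apply: hausdorff_finite_bigcup => -[j b].
apply: le_lt_trans (hausdorff_cube (f := fun i z => z 0 (lift j i)) (c := fun=> 0) (M := r) (C := m%:R) r0 (ler0n _ _) _ _) (ltry _).
- by move=> y i [yr _]; rewrite subr0 (le_trans (coord_le_mxnorm _ _) yr).
- move=> y y' e [_ /= yj] [_ /= yj'] h.
  apply: le_trans (enorm_le_sum _) _.
  rewrite (bigD1_ord j) //= !mxE yj yj' subrr normr0 add0r.
  apply: (@le_trans _ _ (\sum_(i < m) e)); first by apply: ler_sum => i _; rewrite !mxE; exact: h.
  by rewrite sumr_const card_ord mulr_natl.
Qed.

(** The intermediate value theorem along the ray. The margin between [M] and [M + 1] forces
    [t >= 1], so dividing by [t] to recover [v] does not enlarge errors. *)
Lemma ray_hits_cube (x v : 'rV[R]_m.+1) (M : R) : enorm x <= M -> enorm v = 1 ->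
  exists2 t : R, 1 <= t & `|x + t *: v| = M + 1.
Proof.
move=> xM v1.
have M0 : 0 <= M := le_trans (enorm_ge0 _) xM.
pose T : R := m.+1%:R * (M + 1) + M.
have T0 : 0 <= T by rewrite addr_ge0 // mulr_ge0 // addr_ge0.
pose g (t : R) : R := `|x + t *: v|.
have gc : {within `[0, T], continuous g}.
  apply: continuous_subspaceT => t.
  apply: cvg_norm; apply: cvgD; first exact: cvg_cst.
  apply: cvgZr_tmp; exact: cvg_id.
have g0 : g 0 <= M by rewrite /g scale0r addr0 (le_trans (mxnorm_le_enorm _)).
have gT : M + 1 <= g T.
  have m1 : 0 < m.+1%:R :> R by rewrite ltr0n.
  rewrite -(ler_pM2l m1) (le_trans _ (enorm_le_mxnorm _)) //.
  have : enorm (T *: v) - enorm x <= enorm (x + T *: v).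
    by rewrite lerBlDr -{1}(addrDBl x (T *: v)) (le_trans (ler_enormB _ _)).
  rewrite enormZ v1 mulr1 ger0_norm // /T; lra.
have [|t] := IVT T0 gc (v := M + 1).
  by rewrite ge_min le_max gT orbT (le_trans g0) // lerDl.
rewrite in_itv /= => /andP[t0 _] gt; exists t => //.
have : `|x + t *: v| <= `|x| + `|t *: v| := ler_normD _ _.
rewrite -/(g t) gt => h.
have := mxnorm_le_enorm x; have := mxnorm_le_enorm (t *: v).
rewrite enormZ v1 mulr1 ger0_norm //; lra.
Qed.

(* The map from the cube boundary to [(x, v)], sending the point where the ray
   from [x] in direction [v] leaves the cube to [(x, v)], is Lipschitz. *)
Lemma normal_set_hausdorff_fin (A : set 'rV[R]_(m.+1 + m.+1)) (M : R) :
  (forall p, A p -> enorm (lsubmx p) <= M /\ enorm (rsubmx p) = 1) ->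
  (forall p p', A p -> A p' -> dot (lsubmx p' - lsubmx p) (rsubmx p) <= 0) ->
  (H A < +oo)%E.
Proof.
move=> AM mono; have [->|/set0P[p0 Ap0]] := eqVneq A set0; first by rewrite outer_measure0.
have M0 : 0 <= M := le_trans (enorm_ge0 _) (proj1 (AM _ Ap0)).
pose T (p : 'rV[R]_(m.+1 + m.+1)) (z : 'rV[R]_m.+1) :=
  exists2 t : R, 1 <= t & z = lsubmx p + t *: rsubmx p.
apply: le_lt_trans (@hausdorff_lipschitz R m.+1 (m.+1 + m.+1) m A (cube_boundary (M + 1)) T 5 _ _ _) _ => //.
- move=> p Ap; have [pM p1] := AM _ Ap; have [t t1 tM] := ray_hits_cube pM p1.
  by exists (lsubmx p + t *: rsubmx p) => //; exists t.
- move=> p p' z z' Ap Ap' _ _ [t t1 ->] [t' t'1 ->].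
  have [_ v1] := AM _ Ap; have [_ v'1] := AM _ Ap'.
  have m1 := mono _ _ Ap Ap'; have m2 := mono _ _ Ap' Ap.
  rewrite -{1}(hsubmxK p) -{1}(hsubmxK p') row_mxB.
  move: (lsubmx p) (rsubmx p) (lsubmx p') (rsubmx p') v1 v'1 m1 m2 => x v x' v' v1 v'1 m1 m2.
  set w := x + t *: v - (x' + t' *: v').
  (* Monotonicity: the normal parts only add to the separation of [x] and [x']. This costs a factor
     1, and [v] a factor 4, whence the constant 5. *)
  have xw : enorm (x - x') <= enorm w.
    have cs := cauchy_schwarz (x - x') w.
    have : enorm (x - x') ^+ 2 <= dot (x - x') w.
      have -> : w = (x - x') + (t *: v - t' *: v') by rewrite /w; apply/rowP => i; rewrite !mxE; ring.
      rewrite dotDr -[dot (x - x') (x - x')]sqr_enorm lerDl dotBr !dotZr.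
      have : 0 <= t * dot (x - x') v.
        apply: mulr_ge0; first exact: le_trans ler01 t1.
        by rewrite -oppr_le0 -dotNl opprB.
      have : t' * dot (x - x') v' <= 0.
        by apply: mulr_ge0_le0 => //; exact: le_trans ler01 t'1.
      lra.
    move=> h; have [->|x0] := eqVneq (enorm (x - x')) 0; first exact: enorm_ge0.
    have {}x0 : 0 < enorm (x - x') by rewrite lt_neqAle eq_sym x0 enorm_ge0.
    by rewrite -(ler_pM2l x0) -expr2 (le_trans h).
  have tv : enorm (t *: v - t' *: v') <= 2 * enorm w.
    have -> : t *: v - t' *: v' = w - (x - x') by rewrite /w; apply/rowP => i; rewrite !mxE; ring.
    by apply: le_trans (ler_enormB _ _) _; lra.
  have tt : `|t - t'| <= 2 * enorm w.
    apply: le_trans tv; have := ler_dist_enorm (t *: v) (t' *: v').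
    by rewrite !enormZ v1 v'1 !mulr1 (ger0_norm (le_trans ler01 t1)) (ger0_norm (le_trans ler01 t'1)).
  have vv : enorm (v - v') <= 4 * enorm w.
    have : enorm (t *: (v - v')) <= 4 * enorm w.
      have -> : t *: (v - v') = (t *: v - t' *: v') - (t - t') *: v'.
        by apply/rowP => i; rewrite !mxE; ring.
      by apply: le_trans (ler_enormB _ _) _; rewrite enormZ v'1 mulr1; lra.
    rewrite enormZ ger0_norm ?(le_trans ler01) //; apply: le_trans.
    by rewrite ler_peMl ?enorm_ge0.
  by apply: le_trans (enorm_row_mx_le _ _) _; lra.
rewrite lte_mul_pinfty ?lee_fin ?exprn_ge0 //; apply: cube_boundary_hausdorff_fin.
by rewrite addr_ge0.
Qed.

(** The sphere is the set of second components of the normals at the single point 0. *)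
Lemma sphere_hausdorff_fin : (H (@usphere R m.+1) < +oo)%E.
Proof.
pose A := [set p : 'rV[R]_(m.+1 + m.+1) | lsubmx p = 0 /\ enorm (rsubmx p) = 1].
have Afin : (H A < +oo)%E.
  apply: (@normal_set_hausdorff_fin A 0) => [p [-> ->]|p p' [-> _] [-> _]].
    by rewrite enorm0.
  by rewrite subrr dot0l.
apply: le_lt_trans (@hausdorff_lipschitz R (m.+1 + m.+1) m.+1 m _ A (fun v p => v = rsubmx p) 1 _ _ _) _ => //.
- by move=> v v1; exists (row_mx 0 v); rewrite /A /= ?row_mxKl ?row_mxKr.
- move=> v v' p p' _ _ _ _ -> ->; rewrite mul1r -linearB; exact: enorm_rsubmx.
- by rewrite lte_mul_pinfty ?lee_fin ?exprn_ge0.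
Qed.

End Sphere.

Lemma outer_image_le_integral (R : realType) (T : pointedType) T'
    (mu : {outer_measure set T -> \bar R}) (nu : {outer_measure set T' -> \bar R}) (f : T -> T')
    (D A B : set (caratheodory_type mu)) (P : nat -> set (caratheodory_type mu))
    (w : nat -> R) (g : T -> R) (C : R) :
  0 < C -> measurable A -> measurable B -> (mu A < +oo)%E -> (mu B = 0)%E -> (nu (f @` B) = 0)%E -> A `<=` D ->
  (forall j, measurable (P j)) -> (forall j, 0 < w j) ->
  (forall j (E : set (caratheodory_type mu)), measurable E -> E `<=` P j ->
    (nu (f @` E) <= (C * w j)%:E * mu E)%E) ->
  (forall x, A x -> ~ B x -> 0 <= g x <= 1) ->
  (forall x c, A x -> ~ B x -> g x < c -> exists2 j, P j x & w j <= c) ->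
  (nu (f @` A) <= C%:E * \int[mu : set (caratheodory_type mu) -> \bar R]_(x in D) (\1_A x * g x)%:E)%E.
Proof. exact: (@image_le_integral _ (caratheodory_type mu) R mu T' nu f). Qed.
Lemma rational_matrix_close (R : realType) k n (a : 'M[R]_(k, n)) (e : R) : 0 < e ->
  exists Q : 'M[rat]_(k, n), forall i j, `|ratr (Q i j) - a i j| <= e.
Proof.
move=> e0; have h (ij : 'I_k * 'I_n) : exists q : rat, `|ratr q - a ij.1 ij.2| <= e.
  have [|q] := @rat_in_itvoo R (a ij.1 ij.2 - e) (a ij.1 ij.2 + e); first by lra.
  rewrite in_itv /= => /andP[h1 h2]; exists q; rewrite ler_norml; lra.
have [q hq] := choice h.
by exists (\matrix_(i, j) q (i, j)) => i j; rewrite mxE; exact: (hq (i, j)).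
Qed.

Lemma prodr_perturb (R : realType) (I : Type) (s : I -> R) (l : seq I) c :
  (forall i, 0 <= s i) -> \prod_(i <- l) s i < c ->
  exists2 eta, 0 < eta & \prod_(i <- l) (s i + eta) < c.
Proof.
move=> s0; elim: l c => [|i l ih] c; rewrite ?big_nil ?big_cons.
  by move=> c1; exists 1; rewrite ?big_nil.
move=> hc; set P := \prod_(j <- l) s j in hc *.
have P0 : 0 <= P by apply: prodr_ge0.
pose d := Num.min 1 ((c - s i * P) / (2 * (s i + P + 1))).
have K0 : 0 < 2 * (s i + P + 1) by rewrite mulr_gt0 // ltr_wpDl // addr_ge0.
have d0 : 0 < d by rewrite lt_min ltr01 divr_gt0 // subr_gt0.
have d1 : d <= 1 by rewrite ge_min lexx.
have dc : d * (2 * (s i + P + 1)) <= c - s i * P.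
  by rewrite -ler_pdivlMr // ge_min lexx orbT.
have Pd : P < P + d by rewrite ltrDl.
have [eta eta0 he] := ih (P + d) Pd.
exists (Num.min d eta); first by rewrite lt_min d0.
rewrite big_cons.
have m1 : Num.min d eta <= d by rewrite ge_min lexx.
have m2 : Num.min d eta <= eta by rewrite ge_min lexx orbT.
have m0 : 0 <= Num.min d eta by rewrite le_min !ltW.
move: (Num.min d eta) m1 m2 m0 => t m1 m2 m0.
have p0 : 0 <= \prod_(j <- l) (s j + t) by apply: prodr_ge0 => j _; rewrite addr_ge0.
have p1 : \prod_(j <- l) (s j + t) <= P + d.
  apply: le_trans (ltW he); apply: ler_prod => j _.
  by rewrite addr_ge0 //= lerD2l.
apply: (@le_lt_trans _ _ ((s i + d) * (P + d))).
  by apply: ler_pM => //; rewrite ?addr_ge0 // lerD2l.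
have s0i := s0 i; have dd : d * d <= d * 1 by rewrite ler_pM2l.
have := mulr_ge0 (ltW d0) s0i; have := mulr_ge0 (ltW d0) P0; lra.
Qed.

Lemma orthonormal_rows_norm (R : realType) m (a : 'M[R]_(m, m.+1)) (v : 'rV[R]_m.+1) :
  a *m a^T = 1%:M -> (forall i, dot (row i a) v = 0) -> enorm v = 1 ->
  forall u, enorm u ^+ 2 = dot u v ^+ 2 + enorm (u *m a^T) ^+ 2.
Proof.
move=> aa av v1 u; pose C : 'M[R]_(1 + m, m.+1) := col_mx v a.
have CC : C *m C^T = 1%:M.
  rewrite tr_col_mx mul_col_row aa.
  have av0 : a *m v^T = 0.
    apply/matrixP => i j; rewrite [RHS]mxE -[RHS](av i) mxE.
    by apply: eq_bigr => l _; rewrite !mxE ord1.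
  have va0 : v *m a^T = 0 by rewrite -[v *m _]trmxK trmx_mul trmxK av0 trmx0.
  have vv : v *m v^T = 1%:M.
    by apply/matrixP => i j; rewrite !ord1 -dot_mulmx_tr mxE eqxx -sqr_enorm v1 expr1n.
  by rewrite av0 va0 vv -scalar_mx_block.
have CT := mulmx1C CC.
have <- : enorm (u *m C^T) = enorm u.
  by rewrite /enorm !dot_mulmx_tr trmx_mul trmxK mulmxA -(mulmxA u) CT mulmx1.
rewrite tr_col_mx mul_mx_row sqr_enorm_row_mx; congr (_ + _).
by rewrite sqr_enorm /dot big_ord1 -expr2 mxE; congr (_ ^+ 2); apply: eq_bigr => i _; rewrite mxE.
Qed.

Section Hole.
Context {R : realType} {m : nat}.
Let n := m.+1.
Local Notation H := (@hausdorff R _ m).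
Implicit Types (x y u w h : 'rV[R]_n).
Variables (X : set 'rV[R]_n) (r : R).
Hypothesis Xc : closed X.
Hypothesis r0 : 0 < r.
Hypothesis reach : forall y, infdist y X < r ->
  exists! x, X x /\ enorm (y - x) = infdist y X.
Variable near_pt : 'rV[R]_n -> 'rV[R]_n.
Hypothesis near_ptP : forall y, X (near_pt y) /\ enorm (y - near_pt y) = infdist y X.
Variable Y : set 'rV[R]_n.
Hypothesis Ycomp : compact Y.
Hypothesis Y0 : Y !=set0.
Hypothesis YX : Y `<=` X.
Hypothesis Yopen : forall x, Y x -> exists2 e, 0 < e & forall y, X y -> enorm (y - x) < e -> Y y.

Definition hull_normals : set 'rV[R]_(n + n) :=
  [set p | [/\ Y (lsubmx p), enorm (rsubmx p) = 1 &
    forall y, Y y -> dot (y - lsubmx p) (rsubmx p) <= 0]].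
Local Notation A := hull_normals.
Let Yc : closed Y. Proof. exact: compact_closed Ycomp. Qed.
Lemma hull_normals_half p : A p -> exists2 e, 0 < e &
  forall y, X y -> enorm (y - lsubmx p) < e -> dot (y - lsubmx p) (rsubmx p) <= 0.
Proof.
move=> [Yp _ h]; have [e e0 he] := Yopen Yp; exists e => // y Xy ye; apply: h; exact: he.
Qed.

Lemma hull_normals_nor : A `<=` nor X.
Proof.
move=> p Ap; have [e e0 half] := hull_normals_half Ap; have [Yp v1 _] := Ap.
set x := lsubmx p in half Yp *; set v := rsubmx p in half v1 *.
split=> //.
  split; first by apply: subset_closure; exact: YX.
  move=> /nbhs_enormP[d d0 hd].
  pose t := Num.min (d / 2) (e / 2).
  have t0 : 0 < t by rewrite lt_min !divr_gt0.
  have td : t < d by apply: (@le_lt_trans _ _ (d / 2)); [rewrite ge_min lexx | lra].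
  have te : t < e by apply: (@le_lt_trans _ _ (e / 2)); [rewrite ge_min lexx orbT | lra].
  have tn : enorm (t *: v) = t by rewrite enormZ v1 mulr1 gtr0_norm.
  have Xt : X (x + t *: v) by apply: hd; rewrite addrDBl tn.
  have := half _ Xt; rewrite addrDBl tn => /(_ te).
  by rewrite dotZl -sqr_enorm v1 expr1n mulr1 leNgt t0.
move=> u cu; apply/ler_addgt0Pr => eps eps0; rewrite add0r.
have m0 : 0 < Num.min e eps by rewrite lt_min e0.
have [b [t [Xb t0 bx tb]]] := cu _ m0.
move: bx tb; rewrite !lt_min => /andP[bx _] /andP[_ tb].
have h1 : dot (t *: (b - x)) v <= 0 by rewrite dotZl pmulr_rle0 //; exact: half.
have := normr_dot_le (u - t *: (b - x)) v; rewrite v1 mulr1 dotBl enormBC => h3.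
have := le_trans (ler_norm _) h3; lra.
Qed.

Lemma hull_normals_closed : closed A.
Proof.
apply/closed_enormP => p hp.
have app e : 0 < e -> exists q, [/\ A q, enorm (lsubmx p - lsubmx q) < e & enorm (rsubmx p - rsubmx q) < e].
  move=> e0; have [q Aq qp] := hp _ e0; exists q; split=> //.
    by rewrite -linearB (le_lt_trans (enorm_lsubmx _)) // enormBC.
  by rewrite -linearB (le_lt_trans (enorm_rsubmx _)) // enormBC.
split.
- apply: (proj1 (closed_enormP _) Yc) => e e0.
  by have [q [[Yq _ _] ql _]] := app _ e0; exists (lsubmx q); rewrite // enormBC.
- apply/eqP; rewrite -subr_eq0 -normr_le0; apply/ler_addgt0Pr => e e0; rewrite add0r.
  have [q [[_ <- _] _ qr]] := app _ e0.
  exact: le_trans (ler_dist_enorm _ _) (ltW qr).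
- move=> y Yy; apply/ler_addgt0Pr => e e0; rewrite add0r.
  have K0 : 0 < enorm (y - lsubmx p) + 1 by rewrite ltr_wpDl // enorm_ge0.
  have [q [[_ q1 hq] ql qr]] := app _ (divr_gt0 e0 K0).
  have -> : dot (y - lsubmx p) (rsubmx p) = dot (y - lsubmx q) (rsubmx q)
      + dot (y - lsubmx p) (rsubmx p - rsubmx q) - dot (lsubmx p - lsubmx q) (rsubmx q).
    by rewrite !dotE; ring.
  have h1 := hq y Yy.
  have := le_trans (ler_norm _) (normr_dot_le (y - lsubmx p) (rsubmx p - rsubmx q)).
  have := normr_dot_le (lsubmx p - lsubmx q) (rsubmx q).
  rewrite q1 mulr1 ler_norml => /andP[h2 _] h3.
  rewrite ltr_pdivlMr // in ql; rewrite ltr_pdivlMr // in qr.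
  have := enorm_ge0 (y - lsubmx p); have := enorm_ge0 (lsubmx p - lsubmx q); nra.
Qed.

Lemma hull_normals_hausdorff_fin : (H A < +oo)%E.
Proof.
have [M M0 YM] := compact_enorm_bounded Ycomp.
apply: (@normal_set_hausdorff_fin _ _ A M) => [p [Yp v1 _]|p p' [_ _ h] [Yp' _ _]].
  by split=> //; exact: YM.
exact: h.
Qed.

(** A direction [v] is an outer normal at any maximizer of the linear form [v] on the compact set
    [Y]. *)
Lemma hull_normals_image : @rsubmx R 1 n n @` A = @usphere R n.
Proof.
apply/seteqP; split=> [_ [p [_ v1 _] <-] //|v v1].
have [|x Yx xmax] := @compact_argmax R n Y (fun y => dot y v) 1 Ycomp Y0 ler01.
  move=> x y _ _; rewrite -dotBl (le_trans (normr_dot_le _ _)) // mul1r.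
  by rewrite (_ : enorm v = 1) ?mulr1.
exists (row_mx x v); rewrite ?row_mxKr //; split; rewrite ?row_mxKl ?row_mxKr //.
by move=> y Yy; rewrite dotBl subr_le0; exact: xmax.
Qed.

Let good p := exists rho M, [/\ 0 < rho, rho < r / 4 & mdiff_at near_pt (lsubmx p + rho *: rsubmx p) M].
Let B := A `&` [set p | ~ good p].

Lemma near_pt_nondiff_null :
  @hausdorff R n n ([set z | infdist z X < r / 4] `&` [set z | ~ exists M, mdiff_at near_pt z M]) = 0%E.
Proof.
pose D := [set z : 'rV[R]_n | infdist z X < r / 4].
have Do : open D.
  apply/open_enormP => z Dz; exists (r / 4 - infdist z X); first by rewrite subr_gt0.
  move=> y yz; rewrite /D /=; have := infdist_lip y z X; rewrite ler_norml => /andP[_]; lra.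
have null j : @hausdorff R n n (D° `&` [set z | ~ diff_at (fun y => near_pt y 0 j) z]) = 0%E.
  apply: (@rademacher_on R n D _ 2) => // x y Dx Dy.
  have := coord_le_enorm (near_pt x - near_pt y) j; rewrite !mxE => h.
  exact: le_trans h (near_pt_lip Xc r0 reach near_ptP Dx Dy).
apply: hausdorff_null_subset (hausdorff_null_bigcup null) => z [Dz nd].
have [j nj] : exists j, ~ diff_at (fun y => near_pt y 0 j) z.
  by apply: contrapT => h; apply: nd; apply: diff_at_mdiff => j; apply: contrapT => nj; apply: h; exists j.
exists j => //; split=> //; rewrite /interior; exact: open_nbhs_nbhs.
Qed.

(* If the points [(x, rho v)] with [(x, v)] bad were not negligible for almost
   every [rho], the nondifferentiability set of [near_pt] would have positive
   measure. *)
Lemma bad_normals_null : H B = 0%E.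
Proof.
(* The bad pairs spread over an interval of distances: a set one dimension higher, comparable with
   nondifferentiability points of [near_pt]. Its slice by the norm of the second component is a
   rescaled copy of [B]. *)
pose E := [set q : 'rV[R]_(n + n) | exists p rho, [/\ B p, r / 16 <= rho <= r / 8 & q = row_mx (lsubmx p) (rho *: rsubmx p)]].
have rhoP rho : r / 16 <= rho <= r / 8 -> [/\ 0 < rho, rho < r / 4 & 0 < rho < r].
  by move=> /andP[h1 h2]; have := r0; split; [lra|lra|apply/andP; split; lra].
have BN p : B p -> nor X p by move=> [/hull_normals_nor].
have E0 : @hausdorff R (n + n) m.+1 E = 0%E.
  apply/eqP; rewrite eq_le outer_measure_ge0 andbT.
  pose W := [set z : 'rV[R]_n | infdist z X < r / 4] `&` [set z | ~ exists M, mdiff_at near_pt z M].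
  (* The inverse map sends z to the pair (P(z), z - P(z)), with P the projection [near_pt]. As P is
     2-Lipschitz at these points, 2 + (1 + 2) gives the constant 5. *)
  apply: le_trans (@hausdorff_lipschitz R n (n + n) m.+1 E W (fun q z => z = lsubmx q + rsubmx q) 5 _ _ _) _; last first.
  - by rewrite (near_pt_nondiff_null : hausdorff m.+1 W = 0%E) mule0.
  - move=> q q' z z' [p [rho [Bp hrho ->]]] [p' [rho' [Bp' hrho' ->]]] _ _ -> ->.
    have [a1 a2 a3] := rhoP _ hrho; have [b1 b2 b3] := rhoP _ hrho'.
    have [dz nz] := nor_near_pt Xc r0 reach near_ptP (BN _ Bp) a3.
    have [dz' nz'] := nor_near_pt Xc r0 reach near_ptP (BN _ Bp') b3.
    rewrite !row_mxKl !row_mxKr row_mxB.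
    set z1 := _ + _ in dz nz *; set z2 := _ + _ in dz' nz' *.
    have lip : enorm (lsubmx p - lsubmx p') <= 2 * enorm (z1 - z2).
      by rewrite -nz -nz'; apply: (near_pt_lip Xc r0 reach near_ptP); rewrite ?dz ?dz'.
    apply: le_trans (enorm_row_mx_le _ _) _.
    have -> : rho *: rsubmx p - rho' *: rsubmx p' = (z1 - z2) - (lsubmx p - lsubmx p').
      by rewrite /z1 /z2; apply/rowP => i; rewrite !mxE; ring.
    have := ler_enormB (z1 - z2) (lsubmx p - lsubmx p'); lra.
  - move=> q [p [rho [Bp hrho ->]]]; have [a1 a2 a3] := rhoP _ hrho.
    have [dz nz] := nor_near_pt Xc r0 reach near_ptP (BN _ Bp) a3.
    eexists; last reflexivity; rewrite row_mxKl row_mxKr; split; first by rewrite /= dz.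
    by move=> [M hM]; have [_] := Bp; apply; exists rho, M.
  - by [].
have [||rho hrho Erho] := @eilenberg R (n + n) m E (fun q => enorm (rsubmx q)) 1 (r / 16) (r / 8) ler01 _ _ E0.
- by have := r0; lra.
- move=> q q' _ _; rewrite mul1r; apply: le_trans (ler_dist_enorm _ _) _.
  by rewrite -linearB; exact: enorm_rsubmx.
have [a1 a2 a3] := rhoP _ hrho.
have ri : 0 < rho^-1 by rewrite invr_gt0.
apply/eqP; rewrite eq_le outer_measure_ge0 andbT.
apply: le_trans (@hausdorff_lipschitz R (n + n) (n + n) m B (E `&` [set q | enorm (rsubmx q) = rho]) (fun p q => q = row_mx (lsubmx p) (rho *: rsubmx p)) (1 + rho^-1) _ _ _) _; last first.
- by rewrite Erho mule0.
- move=> p p' q q' _ _ _ _ -> ->; rewrite row_mxB -scalerBr.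
  rewrite -{1}(hsubmxK p) -{1}(hsubmxK p') row_mxB.
  apply: le_trans (enorm_row_mx_le _ _) _; rewrite mulrDl mul1r lerD ?enorm_row_mxl //.
  rewrite ler_pdivlMl //; apply: le_trans (enorm_row_mxr (lsubmx p - lsubmx p') _).
  by rewrite enormZ gtr0_norm.
- move=> p Bp; eexists; last reflexivity; split; first by exists p, rho.
  by rewrite /= row_mxKr enormZ gtr0_norm // (_ : enorm _ = 1) ?mulr1 //; case: Bp => [[]].
- by rewrite addr_gt0.
Qed.

(* Near [p] the map [(x, v) |-> v] stretches the i-th direction, approximately
   row i of [Q], by at most [(s i + 1) / (L + 1)]. *)
Let J := ('M[rat]_(m, n) * {ffun 'I_m -> nat} * nat * nat)%type.
Let Qr (j : J) : 'M[R]_(m, n) := map_mx ratr j.1.1.1.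
Let sg (j : J) i : R := (j.1.1.2 i).+1%:R / j.1.2.+1%:R.
Let rad (j : J) : R := j.2.+1%:R^-1.
(** The second clause says that the [m] coordinates along the rows of [Qr j] control the whole
    difference of two nearby unit normals: the missing direction is the normal itself, along which
    this difference is of second order. *)
Let piece (j : J) := A `&` [set p | forall p', A p' -> enorm (p' - p) < rad j ->
  (forall i, `|dot (rsubmx p' - rsubmx p) (row i (Qr j))| <= sg j i * enorm (p' - p)) /\
  enorm (rsubmx p' - rsubmx p) <= 4 * enorm ((rsubmx p' - rsubmx p) *m (Qr j)^T)].
Let sg0 j i : 0 < sg j i. Proof. by rewrite divr_gt0 // ltr0n. Qed.
Lemma piece_closed j : closed (piece j).
Proof.
apply: closedI; first exact: hull_normals_closed.
(* An implication from [enorm (p' - p) < rad j] to an inequality becomes one inequality [g t p <= 0]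
   by taking a minimum; [None] stands for the second clause of [piece]. *)
pose g (t : 'rV[R]_(n + n) * option 'I_m) p : R :=
  Num.min (rad j - enorm (t.1 - p)) (if t.2 is Some i
    then `|dot (rsubmx t.1 - rsubmx p) (row i (Qr j))| - sg j i * enorm (t.1 - p)
    else enorm (rsubmx t.1 - rsubmx p) - 4 * enorm ((rsubmx t.1 - rsubmx p) *m (Qr j)^T)).
have -> : [set p | forall p', A p' -> enorm (p' - p) < rad j ->
  (forall i, `|dot (rsubmx p' - rsubmx p) (row i (Qr j))| <= sg j i * enorm (p' - p)) /\
  enorm (rsubmx p' - rsubmx p) <= 4 * enorm ((rsubmx p' - rsubmx p) *m (Qr j)^T)] =
  [set p | forall t, A t.1 -> g t p <= 0].
  apply/seteqP; split=> p hp.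
    move=> [p' o] /= Ap'; rewrite /g ge_min subr_le0 leNgt; have [pp|//] := ltP (enorm (p' - p)) (rad j).
    rewrite -leNgt orFb; have [h1 h2] := hp _ Ap' pp.
    by case: o => [i|] /=; rewrite subr_le0.
  move=> p' Ap' pp; split=> [i|].
    have := hp (p', Some i) Ap'; rewrite /g ge_min => /orP[|]; last by rewrite subr_le0.
    by rewrite subr_le0 leNgt pp.
  have := hp (p', None) Ap'; rewrite /g ge_min => /orP[|]; last by rewrite subr_le0.
  by rewrite subr_le0 leNgt pp.
have [K K0 hK] := mulmx_enorm_bound (Qr j)^T.
have minlip (a b c d e : R) : `|a - c| <= e -> `|b - d| <= e -> `|Num.min a b - Num.min c d| <= e.
  rewrite !ler_norml => /andP[h1 h2] /andP[h3 h4]; rewrite /Num.min.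
  by case: ltP => h5; case: ltP => h6; apply/andP; split; lra.
pose Lip (t : 'rV[R]_(n + n) * option 'I_m) : R := if t.2 is Some i then 1 + enorm (row i (Qr j)) + sg j i else 1 + 4 * K.
apply: (@closed_forall_lip _ _ _ _ _ Lip) => -[p' o] x y; rewrite /g /=.
have d1 : `|enorm (p' - x) - enorm (p' - y)| <= enorm (x - y).
  apply: le_trans (ler_dist_enorm _ _) _; rewrite enormBC.
  by rewrite (_ : p' - y - (p' - x) = x - y) //; apply/rowP => i; rewrite !mxE; ring.
have dr : enorm ((rsubmx p' - rsubmx x) - (rsubmx p' - rsubmx y)) <= enorm (x - y).
  rewrite (_ : _ - _ = rsubmx (y - x)); last by apply/rowP => i; rewrite !mxE; ring.
  by rewrite (enormBC x); exact: enorm_rsubmx.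
have N0 := enorm_ge0 (x - y).
apply: minlip.
  rewrite opprB addrC addrA subrK distrC; apply: le_trans d1 _; rewrite /Lip.
  case: o => [i|] /=; last by rewrite ler_peMl // lerDl mulr_ge0 // ltW.
  by rewrite -addrA ler_peMl // lerDl addr_ge0 ?enorm_ge0 // ltW.
case: o => [i|] /=.
  set a := rsubmx p' - _ in dr *; set b := rsubmx p' - _ in dr *.
  have h1 : `| `|dot a (row i (Qr j))| - `|dot b (row i (Qr j))| | <= enorm (x - y) * enorm (row i (Qr j)).
    apply: le_trans (ler_dist_dist _ _) _; rewrite -dotBl; apply: le_trans (normr_dot_le _ _) _.
    by rewrite ler_wpM2r ?enorm_ge0.
  have h2 : `|sg j i * enorm (p' - x) - sg j i * enorm (p' - y)| <= sg j i * enorm (x - y).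
    by rewrite -mulrBr normrM gtr0_norm // ler_pM2l.
  move: h1 h2; rewrite !ler_norml => /andP[h1 h1'] /andP[h2 h2']; rewrite /Lip /=.
  by rewrite !mulrDl mul1r (mulrC (enorm (row _ _))); apply/andP; split; lra.
set a := rsubmx p' - _ in dr *; set b := rsubmx p' - _ in dr *.
have h1 : `|enorm a - enorm b| <= enorm (x - y) by apply: le_trans (ler_dist_enorm _ _) dr.
have h2 : `|enorm (a *m (Qr j)^T) - enorm (b *m (Qr j)^T)| <= K * enorm (x - y).
  apply: le_trans (ler_dist_enorm _ _) _; rewrite -mulmxBl; apply: le_trans (hK _) _.
  by rewrite ler_pM2l.
move: h1 h2; rewrite !ler_norml => /andP[h1 h1'] /andP[h2 h2']; rewrite /Lip /=.
by rewrite mulrDl mul1r; apply/andP; split; lra.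
Qed.

(** The constant [(2 * C) ^+ m] of the box lemma, where [C] combines the 4 in [piece] with [m.+1%:R]
    for passing from coordinates to the Euclidean norm. *)
Definition area_const : R := (2 * (4 * m.+1%:R)) ^+ m.

Lemma area_const_gt0 : 0 < area_const.
Proof. by rewrite exprn_gt0 // !mulr_gt0 // ltr0n. Qed.
Lemma piece_image j E : E `<=` piece j ->
  (H (@rsubmx R 1 n n @` E) <= (area_const * \prod_i sg j i)%:E * H E)%E.
Proof.
move=> EP.
apply: (@hausdorff_image_le_box R (n + n) n m E (@rsubmx R 1 n n) (fun i v => dot v (row i (Qr j)))
  (fun i => (j.1.1.2 i).+1) j.1.2.+1%:R (4 * m.+1%:R) (rad j)) => //.
- by rewrite invr_gt0 ltr0n.
- move=> p p' i /EP[_ hp] /EP[Ap' _] pp; rewrite -dotBl; exact: (proj1 (hp _ Ap' pp)).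
- move=> p p' e /EP[_ hp] /EP[Ap' _] e0 pp he.
  apply: le_trans (proj2 (hp _ Ap' pp)) _; rewrite -mulrA ler_pM2l //.
  apply: (@le_trans _ _ (m%:R * e)); last by rewrite ler_wpM2r // ler_nat.
  by apply: enorm_le_coord => i; rewrite dot_row dotBl; exact: he.
Qed.

Lemma piece_exists p c : A p -> good p -> curv_density X p < c ->
  exists2 j, piece j p & \prod_i sg j i <= c.
Proof.
move=> Ap [rho [M [rho0 rho4 dM]]] kc.
have np := hull_normals_nor Ap.
have [s [a [kE s01 [aa av] hs]]] := curvature_local Xc r0 reach near_ptP np rho0 rho4 dM (hull_normals_half Ap).
have s0 i : 0 <= s i by case/andP: (s01 i).
rewrite kE in kc; have [eta eta0 heta] := prodr_perturb s0 kc.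
have e40 : 0 < eta / 4 by rewrite divr_gt0.
(* A denominator fine enough for a fraction to fit between [s i + eta / 2] and [s i + eta]; the
   other half of [eta] pays for the differential and the rational frame. *)
have [L hL] := ex_natinv_lt e40.
have L0 : 0 < L.+1%:R :> R by rewrite ltr0n.
have hsig i : exists k : nat, s i + eta / 2 <= k.+1%:R / L.+1%:R <= s i + eta.
  have x0 : 0 <= (s i + eta / 2) * L.+1%:R by rewrite mulr_ge0 ?(ltW L0) // addr_ge0 // divr_ge0 // ltW.
  exists (Num.truncn ((s i + eta / 2) * L.+1%:R)).
  have /andP[t1 t2] := truncn_itv x0.
  rewrite ler_pdivlMr // ler_pdivrMr // (ltW t2) /= -natr1.
  have : 1 <= eta / 4 * L.+1%:R by move: hL; rewrite -div1r ltr_pdivrMr // => /ltW.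
  move: t1; move: (_%:R) => T; lra.
have [sn hsn] := choice hsig.
pose e1 := Num.min (eta / 4) (1 / 4) / (m.+1%:R * n%:R).
have mn0 : 0 < m.+1%:R * n%:R :> R by rewrite mulr_gt0 // ltr0n.
have e10 : 0 < e1 by rewrite divr_gt0 // lt_min !divr_gt0.
have [Q hQ] := rational_matrix_close a e10.
have [d1 d10 hd1] := hs (eta / 4) e40.
have [k hk] : exists k : nat, k.+1%:R^-1 < Num.min d1 1 by apply: ex_natinv_lt; rewrite lt_min d10 ltr01.
pose j : J := (Q, [ffun i => sn i], L, k).
have sgE i : sg j i = (sn i).+1%:R / L.+1%:R by rewrite /sg /= ffunE.
exists j; last first.
  apply: le_trans (ltW heta); apply: ler_prod => i _; rewrite sgE.
  by have /andP[_ ->] := hsn i; rewrite divr_ge0.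
split=> // p' Ap' pp'.
have v1 : enorm (rsubmx p) = 1 by case: Ap.
have v'1 : enorm (rsubmx p') = 1 by case: Ap'.
have pd : enorm (p' - p) < d1 by apply: lt_trans pp' (lt_le_trans hk _); rewrite ge_min lexx.
have p1 : enorm (p' - p) < 1 by apply: lt_trans pp' (lt_le_trans hk _); rewrite ge_min lexx orbT.
set u := rsubmx p' - rsubmx p.
have uE : enorm u <= enorm (p' - p) by rewrite /u -linearB; exact: enorm_rsubmx.
have Qa i : enorm (row i (Qr j) - row i a) <= Num.min (eta / 4) (1 / 4) / m.+1%:R.
  apply: le_trans (enorm_le_coord (e := e1) _) _; first by move=> l; rewrite !mxE; exact: hQ.
  by rewrite /e1 invfM mulrC mulrA divfK // gt_eqF // ltr0n.
have dQ i : `|dot u (row i (Qr j)) - dot u (row i a)| <= enorm u * (Num.min (eta / 4) (1 / 4) / m.+1%:R).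
  rewrite -dotBr; apply: le_trans (normr_dot_le _ _) _.
  by rewrite ler_wpM2l ?enorm_ge0.
have min0 : 0 <= Num.min (eta / 4) (1 / 4) by rewrite le_min !divr_ge0 // ltW.
have mle : Num.min (eta / 4) (1 / 4) / m.+1%:R <= Num.min (eta / 4) (1 / 4).
  by rewrite ler_pdivrMr ?ltr0n // ler_peMr // ler1n.
split=> [i|].
  have h1 := hd1 _ (hull_normals_nor Ap') pd i.
  have /andP[h2 _] := hsn i; rewrite sgE.
  have h3 : enorm u * (Num.min (eta / 4) (1 / 4) / m.+1%:R) <= enorm (p' - p) * (eta / 4).
    apply: ler_pM => //; rewrite ?enorm_ge0 ?divr_ge0 //.
    by apply: le_trans mle _; rewrite ge_min lexx.
  apply: (@le_trans _ _ ((s i + eta / 2) * enorm (p' - p))); last by rewrite ler_wpM2r ?enorm_ge0.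
  have := le_trans (dQ i) h3; rewrite -/u in h1 *; move: h1; rewrite !ler_norml.
  by move=> /andP[q1 q2] /andP[q3 q4]; apply/andP; split; lra.
(* Both vectors are unit, so the component of [u] along the normal is quadratic. With [enorm u <= 1]
   the tangential coordinates carry at least half of [enorm u]; the rational frame loses a quarter,
   which leaves the factor 4. *)
have uv : dot u (rsubmx p) = - (enorm u ^+ 2 / 2).
  by rewrite /u enorm_sqrB v1 v'1 dotBl -[dot (rsubmx p) _]sqr_enorm v1 expr1n; field.
have u2 := orthonormal_rows_norm aa av v1 u.
have u1 : enorm u ^+ 2 <= 1 by rewrite expr_le1 ?enorm_ge0 // (le_trans uE) // ltW.
have ua : enorm u <= 2 * enorm (u *m a^T).
  rewrite -(@ler_pXn2r _ 2) ?nnegrE ?mulr_ge0 ?enorm_ge0 // exprMn.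
  move: u2; rewrite uv sqrrN; move: u1 (sqr_ge0 (enorm u)) (sqr_ge0 (enorm (u *m a^T))).
  move: (enorm u ^+ 2) => t t1 t0; nra.
have uQ : enorm (u *m a^T - u *m (Qr j)^T) <= enorm u / 4.
  apply: le_trans (enorm_le_coord (e := enorm u * (Num.min (eta / 4) (1 / 4) / m.+1%:R)) _) _.
    move=> i; have := dQ i; rewrite distrC => h.
    by rewrite (_ : _ 0 i = dot u (row i a) - dot u (row i (Qr j))) // -!dot_row !mxE.
  rewrite mulrCA ler_wpM2l ?enorm_ge0 //; apply: (@le_trans _ _ (Num.min (eta / 4) (1 / 4))).
    by rewrite mulrCA ler_piMr // ler_pdivrMr ?ltr0n // mul1r ler_nat.
  by rewrite ge_min mul1r lexx orbT.
have := ler_enormD (u *m (Qr j)^T) (u *m a^T - u *m (Qr j)^T).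
rewrite addrC subrK; lra.
Qed.

(** The Gauss image is the whole sphere, so the area inequality bounds the integral below by a
    multiple of the sphere's measure, which is exactly what the normalization of [curv_dir_measure]
    divides out. *)
Lemma curv_dir_measure_hull_normals :
  ((area_const^-1)%:E <= @curv_dir_measure R n X A)%E.
Proof.
pose mu := (H : set (caratheodory_type H) -> \bar R).
have mcl E : closed E -> measurable (E : set (caratheodory_type H)) by exact: closed_caratheodory.
have C0 := area_const_gt0.
(* The pieces have a countable index type; codes that decode to nothing get the empty set and weight
   1. *)
pose P k := if @unpickle J k is Some j then piece j else set0.
pose w k := if @unpickle J k is Some j then \prod_i sg j i else 1.
have mB : measurable (B : set (caratheodory_type H)).
  apply: le_caratheodory_measurable => Z.
  have Z0 : hausdorff m (Z `&` B) = 0%E.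
    by apply: hausdorff_null_subset bad_normals_null => z [].
  rewrite [X in (X + _)%E](Z0 : _ = _) add0e; apply: le_outer_measure; exact: subIsetl.
have wP k : 0 < w k.
  by rewrite /w; case: unpickle => [j|//]; apply: prodr_gt0 => i _; exact: sg0.
have fB : (@hausdorff R n m (@rsubmx R 1 n n @` B) = 0)%E.
  apply/eqP; rewrite eq_le outer_measure_ge0 andbT.
  apply: le_trans (@hausdorff_lipschitz R (n + n) n m _ B (fun v p => v = rsubmx p) 1 _ _ _) _ => //.
  - by move=> _ [p Bp <-]; exists p.
  - by move=> v v' p p' _ _ _ _ -> ->; rewrite mul1r -linearB; exact: enorm_rsubmx.
  - by rewrite bad_normals_null mule0.
have area : (@hausdorff R n m (@usphere R n) <= area_const%:E *
    \int[H : set (caratheodory_type H) -> \bar R]_(p in nor X) (\1_A p * curv_density X p)%:E)%E.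
  rewrite -hull_normals_image.
  apply: (@outer_image_le_integral R _ _ (@hausdorff R (n + n) m) (@hausdorff R n m)
    (@rsubmx R 1 n n) (nor X) A B P w (@curv_density R n X) area_const C0) => //.
  - exact/mcl/hull_normals_closed.
  - exact: hull_normals_hausdorff_fin.
  - exact: bad_normals_null.
  - exact: hull_normals_nor.
  - move=> k; rewrite /P; case: unpickle => [j|]; last exact: measurable0.
    exact/mcl/piece_closed.
  - move=> k E mE; rewrite /P /w; case: unpickle => [j|]; first exact: piece_image.
    by rewrite subset0 => ->; rewrite image_set0 !outer_measure0 mule0.
  - move=> p Ap nB; have gp : good p by apply: contrapT => ng; apply: nB.
    have [rho [M [rho0 rho4 dM]]] := gp.
    have [s [a [-> s01 _ _]]] := curvature_local Xc r0 reach near_ptP (hull_normals_nor Ap) rho0 rho4 dM (hull_normals_half Ap).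
    apply/andP; split; first by apply: prodr_ge0 => i _; case/andP: (s01 i).
    have : \prod_i s i <= \prod_(i < m) 1 by apply: ler_prod => i _; exact: s01.
    by rewrite prodr_const expr1n.
  - move=> p c Ap nB kc; have gp : good p by apply: contrapT => ng; apply: nB.
    have [j pj wj] := piece_exists Ap gp kc.
    by exists (pickle j); rewrite /P /w pickleK.
have Sfin : hausdorff m (@usphere R n) \is a fin_num.
  by rewrite ge0_fin_numE ?outer_measure_ge0 // sphere_hausdorff_fin.
have S0 : 0 < fine (hausdorff m (@usphere R n)).
  by rewrite -lte_fin fineK // sphere_hausdorff_pos.
rewrite /curv_dir_measure.
rewrite -lee_pdivrMl in area; last exact: C0.
apply: le_trans (lee_wpmul2l _ area); last by rewrite lee_fin invr_ge0 ltW.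
rewrite -(fineK Sfin) -!EFinM lee_fin /=.
by rewrite mulrCA mulVf ?mulr1 // gt_eqF.
Qed.

End Hole.

(** * Counting holes of self-similar sets *)

Section Similarities.
Context {R : realType} {n : nat}.
Implicit Types (x y u v : 'rV[R]_n) (K U V : set 'rV[R]_n).

(** Preserving norms and distances means preserving inner products, so the images of the basis
    vectors are orthonormal and determine the map. This yields that similarities are onto. *)
Lemma isometry_linear (f : 'rV[R]_n -> 'rV[R]_n) :
  (forall x y, enorm (f x - f y) = enorm (x - y)) -> f 0 = 0 ->
  exists2 M : 'M[R]_n, M *m M^T = 1%:M & forall x, f x = x *m M.
Proof.
move=> iso f0; have fN x : enorm (f x) = enorm x by have := iso x 0; rewrite f0 !subr0.
have fdot x y : dot (f x) (f y) = dot x y.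
  have h1 := enorm_sqrB (f x) (f y); have h2 := enorm_sqrB x y.
  rewrite iso !fN in h1; lra.
pose M := \matrix_i f (delta_mx 0 i).
have dotd x i : dot x (delta_mx 0 i) = x 0 i.
  rewrite /dot (bigD1 i) //= big1 ?addr0 => [|j ji]; last by rewrite mxE (negbTE ji) andbF mulr0.
  by rewrite mxE !eqxx mulr1.
have MM : M *m M^T = 1%:M.
  by apply/matrixP => i j; rewrite mulmx_trE !rowK fdot dotd !mxE eq_sym.
exists M => // x; have MTM := mulmx1C MM.
rewrite -[LHS]mulmx1 -MTM mulmxA; congr (_ *m M).
by apply/rowP => i; rewrite dot_row rowK fdot dotd.
Qed.

Lemma similarity_inverse c (S : 'rV[R]_n -> 'rV[R]_n) : 0 < c -> similarity c S ->
  exists2 S' : 'rV[R]_n -> 'rV[R]_n, forall y, S (S' y) = y & similarity c^-1 S'.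
Proof.
move=> c0 simS; pose f x := c^-1 *: (S x - S 0).
have fiso x y : enorm (f x - f y) = enorm (x - y).
  rewrite /f -scalerBr (_ : S x - S 0 - (S y - S 0) = S x - S y); last first.
    by apply/rowP => i; rewrite !mxE; ring.
  by rewrite enormZ simS gtr0_norm ?invr_gt0 // mulKf // gt_eqF.
have [|M MM fM] := isometry_linear fiso; first by rewrite /f subrr scaler0.
have SS' y : S (c^-1 *: (y - S 0) *m M^T) = y.
  have := fM (c^-1 *: (y - S 0) *m M^T); rewrite -mulmxA (mulmx1C MM) mulmx1 /f.
  have ci : c^-1 != 0 by rewrite invr_eq0 gt_eqF.
  by move=> /(scalerI ci) /(congr1 (fun z => z + S 0)); rewrite !subrK.
exists (fun y => c^-1 *: (y - S 0) *m M^T) => // y z.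
have := simS (c^-1 *: (y - S 0) *m M^T) (c^-1 *: (z - S 0) *m M^T).
by rewrite !SS' => ->; rewrite mulKf // gt_eqF.
Qed.

Lemma similarity_comp c c' (S S' : 'rV[R]_n -> 'rV[R]_n) :
  similarity c S -> similarity c' S' -> similarity (c * c') (S \o S').
Proof. by move=> h h' x y; rewrite /= h h' mulrA. Qed.
Definition hole K V := [/\ open V, exists M, forall x, V x -> enorm x <= M &
  forall y, closure V y -> V y \/ K y].

Lemma component_hole K x0 : closed K -> ~ K x0 ->
  bounded_set (connected_component (~` K) x0) ->
  hole K (connected_component (~` K) x0) /\ connected_component (~` K) x0 x0.
Proof.
move=> Kc nK bU; set U := connected_component _ _ in bU *.
have U0 : U x0 by exact: connected_component_refl.
have near y z e : 0 < e -> (forall u, enorm (u - y) < e -> ~ K u) -> enorm (z - y) < e -> U y -> U z.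
  move=> e0 ye zy Uy; apply: (connected_component_trans Uy).
  apply: (@connected_component_max _ _ [set y + t *: (z - y) | t in `[(0 : R), 1]]).
  - by exists 0; rewrite ?scale0r ?addr0 //= in_itv /= lexx ler01.
  - move=> w [t]; rewrite /= in_itv /= => /andP[t0 t1] <-; apply: ye.
    by rewrite addrDBl enormZ ger0_norm // (le_lt_trans _ zy) // ler_piMl // enorm_ge0.
  - apply: connected_continuous_connected; first exact: segment_connected.
    apply: continuous_subspaceT => t.
    by apply: cvgD; [exact: cvg_cst|apply: cvgZr_tmp; exact: cvg_id].
  - exists 1; first by rewrite /= in_itv /= lexx ler01.
    by rewrite scale1r addrC subrK.
have nbK y : ~ K y -> exists2 e, 0 < e & forall u, enorm (u - y) < e -> ~ K u.
  move=> nKy; have := proj1 (open_enormP _) (closed_openC Kc) y nKy.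
  by move=> [e e0 he]; exists e.
have UK y : U y -> ~ K y by move=> /connected_component_sub.
split=> //; split.
- apply/open_enormP => y Uy; have [e e0 he] := nbK y (UK y Uy).
  by exists e => // z zy; exact: (near y z e).
- by have [M _ hM] := bounded_enormP bU; exists M.
- move=> y /closure_enormP cy; have [Ky|nKy] := pselect (K y); [by right|left].
  have [e e0 he] := nbK y nKy.
  have e20 : 0 < e / 2 by rewrite divr_gt0.
  have [z Uz zy] := cy _ e20.
  apply: (near z y (e / 2)) => //; last by rewrite enormBC.
  move=> u uz; apply: he; rewrite (_ : u - y = (u - z) + (z - y)); last by rewrite addrA subrK.
  by apply: le_lt_trans (ler_enormD _ _) _; lra.
Qed.

Lemma hole_image K U c (S : 'rV[R]_n -> 'rV[R]_n) : closed K -> 0 < c -> similarity c S ->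
  S @` K `<=` K -> hole K U -> hole K (S @` U `\` K).
Proof.
move=> Kc c0 simS SK [Uo [M UM] Ucl]; have [S' SS' simS'] := similarity_inverse c0 simS.
have S'S x : S' (S x) = x.
  apply/eqP; rewrite -subr_eq0; apply/eqP/enorm_eq0.
  have := simS (S' (S x)) x; rewrite SS' subrr enorm0 => /esym/eqP.
  by rewrite mulf_eq0 gt_eqF //= => /eqP.
split.
- apply/open_enormP => _ [[u Uu <-] nK].
  have [e e0 he] := proj1 (open_enormP _) Uo u Uu.
  have [e' e'0 he'] := proj1 (open_enormP _) (closed_openC Kc) _ nK.
  exists (Num.min (c * e) e'); first by rewrite lt_min mulr_gt0.
  move=> z; rewrite lt_min => /andP[z1 z2]; split; last exact: he'.
  exists (S' z) => //; apply: he; rewrite -{1}(S'S u) simS' ltr_pdivrMl //.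
- exists (enorm (S 0) + c * M) => _ [[u Uu <-] _].
  rewrite -[S u](subrK (S 0)) addrC (le_trans (ler_enormD _ _)) // lerD2l simS subr0.
  by rewrite ler_pM2l // UM.
- move=> y /closure_enormP cy; have [Ky|nKy] := pselect (K y); [by right|left].
  split=> //; have [|US'|KS'] := Ucl (S' y).
  + apply/closure_enormP => e e0; have [_ [[u Uu <-] _] uy] := cy (c * e) (mulr_gt0 c0 e0).
    by exists u => //; rewrite -(S'S u) simS' ltr_pdivrMl.
  + by exists (S' y).
  + by exfalso; apply: nKy; apply: SK; exists (S' y).
Qed.

(** Follow the address of [k] and stop at the first composition whose ratio is at most [rho]. The
    last factor is at least the smallest ratio, which bounds the result below; halving that ratio
    makes the bound strict. *)
Lemma small_similarity (N : nat) (S : 'I_N -> 'rV[R]_n -> 'rV[R]_n) (r : 'I_N -> R) K :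
  (forall i, 0 < r i < 1) -> (forall i, similarity (r i) (S i)) -> self_similar_set S K ->
  exists2 a, 0 < a & forall rho k, 0 < rho <= 1 -> K k ->
    exists g t, [/\ a * rho < t <= rho, similarity t g, g @` K `<=` K & (g @` K) k].
Proof.
move=> hr hS [_ _ KE].
have KS i : S i @` K `<=` K by move=> y Sy; rewrite KE; exists i.
pose a := \big[Num.min/1]_i r i; pose b := \big[Num.max/0]_i r i.
have a0 : 0 < a by apply: lt_bigmin => // i _; case/andP: (hr i).
have ar i : a <= r i by exact: bigmin_le.
have b1 : b < 1 by apply: bigmax_lt => // i _; case/andP: (hr i).
have rb i : r i <= b by exact: le_bigmax.
have b0 : 0 <= b by exact: bigmax_ge_id.
exists (a / 2); first by rewrite divr_gt0.
move=> rho k /andP[rho0 rho1] Kk.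
have a1 : a <= 1 by exact: bigmin_le_id.
suff step j : exists g t, [/\ similarity t g, g @` K `<=` K & (g @` K) k] /\
    (a / 2 * rho < t <= rho \/ rho < t <= b ^+ j).
  have [j hj] : exists j, b ^+ j <= rho.
    have b1' : `|b| < 1 by rewrite ger0_norm.
    have /cvgrPdist_lt/(_ rho rho0)[j _ hj] := cvg_expr b1'.
    exists j; have := hj j (leqnn j).
    by rewrite sub0r normrN ger0_norm ?exprn_ge0 // => /ltW.
  have [g [t [[h1 h2 h3] [h4|/andP[h4 h5]]]]] := step j; first by exists g, t.
  by have := lt_le_trans h4 (le_trans h5 hj); rewrite ltxx.
elim: j => [|j [g [t [[h1 h2 h3] [h4|/andP[h4 h5]]]]]].
- exists id, 1; split; first by split=> [x y|y [x Kx <-] //|]; [rewrite mul1r|exists k].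
  have [->|rn] := eqVneq rho 1; [left|right].
    by rewrite mulr1 lexx andbT; lra.
  by rewrite expr0 lexx andbT lt_neqAle rn.
- by exists g, t; split=> //; left.
- move: h3 => [k' Kk' gk']; move: (Kk'); rewrite {1}KE => -[i _ [k'' Kk'' Sk'']].
  have [r0 r1] := andP (hr i).
  have t0 : 0 < t := lt_trans rho0 h4.
  exists (g \o S i), (t * r i); split.
    split; first exact: similarity_comp.
    - by move=> _ [x Kx <-]; apply: h2; exists (S i x) => //; apply: KS; exists x.
    - by exists k'' => //=; rewrite Sk''.
  have [le|gt] := leP (t * r i) rho; [left|right]; last first.
    by rewrite exprSr ler_pM // ?ltW.
  rewrite andbT; apply: (@lt_le_trans _ _ (rho * r i)); last by rewrite ler_pM2r // ltW.
  rewrite mulrC ltr_pM2l //; apply: lt_le_trans (ar i); lra.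
Qed.

End Similarities.

Section Counting.
Context {R : realType} {n : nat}.
Implicit Types (x y u v : 'rV[R]_n) (K U V : set 'rV[R]_n).

Definition covering K (e : R) k := exists A : 'I_k -> set 'rV[R]_n,
  (forall i, (ediam (A i) <= e%:E)%E) /\ K `<=` \bigcup_i A i.

Lemma covering_number_le K e k : covering K e k -> covering_number K e <= k%:R.
Proof.
by move=> h; apply: ge_inf; [exists 0 => _ [j _ <-] /= | exists k].
Qed.

Lemma covering_exists K (M e : R) : (forall x, K x -> enorm x <= M) -> 0 < e ->
  exists k, covering K e k.
Proof.
move=> KM e0; pose h := e / n.+1%:R.
have n0 : 0 < n.+1%:R :> R by rewrite ltr0n.
have h0 : 0 < h by rewrite divr_gt0.
pose M' := `|M|; have MM' : M <= M' := ler_norm M.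
pose s := (Num.truncn (M' / h)).+1.
have sM : M' / h <= s%:R by exact: ltW (truncnS_gt _).
pose T := {ffun 'I_n -> 'I_(2 * s)}.
exists #|T|, (fun k => [set x | K x /\ forall i, ((enum_val k : T) i)%:R <= (x 0 i + M') / h <= ((enum_val k : T) i).+1%:R]).
split=> [k|x Kx].
  apply/ediam_leP => x y [Kx hx] [Ky hy].
  apply: (@le_trans _ _ (n%:R * h)).
    apply: enorm_le_coord => i; rewrite !mxE.
    have /andP[x1 x2] := hx i; have /andP[y1 y2] := hy i.
    have -> : x 0 i - y 0 i = h * ((x 0 i + M') / h - (y 0 i + M') / h).
      by field; rewrite gt_eqF.
    rewrite normrM gtr0_norm // ler_piMr ?(ltW h0) //.
    move: x2 y2; rewrite -!natr1 ler_norml => x2 y2; apply/andP; split; lra.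
  by rewrite /h mulrCA ler_piMr ?(ltW e0) // ler_pdivrMr // mul1r ler_nat.
have hx i : exists j : 'I_(2 * s), j%:R <= (x 0 i + M') / h <= j.+1%:R.
  have cx := le_trans (coord_le_enorm x i) (le_trans (KM x Kx) MM').
  have [|j j2 jx] := @grid_index R ((x 0 i + M') / h) s isT; last by exists (Ordinal j2).
  rewrite ler_norml in cx; case/andP: cx => c1 c2.
  rewrite divr_ge0 ?(ltW h0) //=; last by lra.
  rewrite natrM; apply: (@le_trans _ _ (2 * (M' / h))); last by rewrite ler_pM2l.
  by rewrite mulrA ler_pM2r ?invr_gt0 //; lra.
have [f hf] := choice hx.
exists (enum_rank (finfun f : T)) => //; split=> // i; rewrite enum_rankK ffunE; exact: hf.
Qed.

Lemma separated_le_covering (T : finType) (D : {set T}) (p : T -> 'rV[R]_n) K e k :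
  covering K e k -> (forall i, i \in D -> K (p i)) ->
  (forall i j, i \in D -> j \in D -> i != j -> e < enorm (p i - p j)) -> (#|D| <= k)%N.
Proof.
move=> [A [Ad KA]] pK sep.
have [D0|[i0 i0D]] := set_0Vmem D; first by rewrite D0 cards0.
have hc i : exists c : 'I_k, i \in D -> A c (p i).
  case: (boolP (i \in D)) => [iD|_]; first by have [c _ Ac] := KA _ (pK i iD); exists c.
  by have [c _ _] := KA _ (pK i0 i0D); exists c.
have [c hc'] := choice hc.
have inj : {in D &, injective c}; last first.
  by rewrite -(card_in_imset inj) -[k in leqRHS]card_ord max_card.
move=> i j iD jD cij.
apply/eqP; apply: contraT => ij; have := sep i j iD jD ij.
have /ediam_leP/(_ (p i) (p j)) := Ad (c i).
by move=> /(_ (hc' i iD)); rewrite {1}cij => /(_ (hc' j jD)); rewrite leNgt => /negP.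
Qed.

Lemma separated_le_covering_number (T : finType) (D : {set T}) (p : T -> 'rV[R]_n) K (M e : R) :
  (forall x, K x -> enorm x <= M) -> 0 < e -> (forall i, i \in D -> K (p i)) ->
  (forall i j, i \in D -> j \in D -> i != j -> e < enorm (p i - p j)) ->
  #|D|%:R <= covering_number K e.
Proof.
move=> KM e0 pK sep; apply: lb_le_inf.
  by have [k hk] := covering_exists KM e0; exists k%:R; exists k.
by move=> _ [k hk <-]; rewrite ler_nat; exact: separated_le_covering hk pK sep.
Qed.

Lemma max_separated K (M e : R) : (forall x, K x -> enorm x <= M) -> 0 < e ->
  exists k (p : 'I_k -> 'rV[R]_n), [/\ forall i, K (p i),
    forall i j, i != j -> e < enorm (p i - p j) &
    forall x, K x -> exists i, enorm (x - p i) <= e].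
Proof.
move=> KM e0.
pose P k := `[< exists p : 'I_k -> 'rV[R]_n, (forall i, K (p i)) /\
  (forall i j, i != j -> e < enorm (p i - p j)) >].
have P0 : exists k, P k.
  exists 0%N; apply/asboolP; exists (fun=> 0); by split=> [[]|[]].
have [l hl] := covering_exists KM e0.
have Pl k : P k -> (k <= l)%N.
  move=> /asboolP[p [pK sep]].
  by have := @separated_le_covering _ [set: 'I_k] p K e l hl; rewrite cardsT card_ord; apply => // i j _ _; exact: sep.
have [k /asboolP[p [pK sep]] kmax] := ex_maxnP P0 Pl.
exists k, p; split=> // x Kx; apply: contrapT => nx.
have far i : e < enorm (x - p i) by rewrite ltNge; apply/negP => h; apply: nx; exists i.
have /kmax : P k.+1; last by rewrite ltnn.
apply/asboolP; exists (fun i => if unlift ord_max i is Some j then p j else x); split.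
  by move=> i; case: unliftP.
move=> i j; case: (unliftP ord_max i) => [i' ->|->]; case: (unliftP ord_max j) => [j' ->|->].
- by rewrite (inj_eq lift_inj); exact: sep.
- by rewrite enormBC.
- by [].
- by rewrite eqxx.
Qed.

(* A ball filled by the e-neighbourhood of [K] contains a grid whose nearest
   points in [K] are e-separated. *)
Lemma filled_ball_separated K z (eta e : R) L : closed K -> K !=set0 -> 0 < e ->
  n%:R * (4 * e * L%:R) <= eta ->
  (forall y, enorm (y - z) <= eta -> infdist y K <= e) ->
  exists q : {ffun 'I_n -> 'I_L.+1} -> 'rV[R]_n, forall f,
    [/\ K (q f), enorm (q f - z) <= eta + e & forall g, f != g -> e < enorm (q f - q g)].
Proof.
move=> Kc K0 e0 Leta fill.
have e40 : 0 < 4 * e by rewrite mulr_gt0.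
(* Spacing [4 * e] survives the passage to nearest points, each of which moves by at most [e]. *)
pose y (f : {ffun 'I_n -> 'I_L.+1}) : 'rV[R]_n := z + \row_i (4 * e * (f i)%:R).
have yz f : enorm (y f - z) <= eta.
  rewrite addrDBl; apply: le_trans (enorm_le_coord (e := 4 * e * L%:R) _) Leta => i.
  rewrite mxE ger0_norm ?mulr_ge0 ?(ltW e0) // ler_pM2l // ler_nat.
  by rewrite -ltnS.
have hq f : exists q, K q /\ enorm (y f - q) <= e.
  by have [q Kq qy] := infdist_attained (y f) Kc K0; exists q; rewrite qy; split=> //; exact: fill.
have [q qP] := choice hq; exists q => f; have [Kq qf] := qP f; split=> //.
  rewrite (_ : q f - z = (y f - z) - (y f - q f)); last by apply/rowP => i; rewrite !mxE; ring.
  by apply: le_trans (ler_enormB _ _) _; rewrite lerD.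
move=> g fg; have [_ qg] := qP g.
have [i fgi] : exists i, f i != g i.
  by apply/existsP; rewrite -negb_forall; apply: contra fg => /forallP h; apply/eqP/ffunP => i; apply/eqP.
have yy : 4 * e <= enorm (y f - y g).
  apply: le_trans (coord_le_enorm _ i); rewrite !mxE.
  rewrite (_ : _ - _ = 4 * e * ((f i)%:R - (g i)%:R)); last by ring.
  rewrite normrM gtr0_norm // ler_peMr ?(ltW e40) //.
  have fg' : (f i : nat) != g i by rewrite val_eqE.
  have [lt|] := leqP (f i).+1 (g i).
    rewrite distrC ger0_norm ?subr_ge0 ?ler_nat ?(ltnW lt) //.
    by rewrite lerBrDl natr1 ler_nat.
  rewrite ltnS leq_eqVlt eq_sym (negbTE fg') /= => gt.
  rewrite ger0_norm ?subr_ge0 ?ler_nat ?(ltnW gt) //.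
  by rewrite lerBrDl natr1 ler_nat.
have : enorm (y f - y g) <= enorm (q f - q g) + 2 * e.
  rewrite (_ : y f - y g = (q f - q g) + ((y f - q f) - (y g - q g))); last first.
    by apply/rowP => j; rewrite !mxE; ring.
  apply: le_trans (ler_enormD _ _) _; rewrite lerD2l (le_trans (ler_enormB _ _)) //; lra.
lra.
Qed.

(** Cells centred on a maximal [sigma * rho]-separated subset of [K] are at least as many as
    [covering_number K (2 * sigma * rho)]. A bad cell, whose image of [U] is filled, contains a ball
    filled by the [e]-neighbourhood, hence [L.+1 ^ n] points of [K] that are [e]-separated, also
    from those of other cells; so [covering_number K e] limits the bad cells. *)
Lemma hole_count (N : nat) (S : 'I_N -> 'rV[R]_n -> 'rV[R]_n) (r : 'I_N -> R) K U u0 :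
  (forall i, 0 < r i < 1) -> (forall i, similarity (r i) (S i)) -> self_similar_set S K ->
  hole K U -> U u0 ->
  exists C B : R, [/\ 0 < C, 0 < B & forall rho e, 0 < rho <= 1 -> 0 < e <= rho ->
    exists k (V : 'I_k -> set 'rV[R]_n), [/\ forall i, hole K (V i),
      forall i, exists2 y, V i y & e < infdist y K, trivIset setT V &
      covering_number K (C * rho) <= k%:R + covering_number K e * (B * (e / rho)) ^+ n]].
Proof.
move=> hr hS hK hU Uu0; have [K0 Kcomp _] := hK.
have Kc : closed K by exact: compact_closed Kcomp.
have [MK MK0 KMK] := compact_enorm_bounded Kcomp.
have [Uo [MU UMU] Ucl] := hU.
have [eta eta0 heta] := proj1 (open_enormP _) Uo u0 Uu0.
have [a a0 ha] := small_similarity hr hS hK.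
pose M := MK + `|MU|; have M0 : 0 < M by rewrite ltr_wpDr.
have KM x : K x -> enorm x <= M by move=> /KMK h; rewrite (le_trans h) // lerDl.
have UM x : U x -> enorm x <= M.
  by move=> /UMU h; rewrite (le_trans h) // (le_trans (ler_norm _)) // lerDr ltW.

(* Images of [K] and [U] under a similarity of ratio at most [rho] lie within
   [2 * M * rho] of each other, hence the separation constant. *)
pose sigma := 4 * M + 2 * eta + 4.
have sigma0 : 0 < sigma by rewrite /sigma; lra.
have n0 : 0 < n.+1%:R :> R by rewrite ltr0n.
(* The grid size [L.+1] will exceed the inverse of [B * (e / rho)], the number of steps [4 * e] that
   fit in a ball of radius [eta * a * rho]. *)
pose B := 4 * n.+1%:R / (eta * a).
have B0 : 0 < B by rewrite divr_gt0 ?mulr_gt0.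
exists (2 * sigma), B; split=> // [|rho e /andP[rho0 rho1] /andP[e0 erho]].
  by rewrite mulr_gt0.
have sr0 : 0 < sigma * rho by rewrite mulr_gt0.
have [k [p [pK psep pcov]]] := max_separated KM sr0.
have hg i : exists gt : ('rV[R]_n -> 'rV[R]_n) * R, [/\ a * rho < gt.2 <= rho, similarity gt.2 gt.1, gt.1 @` K `<=` K & (gt.1 @` K) (p i)].
  by have [g [t h]] := ha rho (p i) (introT andP (conj rho0 rho1)) (pK i); exists (g, t).
have [gt gtP] := choice hg.
pose g i := (gt i).1; pose t i := (gt i).2.
have t0 i : 0 < t i by have [/andP[h _] _ _ _] := gtP i; apply: lt_trans h; rewrite mulr_gt0.
pose W i := g i @` U `\` K.
have hW i : hole K (W i) by have [_ h2 h3 _] := gtP i; apply: (hole_image Kc (t0 i) h2 h3).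
have gp i u : U u -> enorm (g i u - p i) <= 2 * M * rho.
  move=> Uu; have [/andP[_ tr] h2 _ [x Kx <-]] := gtP i; rewrite h2.
  rewrite mulrC; apply: ler_pM; rewrite ?enorm_ge0 ?(ltW (t0 i)) //.
  by apply: le_trans (ler_enormB _ _) _; have := UM u Uu; have := KM x Kx; lra.
(* Serves twice: [d = 0] separates the images of [U], and [d = eta * a * rho + e] separates the grid
   points found in two bad cells. *)
have far i j x y d : i != j -> enorm (x - p i) <= 2 * M * rho + d -> enorm (y - p j) <= 2 * M * rho + d ->
    2 * d <= 2 * eta * rho + 2 * rho -> rho < enorm (x - y).
  move=> ij xi yj dr; have := psep i j ij.
  rewrite (_ : p i - p j = (x - y) - ((x - p i) - (y - p j))); last by apply/rowP => l; rewrite !mxE; ring.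
  have := ler_enormB (x - y) ((x - p i) - (y - p j)); have := ler_enormB (x - p i) (y - p j).
  rewrite /sigma !mulrDl; lra.
have Wdisj i j x : W i x -> W j x -> i = j.
  move=> [[u Uu ux] _] [[u' Uu' ux'] _]; apply/eqP; apply: contraT => ij.
  have := far i j x x 0 ij; rewrite subrr enorm0 !addr0 mulr0 -{1}ux -{1}ux'.
  move=> /(_ (gp i u Uu) (gp j u' Uu')); rewrite ltNge (ltW rho0) => h; apply: h.
  by rewrite addr_ge0 // !mulr_ge0 // ltW.
pose good i := `[< exists2 y, W i y & e < infdist y K >].
pose bad : {set 'I_k} := finset (fun i => ~~ good i).
pose L := Num.truncn (eta * a * rho / (4 * n.+1%:R * e)).
have c40 : 0 < 4 * n.+1%:R * e by rewrite !mulr_gt0.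
have q0 : 0 <= eta * a * rho / (4 * n.+1%:R * e) by rewrite divr_ge0 ?(ltW c40) // !mulr_ge0 // ltW.
have [L1 L2] := andP (truncn_itv q0).
have Leta : n%:R * (4 * e * L%:R) <= eta * a * rho.
  rewrite -/L ler_pdivlMr // in L1; apply: le_trans L1.
  rewrite (_ : L%:R * _ = n.+1%:R * (4 * e * L%:R)); last by ring.
  by rewrite ler_wpM2r ?ler_nat // !mulr_ge0 // ltW.
have LB : 1 <= L.+1%:R * (B * (e / rho)).
  have -> : L.+1%:R * (B * (e / rho)) = L.+1%:R / (eta * a * rho / (4 * n.+1%:R * e)).
    by rewrite /B; field; rewrite !gt_eqF.
  by rewrite ler_pdivlMr ?mul1r ?(ltW L2) // divr_gt0 // !mulr_gt0.
have a1 : a <= 1.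
  have [x Kx] := K0; have [|g' [t' [/andP[h1 h2] _ _ _]]] := ha 1 x _ Kx; first by rewrite ltr01 lexx.
  by rewrite mulr1 in h1; exact: le_trans (ltW h1) h2.
have hq i : exists q : {ffun 'I_n -> 'I_L.+1} -> 'rV[R]_n, i \in bad -> forall f,
    [/\ K (q f), enorm (q f - g i u0) <= eta * a * rho + e & forall h, f != h -> e < enorm (q f - q h)].
  case: (boolP (i \in bad)) => [|_]; last by exists (fun=> 0).
  rewrite inE => /asboolP nG.
  have [|q qP] := filled_ball_separated Kc K0 e0 Leta (z := g i u0); last by exists q.
  move=> y yg; have [Ky|nKy] := pselect (K y); first by rewrite infdist0 // ltW.
  rewrite leNgt; apply/negP => ye; apply: nG; exists y => //; split=> //.
  have [/andP[h1 _] h2 _ _] := gtP i.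
  have [S' SS' simS'] := similarity_inverse (t0 i) h2.
  exists (S' y); last exact: SS'.
  apply: heta; rewrite -(ltr_pM2l (t0 i)) -h2 SS'; apply: le_lt_trans yg _.
  by rewrite -mulrA mulrC ltr_pM2r.
have [q qP] := choice hq.
have cardbad : #|bad|%:R <= covering_number K e * (B * (e / rho)) ^+ n.
  have := @separated_le_covering_number _ (finset.setX bad [set: {ffun 'I_n -> 'I_L.+1}]%SET)
    (fun ij => q ij.1 ij.2) K MK e KMK e0.
  rewrite cardsX cardsT card_ffun !card_ord natrM natrX => sepN.
  have Bn : 0 <= (B * (e / rho)) ^+ n by apply/exprn_ge0/mulr_ge0; [exact: ltW|rewrite divr_ge0 // ltW].
  apply: (@le_trans _ _ (#|bad|%:R * L.+1%:R ^+ n * (B * (e / rho)) ^+ n)).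
    by rewrite -mulrA -exprMn ler_peMr // exprn_ege1.
  rewrite ler_wpM2r //; apply: sepN => [[i f]|[i f] [j h]]; rewrite !finset.inE /= !andbT.
    by move=> ib; have [] := qP i (_ : i \in bad) f; rewrite ?finset.inE.
  move=> ib jb; have ib' : i \in bad by rewrite finset.inE.
  have jb' : j \in bad by rewrite finset.inE.
  have [_ di sepi] := qP i ib' f; have [_ dj _] := qP j jb' h.
  have [eij|ij] := eqVneq i j.
    rewrite -eij xpair_eqE eqxx /=; exact: sepi.
  move=> _; apply: (le_lt_trans erho); apply: (far i j _ _ (eta * a * rho + e)) => //.
  - rewrite (_ : q i f - p i = (q i f - g i u0) + (g i u0 - p i)); last by rewrite addrA subrK.
    by rewrite (le_trans (ler_enormD _ _)) // addrC lerD // gp.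
  - rewrite (_ : q j h - p j = (q j h - g j u0) + (g j u0 - p j)); last by rewrite addrA subrK.
    by rewrite (le_trans (ler_enormD _ _)) // addrC lerD // gp.
  - have : eta * a * rho <= eta * rho by rewrite ler_pM2r // ler_piMr // ltW.
    lra.
pose G : {set 'I_k} := finset good.
exists #|G|, (fun j => W (enum_val j)); split.
- by move=> j; exact: hW.
- by move=> j; have := enum_valP j; rewrite finset.inE => /asboolP.
- by move=> i j _ _ [x [Wi Wj]]; apply: enum_val_inj; exact: Wdisj Wi Wj.
have cov : covering K (2 * sigma * rho) k.
  exists (fun i => [set x | enorm (x - p i) <= sigma * rho]); split=> [i|x Kx].
    apply/ediam_leP => x y hx hy.
    rewrite (_ : x - y = (x - p i) - (y - p i)); last by apply/rowP => l; rewrite !mxE; ring.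
    by apply: le_trans (ler_enormB _ _) _; rewrite /= in hx hy; lra.
  by have [i hi] := pcov x Kx; exists i.
apply: le_trans (covering_number_le cov) _.
have -> : k%:R = #|G|%:R + #|bad|%:R :> R.
  rewrite -natrD; congr _%:R; rewrite -{1}(card_ord k) -(cardC (mem G)); congr addn.
  by apply: eq_card => i; rewrite !inE.
by rewrite lerD2l.
Qed.

End Counting.

Lemma near_at_right0 (R : realType) (P : R -> Prop) : (\forall x \near 0^'+, P x) ->
  exists2 d : R, 0 < d & forall x, 0 < x < d -> P x.
Proof.
move=> [d /= d0 hd]; exists d => // x /andP[x0 xd]; apply: hd => //=.
by rewrite sub0r normrN gtr0_norm.
Qed.

(** * Exponents and the number of holes *)

Section Asymptotics.
Context {R : realType} {n : nat}.

(** Choose [rho] with e = rho^(1 + zeta). There are about rho^(-D) cells; the filled ones number at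
    most about rho^(-D (1 + zeta) + zeta n), a smaller power because D < n; and the target e^(-s) is
    rho^(-s (1 + zeta)), also smaller when [zeta] is small since s < D. *)
Lemma many_holes (N : nat) (S : 'I_N -> 'rV[R]_n -> 'rV[R]_n) (r : 'I_N -> R) K x0 (D s : R) :
  (forall i, 0 < r i < 1) -> (forall i, similarity (r i) (S i)) -> self_similar_set S K ->
  ~ K x0 -> bounded_set (connected_component (~` K) x0) ->
  (fun delta : R => ln (covering_number K delta) / - ln delta) @ 0^'+ --> D ->
  0 <= s -> s < D -> D < n%:R ->
  exists2 e0 : R, 0 < e0 & forall e, 0 < e < e0 -> exists k (V : 'I_k -> set 'rV[R]_n),
    [/\ forall i, hole K (V i), forall i, exists2 y, V i y & e < infdist y K,
       trivIset setT V & e `^ (- s) <= k%:R].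
Proof.
move=> hr hS hK nK bU cvgD s0 sD Dn; have [_ Kcomp _] := hK.
have [hU Ux0] := component_hole (compact_closed (@norm_hausdorff _ _) Kcomp) nK bU.
have [C [B [C0 B0 hcount]]] := hole_count hr hS hK hU Ux0.
pose zeta := (D - s) / (2 * (s + 1)).
have zeta0 : 0 < zeta by rewrite divr_gt0 ?subr_gt0 // mulr_gt0 // ltr_wpDl.
have z1 : s * zeta <= (D - s) / 2.
  rewrite /zeta mulrA ler_pdivrMr ?mulr_gt0 ?ltr_wpDl //; lra.
clearbody zeta.
pose d0 := Num.min ((D - s) / 4) (zeta * (n%:R - D) / (2 * (2 + zeta))).
have d00 : 0 < d0 by rewrite lt_min !divr_gt0 ?mulr_gt0 ?subr_gt0 // addr_gt0.
have d1 : d0 <= (D - s) / 4 by rewrite ge_min lexx.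
have d2 : d0 * (2 * (2 + zeta)) <= zeta * (n%:R - D).
  by rewrite -ler_pdivlMr ?mulr_gt0 ?addr_gt0 // ge_min lexx orbT.
clearbody d0.
(* Exponents of 1/rho for all cells, filled cells and the target; [d0] is the slack left by the
   limit defining the dimension. *)
pose al := D - d0; pose be := (D + d0) * (1 + zeta) - zeta * n%:R; pose ga := s * (1 + zeta).
have alga : 0 < al - ga by rewrite /al /ga; lra.
have albe : 0 < al - be.
  by rewrite /al /be; have := mulr_gt0 d00 zeta0; lra.
have al0 : 0 < al by rewrite /al; lra.
have /cvgrPdist_lt/(_ d0 d00)/near_at_right0[dl dl0 hdl] := cvgD.
have cn delta : 0 < delta < Num.min dl 1 ->
    [/\ 0 < covering_number K delta, expR (al * - ln delta) <= covering_number K delta &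
     covering_number K delta <= expR ((D + d0) * - ln delta)].
  move=> /andP[de0]; rewrite lt_min => /andP[ded de1].
  have L0 : 0 < - ln delta by rewrite oppr_gt0 ln_lt0 // de0.
  have := hdl delta; rewrite de0 ded => /(_ isT); rewrite ltr_norml => /andP[h1 h2].
  have {}h1 : ln (covering_number K delta) < (D + d0) * - ln delta.
    by rewrite -ltr_pdivrMr //; lra.
  have {}h2 : al * - ln delta < ln (covering_number K delta).
    by rewrite -ltr_pdivlMr // /al; lra.
  have N0 : 0 < covering_number K delta.
    rewrite ltNge; apply/negP => /ln0 l0; move: h2; rewrite l0.
    by have := mulr_gt0 al0 L0; lra.
  by split=> //; rewrite -[covering_number K delta]lnK ?posrE // ler_expR ltW.
have z10 : 0 < 1 + zeta by rewrite addr_gt0.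
pose A := expR (- (al * ln C)).
have A0 : 0 < A by exact: expR_gt0.
have Bn0 : 0 < B ^+ n by rewrite exprn_gt0.
(* Past this threshold both scales fall below [Num.min dl 1], and filled cells and target each take
   at most half of the main term [A * expR (al * t)]. *)
pose T := `|ln (Num.min dl 1 / C)| + `|ln (Num.min dl 1)| + 2 * B ^+ n / (A * (al - be)) + 2 / (A * (al - ga)).
have m0 : 0 < Num.min dl 1 by rewrite lt_min dl0 ltr01.
have T0 : 0 <= T by rewrite !addr_ge0 // divr_ge0 ?mulr_ge0 // ltW.
exists (expR (- ((1 + zeta) * (T + 1)))); first exact: expR_gt0.
move=> e /andP[e0 eT].
pose t := - ln e / (1 + zeta).
have tE : (1 + zeta) * t = - ln e by rewrite mulrC divfK // gt_eqF.
have tT : T < t.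
  rewrite ltr_pdivlMr // ltrNr -ltr_expR lnK ?posrE //; apply: lt_trans eT _.
  by rewrite ltr_expR ltrN2 mulrC ltr_pM2l // ltrDl.
have t0 : 0 < t by exact: le_lt_trans T0 tT.
pose rho := expR (- t).
have rho0 : 0 < rho by exact: expR_gt0.
have rho1 : rho <= 1 by rewrite -expR0 ler_expR oppr_le0 ltW.
have eE : e = expR (- ((1 + zeta) * t)) by rewrite tE opprK lnK.
have erho : e / rho = expR (- (zeta * t)).
  by rewrite eE /rho -expRN -expRD; congr expR; ring.
have er : e <= rho by rewrite eE ler_expR lerN2 mulrDl mul1r lerDl mulr_ge0 // ltW.
have [||k [V [V1 V2 V3 V4]]] := hcount rho e; rewrite ?rho0 ?rho1 ?e0 ?er //.
exists k, V; split=> //.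
have h1 : 0 <= 2 * B ^+ n / (A * (al - be)) by rewrite divr_ge0 ?mulr_ge0 // ltW.
have h2 : 0 <= 2 / (A * (al - ga)) by rewrite divr_ge0 ?mulr_ge0 // ltW.
have cC : 0 < C * rho < Num.min dl 1.
  rewrite mulr_gt0 //= mulrC -ltr_pdivlMr //.
  rewrite /rho -[ltRHS]lnK ?posrE ?divr_gt0 // ltr_expR ltrNl.
  apply: le_lt_trans (ler_norm _) _; rewrite normrN.
  by move: tT h1 h2 (normr_ge0 (ln (Num.min dl 1))); rewrite /T; lra.
have ce : 0 < e < Num.min dl 1.
  rewrite e0 /= -[ltRHS]lnK ?posrE // eE ltr_expR ltrNl.
  apply: (@lt_trans _ _ t); last by rewrite mulrDl mul1r ltrDl mulr_gt0.
  apply: le_lt_trans (ler_norm _) _; rewrite normrN.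
  by move: tT h1 h2 (normr_ge0 (ln (Num.min dl 1 / C))); rewrite /T; lra.
have [_ c1 _] := cn _ cC; have [_ _ c2] := cn _ ce.
(* By [1 + x <= expR x], a lower bound linear in [t] absorbs the constant [c] into the gap of
   exponents. *)
have big g c : 0 < al - g -> 0 < c -> c / (A * (al - g)) < t -> c * expR (g * t) <= A * expR (al * t).
  move=> ag c0; rewrite ltr_pdivrMr ?mulr_gt0 // => h.
  have -> : al * t = (al - g) * t + g * t by ring.
  rewrite expRD mulrA ler_pM2r ?expR_gt0 //.
  apply: le_trans (ltW h) _; rewrite mulrCA ler_pM2l // mulrC.
  by apply: le_trans (expR_ge1Dx _); rewrite lerDr.
have b1 := big be (2 * B ^+ n) albe _ _.
have {}b1 : 2 * B ^+ n * expR (be * t) <= A * expR (al * t).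
  apply: b1; first by rewrite mulr_gt0.
  by move: tT h2 (normr_ge0 (ln (Num.min dl 1 / C))) (normr_ge0 (ln (Num.min dl 1))); rewrite /T; lra.
have b2 : 2 * expR (ga * t) <= A * expR (al * t).
  apply: big => //.
  by move: tT h1 (normr_ge0 (ln (Num.min dl 1 / C))) (normr_ge0 (ln (Num.min dl 1))); rewrite /T; lra.
have c1E : expR (al * - ln (C * rho)) = A * expR (al * t).
  by rewrite lnM ?posrE // /rho expRK /A -expRD; congr expR; ring.
have c2E : expR ((D + d0) * - ln e) * (B * (e / rho)) ^+ n = B ^+ n * expR (be * t).
  rewrite -tE erho exprMn mulrCA -expRM_natr -expRD; congr (_ * expR _).
  by rewrite /be; ring.
have sE : e `^ (- s) = expR (ga * t).
  by rewrite /powR gt_eqF // /ga -mulrA tE mulNr mulrN.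
rewrite c1E in c1.
have c3 : covering_number K e * (B * (e / rho)) ^+ n <= B ^+ n * expR (be * t).
  by rewrite -c2E ler_wpM2r // exprn_ge0 // mulr_ge0 ?divr_ge0 // ltW.
rewrite sE; lra.
Qed.

End Asymptotics.

(** * Curvature of parallel sets *)

Section HolesOfParallelSets.
Context {R : realType} {m : nat}.
Let n := m.+1.
Implicit Types (x y : 'rV[R]_n) (K : set 'rV[R]_n).

Lemma reflect_normalK : involutive (@reflect_normal R n).
Proof. by move=> p; rewrite /reflect_normal row_mxKl row_mxKr opprK hsubmxK. Qed.
Lemma closed_borel k (A : set 'rV[R]_k) : closed A -> <<s open >> A.
Proof.
move=> Ac; have := @measurableC _ (g_sigma_algebraType (@open 'rV[R]_k)) (~` A).
rewrite setCK; apply; apply: sub_sigma_algebra; exact: closed_openC.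
Qed.

Lemma enorm_reflect (p q : 'rV[R]_(n + n)) :
  enorm (reflect_normal p - reflect_normal q) = enorm (p - q).
Proof.
apply/eqP; rewrite -(@eqrXn2 _ 2) ?enorm_ge0 //.
rewrite -[in X in _ == X](hsubmxK p) -[in X in _ == X](hsubmxK q) /reflect_normal !row_mxB !sqr_enorm_row_mx.
by rewrite -opprD enormN.
Qed.

Lemma closed_reflect (A : set 'rV[R]_(n + n)) : closed A -> closed (@reflect_normal R n @` A).
Proof.
move=> Ac; apply/closed_enormP => p hp; exists (reflect_normal p); last exact: reflect_normalK.
apply: (proj1 (closed_enormP _) Ac) => e e0; have [_ [q Aq <-] qp] := hp e e0; exists q => //.
by rewrite -enorm_reflect reflect_normalK.
Qed.

Lemma direction_bundle_closed : closed (@direction_bundle R n).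
Proof.
apply/closed_enormP => p hp; apply/eqP; rewrite -subr_eq0 -normr_le0.
apply/ler_addgt0Pr => e e0; rewrite add0r; have [q q1 qp] := hp e e0.
rewrite -{1}(q1 : enorm (rsubmx q) = 1); apply: le_trans (ler_dist_enorm _ _) _.
by rewrite -linearB (le_trans (enorm_rsubmx _)) // enormBC ltW.
Qed.

(** Test the variation on a partition of the direction bundle: the reflected hull normals of each
    hole, disjoint since the holes are, and the rest. Reflection cancels the one in
    [parallel_curv_measure], and the absolute value removes the sign. *)
Lemma curv_variation_ge K e k (V : 'I_k -> set 'rV[R]_n) : 0 < e -> closed K ->
  positive_reach (closed_complement K e) -> (forall i, hole K (V i)) ->
  (forall i, exists2 y, V i y & e < infdist y K) -> trivIset setT V ->
  ((k%:R / @area_const R m)%:E <= curv_variation K e)%E.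
Proof.
move=> e0 Kc [Xc [r r0 reach]] hV deep tV.
set X := closed_complement K e in Xc reach.
have [near_pt near_ptP] := near_pt_exists Xc r0 reach.
(* [X] stays at distance [e] from [K], so it avoids the boundary of each hole; this makes [Y i]
   closed. *)
have Xfar x : X x -> e <= infdist x K.
  move=> /closure_enormP Xx; apply/ler_addgt0Pr => d d0; have [y ny yx] := Xx d d0.
  have : e < infdist y K by rewrite ltNge; apply/negP.
  have := infdist_lip y x K; rewrite ler_norml => /andP[_]; lra.
pose Y i := X `&` V i.
have Ycomp i : compact (Y i).
  have [_ [M VM] Vcl] := hV i.
  apply: (@bounded_enorm_compact _ _ _ M) => [x [_ /VM]//|].
  apply/closed_enormP => x hx.
  have Xx : X x by apply: (proj1 (closed_enormP _) Xc) => d /hx[y [Xy _] yx]; exists y.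
  split=> //; have [|//|Kx] := Vcl x.
    by apply/closure_enormP => d /hx[y [_ Vy] yx]; exists y.
  by have := Xfar x Xx; rewrite infdist0 // leNgt e0.
have Y0 i : Y i !=set0.
  have [y Vy ye] := deep i; exists y; split=> //; apply: subset_closure.
  by move=> /=; rewrite /parallel_set /= leNgt ye.
have Yopen i x : Y i x -> exists2 d, 0 < d & forall y, X y -> enorm (y - x) < d -> Y i y.
  move=> [Xx Vx]; have [Vo _ _] := hV i; have [d d0 hd] := proj1 (open_enormP _) Vo x Vx.
  by exists d => // y Xy yx; split=> //; exact: hd.
pose A i := @hull_normals R m (Y i).
have Abig i : ((@area_const R m)^-1%:E <= @curv_dir_measure R n X (A i))%E.
  apply: (curv_dir_measure_hull_normals Xc r0 reach near_ptP (Ycomp i) (Y0 i)) => //.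
    by move=> x [].
  exact: Yopen.
have Adir i p : A i p -> direction_bundle p by move=> [].
pose F i := @reflect_normal R n @` A i.
have Fclosed i : closed (F i).
  by apply: closed_reflect; apply: hull_normals_closed; exact: Ycomp.
have Fdir i p : F i p -> direction_bundle p.
  move=> [q /Adir q1 <-]; rewrite /direction_bundle /= /reflect_normal row_mxKr.
  by rewrite /usphere /= enormN.
have Fdisj i j p : F i p -> F j p -> i = j.
  move=> [q [[_ Vq] _ _] <-] [q' [[_ Vq'] _ _] qq'].
  have {}qq' : q' = q by rewrite -(reflect_normalK q') qq' reflect_normalK.
  by apply: (tV i j) => //; exists (lsubmx q); split=> //; rewrite -qq'.
pose rest := direction_bundle `\` \bigcup_i F i.
have mF i : <<s open >> (F i) by apply: closed_borel; exact: Fclosed.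
have mrest : <<s open >> rest.
  have := @measurableD _ (g_sigma_algebraType (@open 'rV[R]_(n + n))) direction_bundle (\bigcup_i F i).
  apply; first by apply: closed_borel; exact: direction_bundle_closed.
  have -> : \bigcup_i F i = \bigcup_(i in [set` enum 'I_k]) F i.
    by apply/seteqP; split=> x [i _ Fx]; exists i => //=; rewrite mem_enum.
  by rewrite bigcup_seq; apply: bigsetU_measurable => i _; exact: mF.
pose beta (j : 'I_k.+1) := if unlift ord_max j is Some i then F i else rest.
have betaF i : beta (lift ord_max i) = F i by rewrite /beta liftK.
apply: (@le_trans _ _ (\sum_(j < k.+1) `|parallel_curv_measure K e (beta j)|)%E); last first.
  apply: ereal_sup_ubound; exists k.+1, beta; split=> //.
  - by move=> j; rewrite /beta; case: unliftP.
  - move=> i j _ _ [p []]; rewrite /beta.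
    case: (unliftP ord_max i) => [i' ->|->]; case: (unliftP ord_max j) => [j' ->|->] //.
    + by move=> Fi Fj; rewrite (Fdisj _ _ _ Fi Fj).
    + by move=> Fi [_ nF]; exfalso; apply: nF; exists i'.
    + by move=> [_ nF] Fi; exfalso; apply: nF; exists j'.
  - apply/seteqP; split=> p.
      by move=> [j _]; rewrite /beta; case: unliftP => [i _ /Fdir|_ []].
    move=> dp; have [[i _ Fi]|nF] := pselect ((\bigcup_i F i) p).
      by exists (lift ord_max i) => //; rewrite betaF.
    by exists ord_max => //; rewrite /beta unlift_none.
rewrite (bigD1_ord ord_max) //=; apply: (@le_trans _ _ (\sum_(i < k) (@area_const R m)^-1%:E)%E).
  by rewrite sumEFin sumr_const card_ord mulr_natl.
rewrite -[leLHS]add0e; apply: leeD; first exact: abse_ge0.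
apply: lee_sum => i _; rewrite betaF /parallel_curv_measure.
rewrite (_ : reflect_normal @` F i = A i); last first.
  apply/seteqP; split=> [_ [_ [q Aq <-] <-]|q Aq]; first by rewrite reflect_normalK.
  by exists (reflect_normal q); [exists q|exact: reflect_normalK].
apply: le_trans (Abig i) _; rewrite abseM /= normrX normrN1 expr1n mul1e.
exact: lee_abs.
Qed.

End HolesOfParallelSets.

Theorem theorem5p3 (R : realType) (d N : nat) (hd : (0 < d)%N)
    (hN : (2 <= N)%N) (S : 'I_N -> 'rV[R]_d -> 'rV[R]_d) (r : 'I_N -> R)
    (hr : forall i, 0 < r i < 1) (hS : forall i, similarity (r i) (S i))
    (K : set 'rV[R]_d) (hK : self_similar_set S K)
    (hreg : regular_set K) (hOSC : open_set_condition S)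
    (hdim : minkowski_dim K < d%:R)
    (hbdd : exists2 x, ~ K x & bounded_set (connected_component (~` K) x)) :
  ((minkowski_dim K)%:E <= scaling_exponent K)%E.
Proof.
have [_ Kcomp _] := hK.
have Kc : closed K by exact: compact_closed Kcomp.
apply: le_ereal_inf_tmp => _ [s [s0 [E negE cvg0]] <-]; rewrite lee_fin leNgt; apply/negP => sD.
(* Without convergence [lim] takes its default value 0, which is incompatible with [0 <= s] and [s]
   below the dimension. *)
have cvgD : (fun delta : R => ln (covering_number K delta) / - ln delta) @ 0^'+ --> minkowski_dim K.
  apply: contrapT => nc; move: sD; apply/negP; rewrite -leNgt.
  rewrite /minkowski_dim (_ : lim _ = 0) //.
  by rewrite /lim /lim_in /= xgetPN // => l hl; apply: nc; exact: (cvgP _ hl).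
have [x nKx bU] := hbdd.
have [e0 e00 holes] := many_holes hr hS hK nKx bU cvgD s0 sD hdim.
destruct d as [|m]; first by [].
pose c := (@area_const R m)^-1; have c0 : 0 < c by rewrite invr_gt0 area_const_gt0.
have [e1 e10 small] : exists2 e1 : R, 0 < e1 & forall e, 0 < e < e1 -> ~ E e ->
    ((e `^ s)%:E * curv_variation K e < c%:E)%E.
  have nc : nbhs (0%E : \bar R) [set y | (y < c%:E)%E].
    by apply: open_ereal_lt'; rewrite lte_fin.
  have := cvg0 _ nc => /near_at_right0[e1 e10 h]; exists e1 => // e ee nE; exact: h.
pose dl := Num.min e0 e1; have dl0 : 0 < dl by rewrite lt_min e00.
have [e [/andP[ep ed] nE re]] : exists e, [/\ 0 < e < dl, ~ E e & regular_value K e].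
  apply: contrapT => ne.
  have sub : `]0, dl[%classic `<=` E `|` ~` [set e | 0 < e -> regular_value K e].
    move=> e; rewrite /= in_itv /= => ee; have [Ee|nE] := pselect (E e); [by left|right => re].
    by apply: ne; exists e; split=> //; apply: re; case/andP: ee.
  have := @negligibleS _ _ _ (@lebesgue_measure R) _ _ sub (negligibleU negE hreg).
  move=> [Z [mZ Z0 sZ]].
  have : (@lebesgue_measure R `]0%R, dl[%classic <= @lebesgue_measure R Z)%E.
    by apply: le_measure; rewrite ?inE //; exact: measurable_itv.
  by rewrite Z0 lebesgue_measure_itv /= lte_fin dl0 oppr0 adde0 lee_fin leNgt dl0.
move: ed; rewrite lt_min => /andP[ee0 ee1].
have [|k [V [V1 V2 V3 V4]]] := holes e; first by rewrite ep.
have := curv_variation_ge ep Kc (proj1 re) V1 V2 V3 => var.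
have := small e; rewrite ep ee1 => /(_ isT nE); apply/negP; rewrite -leNgt.
apply: le_trans (lee_wpmul2l _ var); last by rewrite lee_fin powR_ge0.
(* With at least [e] to the power [- s] holes, each contributing [c], the power of [e] cancels and
   the product is at least [c]. *)
rewrite -EFinM lee_fin mulrA ler_peMl ?(ltW c0) //.
apply: (@le_trans _ _ (e `^ s * e `^ (- s))); last by rewrite ler_wpM2l ?powR_ge0.
by rewrite powRN divff // gt_eqF // powR_gt0.
Qed.
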